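(* Let $T>0$ and let $u\in L^\infty_{[0,T]}\mathcal{S}_x$ be a smooth solution of the defocusing cubic nonlinear Schrödinger equation $$iu_t+\Delta u=|u|^2u,\qquad(x,t)\in\mathbb{R}^2\times[0,T].$$ Then $$\|u\|_{L^4_{t\in[0,T]}L^4_x}^4\lesssim T^{\frac13}\|u\|_{L^\infty_{t\in[0,T]}L^2_x}^3\|u\|_{L^\infty_{t\in[0,T]}\dot H^1_x}+T^{\frac13}\|u\|_{L^\infty_{t\in[0,T]}L^2_x}^4,$$ with an implied constant independent of $u$ and $T$.
   Context: $\mathcal S_x$ is the Schwartz class in the space variable $x\in\mathbb{R}^2$, and $\|u\|_{\dot H^1}=\||\xi|\hat u\|_{L^2}$. *)

(* Defs.v *)
From HB Require Import structures.
From mathcomp Require Import all_boot all_order all_algebra.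
From mathcomp Require Import complex.
From mathcomp Require Import all_classical all_reals all_analysis.

Set Implicit Arguments.
Unset Strict Implicit.
Unset Printing Implicit Defensive.

Import Order.TTheory GRing.Theory Num.Theory.
Import numFieldNormedType.Exports.

Local Open Scope classical_set_scope.
Local Open Scope ring_scope.
Local Open Scope complex_scope.

Section Space.
Context {R : realType}.

Definition basis_vec (j : 'I_2) : R * R := if j == 0 then (1, 0) else (0, 1).

(* [R * R] carries the max norm, whence this explicit Euclidean norm. *)
Definition enorm (x : R * R) : R := Num.sqrt (x.1 ^+ 2 + x.2 ^+ 2).

Definition dotp (x y : R * R) : R := x.1 * y.1 + x.2 * y.2.

Definition partialx (j : 'I_2) (f : R * R -> R) : R * R -> R :=
  fun x => 'D_(basis_vec j) f x.

(* C^oo: all iterated partial derivatives, in any order, exist and are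
   continuous. *)
Definition smoothx (f : R * R -> R) : Prop :=
  forall s : seq 'I_2, let g := foldr partialx f s in
    continuous g /\ forall (j : 'I_2) (x : R * R), derivable g x (basis_vec j).

Definition cpartialx (j : 'I_2) : (R * R -> R[i]) -> (R * R -> R[i]) :=
  fun f x => partialx j (fun y => complex.Re (f y)) x +i*
             partialx j (fun y => complex.Im (f y)) x.

Definition laplacian (f : R * R -> R[i]) : R * R -> R[i] :=
  fun x => \sum_(j < 2) cpartialx j (cpartialx j f) x.

Definition schwartz_seminorm (k a b : nat) (f : R * R -> R[i]) : \bar R :=
  ereal_sup (range (fun x : R * R =>
    (enorm x ^+ k *
       Normc.normc (iter a (cpartialx 0) (iter b (cpartialx 1) f) x))%:E)).

Definition schwartz (f : R * R -> R[i]) : Prop :=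
  [/\ smoothx (fun x => complex.Re (f x)), smoothx (fun x => complex.Im (f x)) &
      forall k a b, (schwartz_seminorm k a b f < +oo)%E].

Definition lebesgue2 :
    {measure set (measurableTypeR R * measurableTypeR R) -> \bar R} :=
  (@lebesgue_measure R \x @lebesgue_measure R)%E.

Definition LpNorm (p : \bar R) (f : R * R -> R[i]) : \bar R :=
  ('N[lebesgue2]_p[(fun x => (Normc.normc (f x))%:E)])%E.

Definition expi (theta : R) : R[i] := cos theta +i* sin theta.

(* Unitary normalisation, so that the homogeneous Sobolev norm of order 1 is
   the L^2 norm of the gradient. *)
Definition fourier (f : R * R -> R[i]) (xi : R * R) : R[i] :=
  let g x := expi (- dotp x xi) * f x in
  ((2 * pi)^-1)%:C *
    ((\int[lebesgue2]_x complex.Re (g x)) +i*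
     (\int[lebesgue2]_x complex.Im (g x))).

Definition H1dotNorm (f : R * R -> R[i]) : \bar R :=
  LpNorm 2%:E (fun xi => (enorm xi)%:C * fourier f xi).

End Space.

Section SpaceTime.
Context {R : realType}.
Variable T : R.

(* Only values on [A] matter: one-sided at an endpoint of an interval. *)
Definition diff_quot_within (A : set R) (f : R -> R) (t : R) :=
  (fun s => (f s - f t) / (s - t)) @ within A t^'.

Definition derivable_within (A : set R) (f : R -> R) (t : R) : Prop :=
  cvg (diff_quot_within A f t).

Definition derive_within (A : set R) (f : R -> R) (t : R) : R :=
  lim (diff_quot_within A f t).

(* [None] is the time variable, [Some j] the space variable of index [j]. *)
Definition partial (d : option 'I_2) (f : R -> R * R -> R) : R -> R * R -> R :=
  fun t x => if d is Some j then partialx j (f t) x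
             else derive_within `[0, T] (f^~ x) t.

Definition has_partial (d : option 'I_2) (f : R -> R * R -> R) t x : Prop :=
  if d is Some j then derivable (f t) x (basis_vec j)
  else derivable_within `[0, T] (f^~ x) t.

(* C^oo up to the boundary on [0, T] x R^2. *)
Definition smooth_slab (f : R -> R * R -> R) : Prop :=
  forall s : seq (option 'I_2), let g := foldr partial f s in
    {within `[0, T] `*` [set: R * R],
      continuous (fun p : R * (R * R) => g p.1 p.2)} /\
    forall (d : option 'I_2) (t : R) (x : R * R),
      t \in `[0, T] -> has_partial d g t x.

Definition cpartialt (u : R -> R * R -> R[i]) : R -> R * R -> R[i] :=
  fun t x => partial None (fun s y => complex.Re (u s y)) t x +i*
             partial None (fun s y => complex.Im (u s y)) t x.

Definition LqtNorm (q : \bar R) (g : R -> \bar R) : \bar R :=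
  ('N[@lebesgue_measure R]_q[g \_ `[0%R, T]])%E.

Definition Linfty_schwartz (u : R -> R * R -> R[i]) : Prop :=
  (forall t : R, t \in `[0, T] -> schwartz (u t)) /\
  forall k a b,
    (LqtNorm +oo (fun t => schwartz_seminorm k a b (u t)) < +oo)%E.

Definition smooth_NLS_solution (u : R -> R * R -> R[i]) : Prop :=
  [/\ smooth_slab (fun t x => complex.Re (u t x)),
      smooth_slab (fun t x => complex.Im (u t x)) &
      forall (t : R) (x : R * R), t \in `[0, T] ->
        'i%C * cpartialt u t x + laplacian (u t) x = `|u t x| ^+ 2 * u t x].

End SpaceTime.

(* Main.v *)
Require Import Defs.
From HB Require Import structures.
From mathcomp Require Import all_boot all_order all_algebra.
From mathcomp Require Import complex ring lra.
From mathcomp Require Import all_classical all_reals all_analysis.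
From mathcomp Require Import measurable_realfun.

Set Implicit Arguments.
Unset Strict Implicit.
Unset Printing Implicit Defensive.

Import Order.TTheory GRing.Theory Num.Theory.
Import numFieldNormedType.Exports.

Local Open Scope classical_set_scope.
Local Open Scope ring_scope.

(** Interaction Morawetz estimate, in the form of Colliander, Grillakis and Tzirakis.
    Let [rho] be the density [|u|^2] and [p_j] the momentum density [Im (conj u d_j u)].
    For a weight [w] on the plane, consider the action

      [Mor t = sum_j int int (d_j w)(x - y) p_j(t, x) rho(t, y) dx dy].

    If the gradient of [w] is bounded, [Mor] is bounded by a multiple of
    [|u|_2^3 |grad u|_2]. The conservation laws of mass and momentum express its time derivative
    through the Hessian of [w], and if that Hessian is positive semidefinite the terms that are
    quadratic in [grad u] form, after symmetrisation in [x] and [y], a sum of squares, while the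
    defocusing nonlinearity contributes with a good sign. What remains is
    [(1/2) int int (- Delta^2 w)(x - y) rho(x) rho(y)] as a lower bound
    ([morawetz_fixed_time], [morawetz_integrated]).

    In the plane the distance itself has a bilaplacian of the wrong sign away from the origin. The
    weight used here is the mean [M^-1 int_d^M sqrt (|x|^2 + e^2) de]. It is convex, its gradient
    is bounded independently of [d] and [M], and its bilaplacian telescopes:
    [- Delta^2 w = M^-1 (phi_d - phi_M)], where [phi_e] ([bump]) is an approximate identity as [e]
    tends to 0 and [phi_M <= 4 / M^2] ([wlap2_sum], [whess_psd], [wgrad_le2]). Letting [d] tend
    to 0 gives

      [int_0^T int rho^2 <= C (M |u|_2^3 |grad u|_2 + T M^-2 |u|_2^4)],

    and [M = T^(1/3)] is the estimate ([bump_bound], [nls_L4_bound]).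

    Two links connect this computation with the norms of the statement. The gradient is controlled
    by the Fourier side through a Plancherel inequality: a damping [exp (- e (|xi_1| + |xi_2|))]
    of the frequency integral corresponds to convolution with a product of Poisson kernels, again
    an approximate identity ([plancherel_le], [dirichlet_le]). And the essential suprema
    in time bound the mass and the Dirichlet energy at every time, because both depend
    continuously on time ([continuous_ae_le], [mass_le], [kin_le]).

    Everything is written for the real and imaginary parts of [u]. Functions are required to be
    continuous and bounded by a multiple of [1 / ((1 + x1^2) (1 + x2^2))]; for [u] and its
    derivatives up to order three this follows from the Schwartz seminorms, at all times at
    once ([nls_solution_data]). *)

(** * Dominated functions and Fubini's theorem *)

(** A fixed integrable majorant. Bounding integrands by multiples of such
    weights turns the hypotheses of Fubini's theorem and of dominated
    convergence into a bookkeeping of constants. *)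
Definition weight d (T : measurableType d) (R : realType)
    (mu : {measure set T -> \bar R}) (w : T -> R) :=
  (forall x, 0 <= w x) /\ mu.-integrable [set: T] (EFin \o w).

Definition dominated d (T : measurableType d) (R : realType) (w f : T -> R) :=
  measurable_fun [set: T] f /\ exists C, forall x, `|f x| <= C * w x.

Section dominated.
Context d (T : measurableType d) (R : realType).
Variables (mu : {measure set T -> \bar R}) (w : T -> R).
Hypothesis hw : weight mu w.

Lemma dominated_const_ge0 (f : T -> R) : (exists C, forall x, `|f x| <= C * w x) ->
  exists2 C, 0 <= C & forall x, `|f x| <= C * w x.
Proof.
move=> [C hC]; exists `|C| => // x; apply: (le_trans (hC x)).
by apply: ler_wpM2r; [exact: hw.1|exact: ler_norm].
Qed.

Lemma dominated_weight : dominated w w.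
Proof.
split; last by exists 1 => x; rewrite mul1r ger0_norm// hw.1.
by case: hw => _ /integrableP[/measurable_EFinP].
Qed.

Lemma dominated_integrable (f : T -> R) :
  dominated w f -> mu.-integrable [set: T] (EFin \o f).
Proof.
move=> [mf /dominated_const_ge0[C C0 hC]].
have iCw : mu.-integrable [set: T] (fun x => C%:E * (w x)%:E)%E.
  by apply: integrableZl => //; exact: hw.2.
apply: le_integrable iCw => //; first exact/measurable_EFinP.
move=> x _ /=; rewrite lee_fin (le_trans (hC x))// ger0_norm//.
by rewrite mulr_ge0// hw.1.
Qed.

Lemma dominatedD (f g : T -> R) :
  dominated w f -> dominated w g -> dominated w (fun x => f x + g x).
Proof.
move=> [mf [C hC]] [mg [D hD]]; split; first exact: measurable_funD.
exists (C + D) => x; rewrite mulrDl.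
by rewrite (le_trans (ler_normD _ _))// lerD.
Qed.

Lemma dominatedMl (k f : T -> R) : measurable_fun [set: T] k ->
  (exists C, forall x, `|k x| <= C) ->
  dominated w f -> dominated w (fun x => k x * f x).
Proof.
move=> mk [K hK] [mf /dominated_const_ge0[C C0 hC]].
split; first exact: measurable_funM.
exists (K * C) => x; rewrite normrM -mulrA.
by apply: ler_pM => //; exact: normr_ge0.
Qed.

Lemma dominatedZ (c : R) (f : T -> R) :
  dominated w f -> dominated w (fun x => c * f x).
Proof.
by apply: dominatedMl; [exact: measurable_cst|exists `|c|].
Qed.

Lemma dominated_Rintegral_bound (f : T -> R) C : measurable_fun [set: T] f ->
  (forall x, `|f x| <= C * w x) ->
  `|Rintegral mu setT f| <= C * Rintegral mu setT w.
Proof.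
move=> mf hC.
have df : dominated w f by split=> //; exists C.
apply: le_trans (le_normr_Rintegral _ (dominated_integrable df)) _ => //.
rewrite -RintegralZl//; last exact: hw.2.
apply: le_Rintegral => //.
- apply: dominated_integrable; split; first exact: measurableT_comp.
  by exists C => x; rewrite normr_id.
- exact: dominated_integrable (dominatedZ C dominated_weight).
Qed.

Lemma dominated_EFin_Rintegral (f : T -> R) : dominated w f ->
  ((Rintegral mu setT f)%:E = \int[mu]_x (f x)%:E)%E.
Proof.
move=> df; rewrite /Rintegral fineK//.
by apply: integrable_fin_num => //; exact: dominated_integrable.
Qed.

Lemma Rintegral_dct (f_ : nat -> T -> R) (f : T -> R) C :
  (forall n, measurable_fun [set: T] (f_ n)) ->
  (forall n x, `|f_ n x| <= C * w x) ->
  (forall x, f_ n x @[n --> \oo] --> f x) ->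
  Rintegral mu setT (f_ n) @[n --> \oo] --> Rintegral mu setT f.
Proof.
move=> mf_ hC cf.
have mf : measurable_fun [set: T] f.
  by apply: (measurable_fun_cvg mf_) => x _; exact: cf.
have [] := @dominated_convergence _ T R mu setT measurableT
  (fun n x => (f_ n x)%:E) (EFin \o f) (fun x => C%:E * (w x)%:E)%E.
- by move=> n; exact/measurable_EFinP.
- exact/measurable_EFinP.
- by apply/aeW => x _; apply/cvg_EFin; [exact: nearW|exact: cf].
- by apply: integrableZl => //; exact: hw.2.
- by apply/aeW => x n _ /=; rewrite lee_fin.
move=> inf _ h.
have := @fine_cvg _ _ _ _ _ (fine (\int[mu]_x (f x)%:E)) _.
rewrite /Rintegral; apply; rewrite fineK; first exact: h.
by apply: integrable_fin_num.
Qed.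

End dominated.

Section product_sigma_finite.
Context d1 d2 (T1 : measurableType d1) (T2 : measurableType d2) (R : realType).
Variables (m1 : {sigma_finite_measure set T1 -> \bar R}).
Variables (m2 : {sigma_finite_measure set T2 -> \bar R}).

(** The product measure under a name of its own, which carries the
    sigma-finite structure that iterating products requires. *)
Definition sf_product : set (T1 * T2) -> \bar R := (m1 \x m2)%E.

HB.instance Definition _ := Measure.on sf_product.

Lemma sf_product_sigma_finite : sigma_finite [set: T1 * T2] sf_product.
Proof.
have /sigma_finiteP[F [FT ndF hF]] := sigma_finiteT m1.
have /sigma_finiteP[G [GT ndG hG]] := sigma_finiteT m2.
exists (fun n => F n `*` G n).
  apply/esym/seteqP; split => // -[x y] _.
  have [n _ Fx] : (\bigcup_i F i) x by rewrite -FT.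
  have [m _ Gy] : (\bigcup_i G i) y by rewrite -GT.
  exists (maxn n m) => //; split.
  - by move: Fx; apply/subsetPset/ndF/leq_maxl.
  - by move: Gy; apply/subsetPset/ndG/leq_maxr.
move=> n; have [mF Ffin] := hF n; have [mG Gfin] := hG n.
split; first exact: measurableX.
rewrite /sf_product product_measure1E// lte_mul_pinfty//.
by rewrite ge0_fin_numE.
Qed.

HB.instance Definition _ := Measure_isSigmaFinite.Build _ _ _ sf_product
  sf_product_sigma_finite.

End product_sigma_finite.

Section product.
Context d1 d2 (T1 : measurableType d1) (T2 : measurableType d2) (R : realType).
Variables (m1 : {sigma_finite_measure set T1 -> \bar R}).
Variables (m2 : {sigma_finite_measure set T2 -> \bar R}).
Variables (w1 : T1 -> R) (w2 : T2 -> R).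
Hypothesis hw1 : weight m1 w1.
Hypothesis hw2 : weight m2 w2.

Definition prodw (z : T1 * T2) := w1 z.1 * w2 z.2.

Lemma weight_prod : weight (m1 \x m2)%E prodw.
Proof.
split; first by move=> x; rewrite mulr_ge0// ?hw1.1 ?hw2.1.
have mw : measurable_fun [set: T1 * T2] prodw.
  apply: measurable_funM.
  - by apply: measurableT_comp; first by case: (dominated_weight hw1).
  - by apply: measurableT_comp; first by case: (dominated_weight hw2).
apply/integrable12ltyP; first exact/measurable_EFinP.
under eq_integral => x _.
  under eq_integral => y _.
    rewrite /prodw/= normrM EFinM; over.
  rewrite ge0_integralZl//; last first.
    apply/measurable_EFinP; apply: measurableT_comp => //.
    by case: (dominated_weight hw2).
  over.
have := hw1.2 => /integrableP[mi1 i1].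
have := hw2.2 => /integrableP[mi2 i2].
rewrite ge0_integralZr//; last 2 first.
- apply/measurable_EFinP; apply: measurableT_comp => //.
  by case: (dominated_weight hw1).
- exact: integral_ge0.
apply: lte_mul_pinfty => //; first exact: integral_ge0.
by rewrite ge0_fin_numE//; exact: integral_ge0.
Qed.

Lemma dominated_section1 (F : T1 * T2 -> R) x : dominated prodw F ->
  dominated w2 (fun y => F (x, y)).
Proof.
move=> [mF [C hC]]; split; first exact: measurableT_comp.
by exists (C * w1 x) => y; rewrite -mulrA; exact: hC.
Qed.

Lemma dominated_section2 (F : T1 * T2 -> R) y : dominated prodw F ->
  dominated w1 (fun x => F (x, y)).
Proof.
move=> [mF [C hC]]; split; first exact: measurableT_comp.
exists (C * w2 y) => x; rewrite -mulrA (mulrC (w2 y)); exact: hC.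
Qed.

Lemma dominated_fubini1 (F : T1 * T2 -> R) : dominated prodw F ->
  dominated w1 (fun x => Rintegral m2 setT (fun y => F (x, y))).
Proof.
move=> dF; split.
  have /(measurable_fubini_F) mm := dominated_integrable weight_prod dF.
  exact: measurableT_comp mm.
have [mF [C hC]] := dF.
exists (C * Rintegral m2 setT w2) => x.
rewrite mulrAC; apply: dominated_Rintegral_bound => //.
  exact: measurableT_comp.
by move=> y; rewrite -mulrA; exact: hC.
Qed.

Lemma dominated_fubini2 (F : T1 * T2 -> R) : dominated prodw F ->
  dominated w2 (fun y => Rintegral m1 setT (fun x => F (x, y))).
Proof.
move=> dF; split.
  have /(measurable_fubini_G) mm := dominated_integrable weight_prod dF.
  exact: measurableT_comp mm.
have [mF [C hC]] := dF.
exists (C * Rintegral m1 setT w1) => y.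
rewrite mulrAC; apply: dominated_Rintegral_bound => //.
  exact: measurableT_comp.
by move=> x; rewrite -mulrA (mulrC (w2 y)); exact: hC.
Qed.

Lemma Rintegral_fubini1 (F : T1 * T2 -> R) : dominated prodw F ->
  Rintegral (m1 \x m2)%E setT F =
  Rintegral m1 setT (fun x => Rintegral m2 setT (fun y => F (x, y))).
Proof.
move=> dF; apply: EFin_inj.
rewrite (dominated_EFin_Rintegral weight_prod)//.
rewrite (dominated_EFin_Rintegral hw1); last exact: dominated_fubini1.
have <- := integral12_prod_meas1 (dominated_integrable weight_prod dF).
apply: eq_integral => x _; rewrite /fubini_F.
by rewrite (dominated_EFin_Rintegral hw2)//; exact: dominated_section1.
Qed.

Lemma Rintegral_fubini2 (F : T1 * T2 -> R) : dominated prodw F ->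
  Rintegral (m1 \x m2)%E setT F =
  Rintegral m2 setT (fun y => Rintegral m1 setT (fun x => F (x, y))).
Proof.
move=> dF; apply: EFin_inj.
rewrite (dominated_EFin_Rintegral weight_prod)//.
rewrite (dominated_EFin_Rintegral hw2); last exact: dominated_fubini2.
have <- := integral21_prod_meas1 (dominated_integrable weight_prod dF).
apply: eq_integral => x _; rewrite /fubini_G.
by rewrite (dominated_EFin_Rintegral hw1)//; exact: dominated_section2.
Qed.

End product.

(** * Borel measurability of continuous functions on products *)

(** Countably many measurable sets that refine every neighbourhood. Since open
    sets are then countable unions of measurable ones, continuous functions on
    a product are measurable for the product sigma-algebra. *)
Definition nbhs_base (T : topologicalType) (M : set (set T)) :=
  exists B : nat -> set T, (forall n, M (B n)) /\
    forall (x : T) A, nbhs x A -> exists n, B n x /\ B n `<=` A.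

Lemma nbhs_base_R (R : realType) :
  nbhs_base (@measurable _ (measurableTypeR R) : set (set R)).
Proof.
exists (fun n => if unpickle n is Some (p, q)
  then `](ratr p : R), (ratr q : R)[%classic else set0); split.
  by move=> n; case: (unpickle n) => [[p q]|]//; exact: measurable_itv.
move=> x A /nbhs_ballP[e /= e0 xA].
have /rat_in_itvoo[p] : x - e < x by rewrite ltrBlDr ltrDl.
rewrite in_itv/= => /andP[p1 p2].
have /rat_in_itvoo[q] : x < x + e by rewrite ltrDl.
rewrite in_itv/= => /andP[q1 q2].
exists (pickle (p, q)); rewrite pickleK; split.
  by rewrite /= in_itv/= p2 q1.
move=> y /=; rewrite in_itv/= => /andP[py yq]; apply: xA.
rewrite /ball/= ltr_norml; apply/andP; split; lra.
Qed.

Section continuous_measurable.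
Context d1 d2 (T1 : measurableType d1) (T2 : measurableType d2).
Variables (S1 S2 : topologicalType).

Lemma nbhs_base_prod (M1 : set (set S1)) (M2 : set (set S2))
    (M : set (set (S1 * S2))) :
  (forall A B, M1 A -> M2 B -> M (A `*` B)) ->
  nbhs_base M1 -> nbhs_base M2 -> nbhs_base M.
Proof.
move=> MM [B1 [mB1 hB1]] [B2 [mB2 hB2]].
exists (fun n => if unpickle n is Some (p, q) then B1 p `*` B2 q
                 else B1 0%N `*` B2 0%N); split.
  by move=> n; case: (unpickle n) => [[p q]|]; exact: MM.
move=> [x y] A [[U V] /= [xU yV] UV].
have [n [xn nU]] := hB1 _ _ xU; have [m [ym mV]] := hB2 _ _ yV.
exists (pickle (n, m)); rewrite pickleK; split => //.
by move=> -[a b] [/= /nU ? /mV ?]; exact: UV.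
Qed.

End continuous_measurable.

Lemma nbhs_base_continuous_measurable d (T : measurableType d) (S : topologicalType)
    (R : realType) (f : S -> R) (idT : T -> S) :
  nbhs_base [set A | measurable (idT @^-1` A)] ->
  continuous f -> measurable_fun [set: T] (f \o idT).
Proof.
move=> [B [mB hB]] cf; apply: (measurability _ (RGenOpens.measurableE R)).
move=> _ [_ [a [b ->] <-]]; rewrite setTI comp_preimage.
set A := f @^-1` _.
have -> : A = \bigcup_(n in [set n | B n `<=` A]) B n.
  apply/seteqP; split => [x Ax|x [n /= nA]]; last exact: nA.
  have : nbhs x A.
    by apply: cf; apply: open_nbhs_nbhs; split => //; exact: interval_open.
  by move=> /hB[n [xn nA]]; exists n.
by rewrite preimage_bigcup; apply: bigcup_measurable => n _; exact: mB.
Qed.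

Section plane.
Context {R : realType}.
Local Notation mR := (measurableTypeR R).

Lemma nbhs_base_RR :
  nbhs_base (@measurable _ (mR * mR)%type : set (set (R * R))).
Proof.
apply: nbhs_base_prod (nbhs_base_R R) (nbhs_base_R R) => A B mA mB.
exact: measurableX.
Qed.

Lemma nbhs_base_RRR :
  nbhs_base (@measurable _ (mR * (mR * mR))%type : set (set (R * (R * R)))).
Proof.
apply: nbhs_base_prod (nbhs_base_R R) nbhs_base_RR => A B mA mB.
exact: measurableX.
Qed.

Lemma continuous2_measurable (f : R * R -> R) : continuous f ->
  measurable_fun [set: mR * mR] f.
Proof.
exact: (@nbhs_base_continuous_measurable _ (mR * mR)%type _ R f id nbhs_base_RR).
Qed.

Lemma continuous3_measurable (f : R * (R * R) -> R) : continuous f ->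
  measurable_fun [set: mR * (mR * mR)] f.
Proof.
exact: (@nbhs_base_continuous_measurable _ (mR * (mR * mR))%type _ R f id
  nbhs_base_RRR).
Qed.

End plane.

(** * The Cauchy weight *)

Section weights.
Context {R : realType}.
Local Notation mR := (measurableTypeR R).

Definition jw (s : R) : R := (1 + s ^+ 2)^-1.

Lemma oneDsq_gt0 (s : R) : 0 < 1 + s ^+ 2.
Proof. by rewrite ltr_pwDl// sqr_ge0. Qed.

Lemma jw_gt0 (s : R) : 0 < jw s.
Proof. by rewrite invr_gt0 oneDsq_gt0. Qed.

Lemma jw_le1 (s : R) : jw s <= 1.
Proof. by rewrite invf_le1 ?oneDsq_gt0// lerDl sqr_ge0. Qed.

Lemma jwN (s : R) : jw (- s) = jw s.
Proof. by rewrite /jw sqrrN. Qed.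

Lemma jw_continuous : continuous jw.
Proof. exact: continuous_oneDsqrV. Qed.

Lemma weight_jw : weight (@lebesgue_measure R) jw.
Proof.
split; first by move=> s; exact/ltW/jw_gt0.
apply/integrableP; split.
  apply: measurableT_comp => //.
  exact: (continuous_measurable_fun jw_continuous).
under eq_integral => x _ do rewrite /= ger0_norm ?(ltW (jw_gt0 _))//.
rewrite ge0_symfun_integralT//; last 3 first.
- by move=> s; exact/ltW/jw_gt0.
- exact: jw_continuous.
- by move=> s; rewrite /= jwN.
rewrite -set_itvcy integral0y_oneDsqr.
by rewrite -EFinM ltry.
Qed.

Lemma cvg_jw : jw n%:R @[n --> \oo] --> (0 : R).
Proof.
apply: (@squeeze_cvgr _ _ _ _ (fun=> 0) (fun n => n.+1%:R^-1)).
- near=> n; rewrite (ltW (jw_gt0 _))/= /jw lef_pV2 ?posrE ?oneDsq_gt0//.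
  rewrite -natr1 addrC lerD2l -natrX ler_nat.
  by rewrite -[X in (X <= _)%N]expn1 leq_pexp2l//; near: n; exists 1%N.
- exact: cvg_cst.
- exact: cvg_harmonic.
Unshelve. all: by end_near. Qed.

End weights.

(** * One-dimensional calculus *)

Lemma continuous_pair (S T U : topologicalType) (f : S -> T) (g : S -> U) :
  continuous f -> continuous g -> continuous (fun x => (f x, g x)).
Proof. by move=> cf cg x; apply: cvg_pair; [exact: cf|exact: cg]. Qed.

Lemma Rintegral_eq0 d (T : measurableType d) (R : realType)
    (mu : {measure set T -> \bar R}) (f : T -> R) :
  (forall x, f x = 0) -> Rintegral mu setT f = 0.
Proof.
by move=> f0; rewrite /Rintegral integral0_eq// => x _; rewrite f0.
Qed.

Section real_derivatives.
Context {R : realType}.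
Implicit Types (f g : R -> R) (x a b : R).

Definition der f x a := is_derive (x : R) (1 : R) f a.

Lemma der_eq f x a b : der f x a -> a = b -> der f x b.
Proof. by move=> ? <-. Qed.

Lemma der_cst (c : R) x : der (fun=> c) x 0.
Proof. exact: is_derive_cst. Qed.

Lemma der_id x : der (fun s => s) x 1.
Proof. exact: is_derive_id. Qed.

Lemma derD f g x a b : der f x a -> der g x b ->
  der (fun s => f s + g s) x (a + b).
Proof. exact: is_deriveD. Qed.

Lemma derN f x a : der f x a -> der (fun s => - f s) x (- a).
Proof. exact: is_deriveN. Qed.

Lemma derB f g x a b : der f x a -> der g x b ->
  der (fun s => f s - g s) x (a - b).
Proof. exact: is_deriveB. Qed.

Lemma derM f g x a b : der f x a -> der g x b ->
  der (fun s => f s * g s) x (a * g x + f x * b).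
Proof.
move=> hf hg; have h := is_deriveM hf hg.
by apply: der_eq h _; rewrite addrC /GRing.scale/= (mulrC a).
Qed.

Lemma derX f x a n : der f x a ->
  der (fun s => f s ^+ n) x (n%:R * f x ^+ n.-1 * a).
Proof.
move=> hf; have := @is_deriveX _ _ f n x 1 a hf.
by congr (is_derive _ _ _ _); apply/funext => s; rewrite fctE.
Qed.

Lemma der_comp f g x a b : der g x b -> der f (g x) a ->
  der (fun s => f (g s)) x (a * b).
Proof.
move=> [dg <-] [df <-].
have g1 := (derivable1_diffP g x).1 dg.
have f1 := (derivable1_diffP f (g x)).1 df.
split.
  exact: ((derivable1_diffP (f \o g) x).2 (differentiable_comp g1 f1)).
have := @derive1_comp R g f x dg df.
by rewrite !derive1E.
Qed.

Lemma derV f x a : f x != 0 -> der f x a ->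
  der (fun s => (f s)^-1) x (- a / f x ^+ 2).
Proof.
move=> f0 [df <-]; split; first exact: derivableV.
by rewrite deriveV// /GRing.scale/= !mulNr mulrC.
Qed.

Lemma der_continuous f (f' : R -> R) :
  (forall x, der f x (f' x)) -> continuous f.
Proof.
move=> df x; apply: differentiable_continuous; apply/derivable1_diffP.
by have [] := df x.
Qed.

Lemma der_mvt f (f' : R -> R) (u v : R) : u < v ->
  (forall x, u <= x <= v -> der f x (f' x)) ->
  exists2 c, u < c < v & f v - f u = f' c * (v - u).
Proof.
move=> uv df.
have [||c cI h] := @MVT R f f' u v uv.
- by move=> x; rewrite in_itv/= => /andP[ux xv]; apply: df; rewrite !ltW.
- apply: derivable_within_continuous => x; rewrite in_itv/= => xI.
  by have [] := df x xI.
by exists c => //; move: cI; rewrite in_itv.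
Qed.

End real_derivatives.

Section improper_integrals.
Context {R : realType}.
Local Notation mR := (measurableTypeR R).
Local Notation mu := (@lebesgue_measure R).

(** The two half-lines have separate primitives, which admits an integrand
    with a corner at the origin, such as [exp (- e |s|) cos s]. The limits at
    infinity are taken along the integers. *)
Lemma Rintegral_FTC (f f1 f2 F1 F2 : R -> R) :
  (forall s, der F1 s (f1 s)) -> (forall s, der F2 s (f2 s)) ->
  (forall s, s <= 0 -> f s = f1 s) -> (forall s, 0 <= s -> f s = f2 s) ->
  continuous f -> (exists C, forall s, `|f s| <= C * jw s) ->
  (exists C, forall n, `|F1 (- n%:R)| <= C * jw n%:R) ->
  (exists C, forall n, `|F2 n%:R| <= C * jw n%:R) ->
  Rintegral mu setT f = F1 0 - F2 0.
Proof.
move=> d1 d2 e1 e2 cf [C hC] [D hD] [E hE].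
have mf : measurable_fun [set: mR] f by exact: continuous_measurable_fun.
have FTC (F g : R -> R) (a b : R) : a < b -> (forall s, der F s (g s)) ->
    (forall s, a <= s <= b -> f s = g s) ->
    (\int[mu]_(s in `[a, b]) (f s)%:E = (F b)%:E - (F a)%:E)%E.
  move=> ab dF fg; have cF := der_continuous dF.
  rewrite (@continuous_FTC2 _ f F)//.
  - exact: continuous_subspaceT.
  - split; [by move=> s _; have [] := dF s|..].
      exact: cvg_at_right_filter (cF _).
    exact: cvg_at_left_filter (cF _).
  - move=> s; rewrite in_itv/= => /andP[s0 s1].
    by rewrite derive1E fg ?ltW ?s0//; have [] := dF s.
pose f_ n := f \_ `[- n%:R, n%:R].
have lim1 : Rintegral mu setT (f_ n) @[n --> \oo] --> Rintegral mu setT f.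
  apply: (Rintegral_dct weight_jw (C := C)).
  - move=> n; apply/(measurable_restrictT _ _).1 => //.
    exact: measurable_funTS.
  - move=> n x; rewrite /f_ patchE; case: ifPn => // _.
    by rewrite normr0 (le_trans _ (hC x)).
  - move=> x; apply: cvg_near_cst; near=> n; rewrite /f_ patchE mem_set//=.
    rewrite in_itv/= -ler_norml; near: n; exact: nbhs_infty_ger.
have lim0 : Rintegral mu setT (f_ n) @[n --> \oo] --> F1 0 - F2 0.
  rewrite -(cvg_shiftS _).
  have -> : (fun n => Rintegral mu setT (f_ n.+1)) =
      (fun n => (F1 0 - F1 (- n.+1%:R)) + (F2 n.+1%:R - F2 0)).
    apply/funext => n; rewrite -Rintegral_mkcond.
    have n0 : (0 : R) < n.+1%:R by rewrite ltr0n.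
    have nN : - n.+1%:R < 0 :> R by rewrite oppr_lt0.
    have ifT : mu.-integrable [set: mR] (EFin \o f).
      by apply: (dominated_integrable weight_jw); split => //; exists C.
    have iI (I : interval R) : mu.-integrable [set` I] (EFin \o f).
      by apply: integrableS ifT.
    have h := @Rintegral_itvB R f (BLeft (- n.+1%:R)) (BRight n.+1%:R) 0.
    have {h} := h (iI _); rewrite !bnd_simp => /(_ (ltW nN) (ltW n0)) /eqP.
    rewrite Rintegral_itv_obnd_cbnd// subr_eq => /eqP ->.
    rewrite /Rintegral (FTC F2 f2 0 _ n0 d2); last by move=> s /andP[s0 _]; exact: e2.
    rewrite (FTC F1 f1 _ 0 nN d1); last by move=> s /andP[_ s0]; exact: e1.
    by rewrite addrC.
  have c0 (c : R) : c * jw n.+1%:R @[n --> \oo] --> (0 : R).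
    rewrite -[X in _ --> X](mulr0 c); apply: cvgM; first exact: cvg_cst.
    by rewrite (cvg_shiftS (fun n => jw n%:R)); exact: cvg_jw.
  have to0 (g : nat -> R) c : (forall n, `|g n| <= c * jw n%:R) ->
      g n.+1 @[n --> \oo] --> (0 : R).
    move=> hg; apply/norm_cvg0P.
    apply: (@squeeze_cvgr _ _ _ _ (fun=> 0) _ _ _ _ _ (c0 c)); last exact: cvg_cst.
    by apply: nearW => n /=; rewrite normr_ge0/=.
  have h1 := cvgB (@cvg_cst _ (F1 0) nat \oo _) (to0 _ _ hD).
  have h2 := cvgB (to0 _ _ hE) (@cvg_cst _ (F2 0) nat \oo _).
  by have := cvgD (h1 _ _) (h2 _ _); rewrite subr0 sub0r; exact.
exact: (cvg_unique _ lim1 lim0).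
Unshelve. all: by end_near. Qed.

Lemma Rintegral_derive0 (F f : R -> R) :
  (forall s : R, der F s (f s)) -> continuous f ->
  (exists C, forall s, `|f s| <= C * jw s) ->
  (exists C, forall s, `|F s| <= C * jw s) ->
  Rintegral mu setT f = 0.
Proof.
move=> dF cf bf [C hC].
rewrite (Rintegral_FTC dF dF (fun _ _ => erefl) (fun _ _ => erefl) cf bf) ?subrr//.
- by exists C => n; rewrite -(jwN n%:R).
- by exists C.
Qed.

End improper_integrals.

(** * Rapidly decreasing functions on the plane *)

Section plane_calculus.
Context {R : realType}.
Local Notation mR := (measurableTypeR R).
Local Notation mu := (@lebesgue_measure R).
Implicit Types (a b f k : R * R -> R) (x y : R * R) (j : bool).

(** Coordinates are indexed by booleans, [false] for the first one, so that a
    case analysis enumerates them. *)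
Definition crd j x := if j then x.2 else x.1.
Definition upd j x (s : R) := if j then (x.1, s) else (s, x.2).

Lemma upd_crd j x : upd j x (crd j x) = x.
Proof. by case: j x => -[]. Qed.

Lemma upd_continuous j x : continuous (upd j x).
Proof.
by case: j; apply: continuous_pair => s;
  [exact: cvg_cst|exact: cvg_id|exact: cvg_id|exact: cvg_cst].
Qed.

(** A relation between [f] and [f'] rather than an operator: existence is part
    of it, and [f'] can be given in any algebraic form. *)
Definition pder j f f' := forall x, der (fun s => f (upd j x s)) (crd j x) (f' x).

Lemma pder_eq j f f' g' : pder j f f' -> (forall x, f' x = g' x) -> pder j f g'.
Proof. by move=> df e x; rewrite -e; exact: df. Qed.

Lemma pder_cst j (c : R) : pder j (fun=> c) (fun=> 0).
Proof. by move=> x; exact: der_cst. Qed.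

Lemma pderD j a a' b b' : pder j a a' -> pder j b b' ->
  pder j (fun x => a x + b x) (fun x => a' x + b' x).
Proof. by move=> ha hb x; exact: derD. Qed.

Lemma pderN j a a' : pder j a a' -> pder j (fun x => - a x) (fun x => - a' x).
Proof. by move=> ha x; exact: derN. Qed.

Lemma pderB j a a' b b' : pder j a a' -> pder j b b' ->
  pder j (fun x => a x - b x) (fun x => a' x - b' x).
Proof. by move=> ha hb x; exact: derB. Qed.

Lemma pderM j a a' b b' : pder j a a' -> pder j b b' ->
  pder j (fun x => a x * b x) (fun x => a' x * b x + a x * b' x).
Proof.
by move=> ha hb x; have := derM (ha x) (hb x); rewrite upd_crd.
Qed.

Lemma pderZ j (c : R) a a' : pder j a a' ->
  pder j (fun x => c * a x) (fun x => c * a' x).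
Proof.
by move=> ha; apply: pder_eq (pderM (pder_cst j c) ha) _ => x; rewrite mul0r add0r.
Qed.

Definition w2 x : R := jw x.1 * jw x.2.

Lemma w2_gt0 x : 0 < w2 x.
Proof. by rewrite mulr_gt0 ?jw_gt0. Qed.

Lemma w2_le1 x : w2 x <= 1.
Proof. by rewrite mulr_ile1 ?jw_le1// ltW// jw_gt0. Qed.

Definition plane_measure : {sigma_finite_measure set (mR * mR)%type -> \bar R} :=
  sf_product mu mu.

Lemma weight_w2 : weight plane_measure (w2 : mR * mR -> R).
Proof. exact: weight_prod weight_jw weight_jw. Qed.

(** The decay that all derivatives of a Schwartz function share. The class is
    stable under products and under multiplication by bounded kernels. *)
Definition nice f := continuous f /\ exists C, forall x, `|f x| <= C * w2 x.

Definition bounded_kernel k := continuous k /\ exists C, forall x, `|k x| <= C.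

Lemma nice_const_ge0 f : nice f ->
  exists2 C, 0 <= C & forall x, `|f x| <= C * w2 x.
Proof. by move=> [_ h]; exact: (dominated_const_ge0 weight_w2 h). Qed.

Lemma nice_dominated f : nice f -> dominated (w2 : mR * mR -> R) f.
Proof. by move=> [cf hf]; split => //; exact: continuous2_measurable. Qed.

Lemma nice_bounded f : nice f -> bounded_kernel f.
Proof.
move=> nf; have [C C0 hC] := nice_const_ge0 nf; split; first exact: nf.1.
exists C => x; rewrite (le_trans (hC x))// -[leRHS]mulr1.
by rewrite ler_wpM2l// w2_le1.
Qed.

Lemma bounded_kernel_cst (c : R) : bounded_kernel (fun=> c).
Proof. by split; [move=> x; exact: cvg_cst|exists `|c|]. Qed.

Lemma niceD a b : nice a -> nice b -> nice (fun x => a x + b x).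
Proof.
move=> [ca [C hC]] [cb [D hD]]; split.
  by move=> x; apply: cvgD; [exact: ca|exact: cb].
by exists (C + D) => x; rewrite mulrDl (le_trans (ler_normD _ _))// lerD.
Qed.

Lemma niceN a : nice a -> nice (fun x => - a x).
Proof.
move=> [ca [C hC]]; split; first by move=> x; apply: cvgN; exact: ca.
by exists C => x; rewrite normrN.
Qed.

Lemma niceB a b : nice a -> nice b -> nice (fun x => a x - b x).
Proof. by move=> ha hb; apply: niceD => //; exact: niceN. Qed.

Lemma niceMl k a : bounded_kernel k -> nice a -> nice (fun x => k x * a x).
Proof.
move=> [ck [K hK]] na; have [C C0 hC] := nice_const_ge0 na; split.
  by move=> x; apply: cvgM; [exact: ck|exact: na.1].
exists (K * C) => x; rewrite normrM -mulrA.
by apply: ler_pM => //; exact: normr_ge0.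
Qed.

Lemma niceM a b : nice a -> nice b -> nice (fun x => a x * b x).
Proof. by move=> /nice_bounded; exact: niceMl. Qed.

Lemma niceZ (c : R) a : nice a -> nice (fun x => c * a x).
Proof. by move=> na; apply: (niceMl (k := fun=> c)) na; exact: bounded_kernel_cst. Qed.

Lemma nice_eq a b : nice a -> a =1 b -> nice b.
Proof. by move=> na /funext <-. Qed.

Definition I2 f : R := Rintegral plane_measure setT (f : mR * mR -> R).

(** By Fubini's theorem it suffices to integrate along the lines parallel to
    the axis [j], where the primitive vanishes at both ends. *)
Lemma I2_pder0 j f f' : nice f -> nice f' -> pder j f f' -> I2 f' = 0.
Proof.
move=> nf nf' df.
have df' := nice_dominated nf'.
have sec x (g : R * R -> R) : nice g -> exists C, forall s, `|g (upd j x s)| <= C * jw s.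
  move=> /nice_const_ge0[C C0 hC]; exists C => s.
  rewrite (le_trans (hC _))// ler_wpM2l//.
  by case: (j); rewrite /w2 /=; [rewrite ler_piMl|rewrite ler_piMr];
    rewrite ?jw_le1 ?(ltW (jw_gt0 _)).
have z x : Rintegral mu setT (fun s => f' (upd j x s)) = 0.
  apply: (@Rintegral_derive0 _ (fun s => f (upd j x s))).
  - by move=> s; have := df (upd j x s); case: (j).
  - move=> s; apply: continuous_comp; last exact: nf'.1.
    exact: upd_continuous.
  - exact: sec.
  - exact: sec.
rewrite /I2; case: j z {df sec} => z.
  rewrite (Rintegral_fubini1 weight_jw weight_jw)//.
  apply: Rintegral_eq0 => s.
  exact: (z (s, 0)).
rewrite (Rintegral_fubini2 weight_jw weight_jw)//.
apply: Rintegral_eq0 => s.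
exact: (z (0, s)).
Qed.

End plane_calculus.

(** * Interaction integrals *)

Section trilinear_forms.
Context {R : realType}.
Local Notation mR := (measurableTypeR R).
Local Notation mu := (@lebesgue_measure R).
Local Notation mu2 := (@plane_measure R).
Implicit Types (a b f k : R * R -> R) (x y : R * R) (j : bool).

Definition sub2 x y : R * R := (x.1 - y.1, x.2 - y.2).
Definition opp2 x : R * R := (- x.1, - x.2).

Definition w4 : (mR * mR) * (mR * mR) -> R := prodw w2 w2.

Lemma weight_w4 : weight (sf_product mu2 mu2) w4.
Proof. exact: weight_prod weight_w2 weight_w2. Qed.

Definition I4 (F : (R * R) * (R * R) -> R) : R :=
  Rintegral (sf_product mu2 mu2) setT (F : (mR * mR) * (mR * mR) -> R).

Lemma I4D F G : dominated w4 F -> dominated w4 G ->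
  I4 (fun z => F z + G z) = I4 F + I4 G.
Proof.
by move=> dF dG; rewrite /I4 RintegralD//; exact: (dominated_integrable weight_w4).
Qed.

Lemma I4Z c F : dominated w4 F -> I4 (fun z => c * F z) = c * I4 F.
Proof.
by move=> dF; rewrite /I4 RintegralZl//; exact: (dominated_integrable weight_w4).
Qed.

Lemma I4_ge0 F : (forall z, 0 <= F z) -> 0 <= I4 F.
Proof. by move=> F0; apply: Rintegral_ge0 => z _; exact: F0. Qed.

Lemma I4_swap F : dominated w4 F -> I4 (fun z => F (z.2, z.1)) = I4 F.
Proof.
move=> dF; have [mF [C hC]] := dF.
have dF' : dominated w4 (fun z => F (z.2, z.1)).
  split.
    apply: (measurableT_comp mF); apply: measurable_fun_pair => //.
  by exists C => z; rewrite (le_trans (hC _))// /w4 /prodw/= mulrC (mulrC (w2 _)) mulrC.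
rewrite /I4 (Rintegral_fubini1 weight_w2 weight_w2)//.
by rewrite (Rintegral_fubini2 weight_w2 weight_w2)//.
Qed.

Definition tri_fun k a b (z : (R * R) * (R * R)) :=
  k (sub2 z.1 z.2) * (a z.1 * b z.2).

(** The pairing of [a] with the convolution of [k] and [b]. *)
Definition tri k a b : R := I4 (tri_fun k a b).

Lemma measurable_sub2 :
  measurable_fun [set: (mR * mR) * (mR * mR)]
    (fun z => sub2 z.1 z.2 : (mR * mR)%type).
Proof.
apply: measurable_fun_pair; apply: measurable_funB.
- exact: (measurableT_comp measurable_fst measurable_fst).
- exact: (measurableT_comp measurable_fst measurable_snd).
- exact: (measurableT_comp measurable_snd measurable_fst).
- exact: (measurableT_comp measurable_snd measurable_snd).
Qed.

Lemma tri_fun_dominated k a b : bounded_kernel k -> nice a -> nice b ->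
  dominated w4 (tri_fun k a b).
Proof.
move=> [ck [K hK]] na nb.
have [A A0 hA] := nice_const_ge0 na; have [B B0 hB] := nice_const_ge0 nb.
apply: (dominatedMl weight_w4).
- exact: measurableT_comp (continuous2_measurable ck) measurable_sub2.
- by exists K.
- split.
    apply: measurable_funM.
    + exact: measurableT_comp (continuous2_measurable na.1) measurable_fst.
    + exact: measurableT_comp (continuous2_measurable nb.1) measurable_snd.
  exists (A * B) => z; rewrite normrM /w4 /prodw mulrACA.
  by apply: ler_pM => //; exact: normr_ge0.
Qed.

Lemma tri_swap k a b : bounded_kernel k -> nice a -> nice b ->
  tri k a b = tri (fun z => k (opp2 z)) b a.
Proof.
move=> hk na nb; rewrite /tri -I4_swap; last exact: tri_fun_dominated.
congr I4; apply/funext => z; rewrite /tri_fun/= (mulrC (b _)).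
by rewrite /opp2/= !opprB.
Qed.

Lemma continuous_opp2 : continuous opp2.
Proof.
apply: continuous_pair => x; apply: cvgN; [exact: cvg_fst|exact: cvg_snd].
Qed.

Lemma continuous_sub2l y : continuous (fun x => sub2 x y).
Proof.
by apply: continuous_pair => x; apply: cvgB;
  [exact: cvg_fst|exact: cvg_cst|exact: cvg_snd|exact: cvg_cst].
Qed.

Lemma bounded_kernel_opp k : bounded_kernel k ->
  bounded_kernel (fun z => k (opp2 z)).
Proof.
move=> [ck [K hK]]; split; last by exists K.
by move=> x; apply: continuous_comp; [exact: continuous_opp2|exact: ck].
Qed.

Lemma bounded_kernel_shift k y : bounded_kernel k ->
  bounded_kernel (fun x => k (sub2 x y)).
Proof.
move=> [ck [K hK]]; split; last by exists K.
by move=> x; apply: continuous_comp; [exact: continuous_sub2l|exact: ck].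
Qed.

Lemma pder_shift j k k' y : pder j k k' ->
  pder j (fun x => k (sub2 x y)) (fun x => k' (sub2 x y)).
Proof.
move=> dk x.
have e s : sub2 (upd j x s) y = upd j (sub2 x y) (s - crd j y) by case: (j).
have -> : (fun s => k (sub2 (upd j x s) y)) =
    (fun s => k (upd j (sub2 x y) (s - crd j y))).
  by apply/funext => s; rewrite e.
rewrite -[k' _]mulr1; apply: (der_comp (f := fun s => k (upd j (sub2 x y) s))).
  by apply: der_eq (derB (der_id _) (der_cst _ _)) _; rewrite subr0.
by have := dk (sub2 x y); case: (j).
Qed.

Lemma pder_opp j k k' : pder j k k' ->
  pder j (fun x => k (opp2 x)) (fun x => - k' (opp2 x)).
Proof.
move=> dk x.
have e s : opp2 (upd j x s) = upd j (opp2 x) (- s) by case: (j).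
have -> : (fun s => k (opp2 (upd j x s))) = (fun s => k (upd j (opp2 x) (- s))).
  by apply/funext => s; rewrite e.
rewrite -[k' _]mulr1 -mulrN.
apply: (der_comp (f := fun s => k (upd j (opp2 x) s))).
  exact: derN (der_id _).
by have := dk (opp2 x); case: (j).
Qed.

(** The kernel depends on [x - y], so a derivative taken off [a] falls on it
    with a minus sign. *)
Lemma tri_pderl j k k' a a' b :
  bounded_kernel k -> bounded_kernel k' -> pder j k k' ->
  nice a -> nice a' -> pder j a a' -> nice b ->
  tri k a' b = - tri k' a b.
Proof.
move=> hk hk' dk na na' da nb; apply/eqP; rewrite -addr_eq0; apply/eqP.
rewrite /tri -I4D; [|exact: tri_fun_dominated..].
rewrite /I4 (Rintegral_fubini2 weight_w2 weight_w2); last first.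
  by apply: dominatedD; exact: tri_fun_dominated.
apply: Rintegral_eq0 => y.
pose F x := b y * (k (sub2 x y) * a x).
pose F' x := b y * (k' (sub2 x y) * a x + k (sub2 x y) * a' x).
rewrite -[RHS](_ : I2 F' = 0).
  by apply: eq_Rintegral => x _; rewrite /F' /tri_fun/=; ring.
apply: (@I2_pder0 _ j F).
- by apply: niceZ; apply: niceMl => //; exact: bounded_kernel_shift.
- by apply: niceZ; apply: niceD; apply: niceMl => //; exact: bounded_kernel_shift.
- apply: pderZ; apply: pderM => //; exact: pder_shift.
Qed.

(** The sign of the integration by parts cancels against the one produced by
    differentiating [k (x - y)] in [y]. *)
Lemma tri_pderr j k k' a b b' :
  bounded_kernel k -> bounded_kernel k' -> pder j k k' ->
  nice a -> nice b -> nice b' -> pder j b b' ->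
  tri k a b' = tri k' a b.
Proof.
move=> hk hk' dk na nb nb' db.
rewrite tri_swap// (tri_pderl (j := j) (k' := fun z => - k' (opp2 z)) (a := b))//.
- rewrite [RHS]tri_swap// -[RHS]opprK; congr (- _).
  rewrite /tri -mulN1r -I4Z; last first.
    by apply: tri_fun_dominated => //; exact: bounded_kernel_opp.
  by congr I4; apply/funext => z; rewrite /tri_fun; ring.
- exact: bounded_kernel_opp.
- have [c [K hK]] := bounded_kernel_opp hk'.
  split; first by move=> x; apply: cvgN; exact: c.
  by exists K => x; rewrite normrN.
- exact: pder_opp.
Qed.

(** Linear combinations of interaction integrals are lists, so that the
    positivity of a sum can be read off its total integrand. *)
Definition term := (R * ((R * R -> R) * (R * R -> R) * (R * R -> R)))%type.

Fixpoint good_terms (L : seq term) : Prop :=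
  if L is (_, (k, a, b)) :: L' then
    [/\ bounded_kernel k, nice a & nice b] /\ good_terms L' else True.

Fixpoint sum_tri (L : seq term) : R :=
  if L is (c, (k, a, b)) :: L' then c * tri k a b + sum_tri L' else 0.

Fixpoint sum_tri_fun (L : seq term) z : R :=
  if L is (c, (k, a, b)) :: L' then c * tri_fun k a b z + sum_tri_fun L' z
  else 0.

Lemma sum_tri_funE (L : seq term) : good_terms L ->
  dominated w4 (sum_tri_fun L) /\ sum_tri L = I4 (sum_tri_fun L).
Proof.
elim: L => [_|[c [[k a] b]] L IH [[hk na nb] /IH[dL eL]]] /=.
  split; last by rewrite /I4 Rintegral_eq0.
  by split; [exact: measurable_cst|exists 0 => z; rewrite normr0 mul0r].
have dk := tri_fun_dominated hk na nb.
split; first by apply: dominatedD => //; exact: (dominatedZ weight_w4).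
rewrite I4D//; last exact: (dominatedZ weight_w4).
by rewrite I4Z// eL.
Qed.

(** Exchanging [x] and [y] does not change the integral, so positivity of the
    symmetrised integrand is enough. The Morawetz tensor is positive only in
    this sense. *)
Lemma sum_tri_ge0 (L : seq term) : good_terms L ->
  (forall x y, 0 <= sum_tri_fun L (x, y) + sum_tri_fun L (y, x)) ->
  0 <= sum_tri L.
Proof.
move=> /sum_tri_funE[dL ->] h.
rewrite -(@pmulr_lge0 _ 2)// mulrC mulr2n mulrDl mul1r -{2}I4_swap//.
rewrite -I4D//; last first.
  have [mF [C hC]] := dL; split.
    by apply: (measurableT_comp mF); exact: measurable_fun_pair.
  by exists C => z; rewrite (le_trans (hC _))// /w4 /prodw/= (mulrC (w2 z.2)).
by apply: I4_ge0 => -[x y]; exact: h.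
Qed.

End trilinear_forms.

(** * The regularised radius *)

Section bounded_kernels.
Context {R : realType}.
Implicit Types (k l : R * R -> R) (x : R * R) (j : bool).

Lemma bounded_kernelD k l : bounded_kernel k -> bounded_kernel l ->
  bounded_kernel (fun x => k x + l x).
Proof.
move=> [ck [K hK]] [cl [L hL]]; split.
  by move=> x; apply: cvgD; [exact: ck|exact: cl].
by exists (K + L) => x; rewrite (le_trans (ler_normD _ _))// lerD.
Qed.

Lemma bounded_kernelM k l : bounded_kernel k -> bounded_kernel l ->
  bounded_kernel (fun x => k x * l x).
Proof.
move=> [ck [K hK]] [cl [L hL]]; split.
  by move=> x; apply: cvgM; [exact: ck|exact: cl].
by exists (K * L) => x; rewrite normrM ler_pM.
Qed.

Lemma bounded_kernelN k : bounded_kernel k -> bounded_kernel (fun x => - k x).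
Proof.
move=> [ck [K hK]]; split; first by move=> x; apply: cvgN; exact: ck.
by exists K => x; rewrite normrN.
Qed.

Lemma bounded_kernelB k l : bounded_kernel k -> bounded_kernel l ->
  bounded_kernel (fun x => k x - l x).
Proof. by move=> hk hl; apply: bounded_kernelD => //; exact: bounded_kernelN. Qed.

Lemma bounded_kernelX k n : bounded_kernel k -> bounded_kernel (fun x => k x ^+ n).
Proof.
move=> hk; elim: n => [|n IH].
  exact: (@bounded_kernel_cst R 1).
have := bounded_kernelM hk IH; congr bounded_kernel.
by apply/funext => x; rewrite exprS.
Qed.

Lemma crd_continuous j : continuous (@crd R j).
Proof. by case: j => x; [exact: cvg_snd|exact: cvg_fst]. Qed.

Lemma pder_crd j (k : bool) : pder j (@crd R k) (fun=> (j == k)%:R).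
Proof. by case: j k => -[] x; [exact: der_id|exact: der_cst|exact: der_cst|exact: der_id]. Qed.

Lemma pderX j k k' n : pder j k k' ->
  pder j (fun x => k x ^+ n) (fun x => n%:R * k x ^+ n.-1 * k' x).
Proof. by move=> dk x; have := derX n (dk x); rewrite upd_crd. Qed.

Lemma pderV j k k' : (forall x, k x != 0) -> pder j k k' ->
  pder j (fun x => (k x)^-1) (fun x => - k' x / k x ^+ 2).
Proof.
move=> k0 dk x; have := derV (f := fun s => k (upd j x s)) (k0 _) (dk x).
by rewrite upd_crd.
Qed.

End bounded_kernels.

Section regularised_radius.
Context {R : realType}.
Variables (e : R).
Hypothesis e0 : 0 < e.
Implicit Types (x : R * R) (j k : bool).

(** The Euclidean distance smoothed at scale [e]. *)
Definition rad x : R := Num.sqrt (x.1 ^+ 2 + x.2 ^+ 2 + e ^+ 2).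
Definition irad x : R := (rad x)^-1.
Definition iradD x : R := (e + rad x)^-1.
Definition dir j x : R := crd j x * irad x.
Definition lrad x : R := ln (e + rad x).

Lemma sqr_rad x : rad x ^+ 2 = x.1 ^+ 2 + x.2 ^+ 2 + e ^+ 2.
Proof. by rewrite sqr_sqrtr// !addr_ge0// sqr_ge0. Qed.

Lemma rad_gt0 x : 0 < rad x.
Proof. by rewrite sqrtr_gt0 ltr_wpDl ?addr_ge0 ?sqr_ge0// exprn_gt0. Qed.

Lemma rad_ge x : e <= rad x.
Proof.
rewrite -(@ler_pXn2r _ 2)// ?nnegrE ?(ltW e0) ?(ltW (rad_gt0 _))//.
by rewrite sqr_rad lerDr addr_ge0// sqr_ge0.
Qed.

Lemma radD_gt0 x : 0 < e + rad x.
Proof. by rewrite addr_gt0// rad_gt0. Qed.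

Lemma crd_le_rad j x : `|crd j x| <= rad x.
Proof.
rewrite -(@ler_pXn2r _ 2)// ?nnegrE ?(ltW (rad_gt0 _))//.
rewrite sqr_rad real_normK ?num_real//; case: j => /=.
  by rewrite addrAC lerDr addr_ge0// sqr_ge0.
by rewrite -addrA lerDl addr_ge0// sqr_ge0.
Qed.

Lemma rad_continuous : continuous rad.
Proof.
have h : continuous (fun x : R * R => x.1 ^+ 2 + x.2 ^+ 2 + e ^+ 2).
  move=> x; apply: cvgD; last exact: cvg_cst.
  by apply: cvgD; rewrite /= !expr2; apply: cvgM;
    (exact: cvg_fst || exact: cvg_snd).
by move=> x; exact: (continuous_comp (h x) (@sqrt_continuous R _)).
Qed.

Lemma irad_bounded : bounded_kernel irad.
Proof.
split.
  by move=> x; apply: cvgV; [exact: lt0r_neq0 (rad_gt0 _)|exact: rad_continuous].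
exists e^-1 => x; rewrite ger0_norm ?invr_ge0 ?(ltW (rad_gt0 _))//.
by rewrite lef_pV2 ?posrE ?rad_gt0// rad_ge.
Qed.

Lemma iradD_bounded : bounded_kernel iradD.
Proof.
split.
  move=> x; apply: cvgV; first exact: lt0r_neq0 (radD_gt0 _).
  by apply: cvgD; [exact: cvg_cst|exact: rad_continuous].
exists e^-1 => x; rewrite ger0_norm ?invr_ge0 ?(ltW (radD_gt0 _))//.
by rewrite lef_pV2 ?posrE ?radD_gt0// lerDl ltW// rad_gt0.
Qed.

Lemma dir_bounded j : bounded_kernel (dir j).
Proof.
split.
  by move=> x; apply: cvgM; [exact: crd_continuous|exact: irad_bounded.1].
exists 1 => x; rewrite normrM [`|irad _|]ger0_norm ?invr_ge0 ?(ltW (rad_gt0 _))//.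
by rewrite ler_pdivrMr ?rad_gt0// mul1r crd_le_rad.
Qed.

Lemma lrad_continuous : continuous lrad.
Proof.
have h : continuous (fun x : R * R => e + rad x).
  by move=> x; apply: cvgD; [exact: cvg_cst|exact: rad_continuous].
by move=> x; exact: (continuous_comp (h x) (continuous_ln (radD_gt0 _))).
Qed.

Lemma pder_rad j : pder j rad (dir j).
Proof.
move=> x; have h : 0 < x.1 ^+ 2 + x.2 ^+ 2 + e ^+ 2.
  by rewrite -sqr_rad exprn_gt0// rad_gt0.
have -> : dir j x = (2 * rad x)^-1 * (2%:R * crd j x ^+ 1 * 1).
  by rewrite /dir /irad expr1; field; exact: lt0r_neq0 (rad_gt0 _).
have hu : forall s, rad (upd j x s) =
    Num.sqrt (s ^+ 2 + (crd (~~ j) x ^+ 2 + e ^+ 2)).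
  by move=> s; rewrite /rad; case: (j) => /=; congr Num.sqrt; ring.
have -> : (fun s => rad (upd j x s)) =
    (fun s => Num.sqrt (s ^+ 2 + (crd (~~ j) x ^+ 2 + e ^+ 2))).
  exact/funext.
have hc : crd j x ^+ 2 + (crd (~~ j) x ^+ 2 + e ^+ 2) =
    x.1 ^+ 2 + x.2 ^+ 2 + e ^+ 2 by case: (j) => /=; ring.
apply: (der_comp (f := Num.sqrt)).
  by rewrite -[X in der _ _ X]addr0; apply: derD (der_cst _ _); exact: derX (der_id _).
by rewrite hc /rad; exact: is_derive1_sqrt.
Qed.

Lemma pder_irad j : pder j irad (fun x => - dir j x * irad x ^+ 2).
Proof.
apply: pder_eq (pderV _ (pder_rad j)) _.
  by move=> x; exact: lt0r_neq0 (rad_gt0 _).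
by move=> x; rewrite /irad exprVn.
Qed.

Lemma pder_dir j k :
  pder k (dir j) (fun x => ((k == j)%:R - dir j x * dir k x) * irad x).
Proof.
apply: pder_eq (pderM (pder_crd _ _) (pder_irad _)) _ => x.
by rewrite /dir; ring.
Qed.

Lemma pder_iradD j : pder j iradD (fun x => - dir j x * iradD x ^+ 2).
Proof.
have d : pder j (fun x => e + rad x) (dir j).
  by apply: pder_eq (pderD (pder_cst _ _) (pder_rad _)) _ => x; rewrite add0r.
apply: pder_eq (pderV _ d) _.
  by move=> x; exact: lt0r_neq0 (radD_gt0 _).
by move=> x; rewrite /iradD exprVn.
Qed.

Lemma pder_lrad j : pder j lrad (fun x => dir j x * iradD x).
Proof.
move=> x; rewrite mulrC; apply: (der_comp (f := @ln R)).
  have d : pder j (fun x => e + rad x) (dir j).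
    by apply: pder_eq (pderD (pder_cst _ _) (pder_rad _)) _ => y; rewrite add0r.
  exact: d.
by rewrite upd_crd; exact: is_derive1_ln (radD_gt0 _).
Qed.

Lemma sqr_dir x : dir false x ^+ 2 + dir true x ^+ 2 = 1 - e ^+ 2 * irad x ^+ 2.
Proof.
rewrite /dir /irad/=; apply: (@mulIf _ (rad x ^+ 2)).
  by rewrite expf_neq0// lt0r_neq0// rad_gt0.
have r0 := lt0r_neq0 (rad_gt0 x).
have h := sqr_rad x.
transitivity (x.1 ^+ 2 + x.2 ^+ 2); first by field.
transitivity (rad x ^+ 2 - e ^+ 2); last by field.
by rewrite h addrK.
Qed.

(** With [s] for [rad x] and [r] for the Euclidean norm of [x], this is, up to
    a multiple of the identity that cancels in differences over [e], the
    Hessian of the primitive [(e s + r^2 ln (e + s)) / 2] of [s] with respect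
    to [e]. The gradient of the primitive is, modulo [x], the field [crd j x *
    lrad x]. *)
Definition hess j k x : R :=
  (j == k)%:R * lrad x + dir j x * dir k x * (1 - e * iradD x).

Definition hess_lap x : R := 2 * lrad x - e * irad x.

Definition hess_lap1 j x : R :=
  2 * (dir j x * iradD x) + e * (dir j x * irad x ^+ 2).

Definition hess_lap2 j x : R :=
  2 * ((1 - dir j x ^+ 2) * irad x * iradD x - dir j x ^+ 2 * iradD x ^+ 2) +
  e * (irad x ^+ 3 * (1 - 3 * dir j x ^+ 2)).

(** The bilaplacian of the primitive above. It is positive and scales as an
    approximate identity, [bump] at scale [e] being [e^-2] times [bump] at
    scale [1] evaluated at [x / e]. *)
Definition bump x : R := e * irad x ^+ 3 + 3 * e ^+ 3 * irad x ^+ 5.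

Lemma pder_grad j k : pder k (fun x => crd j x * lrad x) (hess j k).
Proof.
apply: pder_eq (pderM (pder_crd _ _) (pder_lrad _)) _ => x.
rewrite /hess eq_sym; congr (_ + _); rewrite /dir /irad /iradD.
have r0 := lt0r_neq0 (rad_gt0 x); have rd0 := lt0r_neq0 (radD_gt0 x).
by field; apply/andP.
Qed.

Lemma hess_tr x : hess false false x + hess true true x = hess_lap x + 1.
Proof.
rewrite /hess /hess_lap !eqxx !mul1r -!expr2.
transitivity (2 * lrad x +
    (dir false x ^+ 2 + dir true x ^+ 2) * (1 - e * iradD x)); first by ring.
rewrite sqr_dir -addrA; congr (_ + _); rewrite /irad /iradD.
have r0 := lt0r_neq0 (rad_gt0 x); have rd0 := lt0r_neq0 (radD_gt0 x).
by field; apply/andP.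
Qed.

Lemma pder_hess_lap j : pder j hess_lap (hess_lap1 j).
Proof.
apply: pder_eq (pderB (pderZ 2 (pder_lrad j)) (pderZ e (pder_irad j))) _ => x.
by rewrite /hess_lap1; ring.
Qed.

Lemma pder_hess_lap1 j : pder j (hess_lap1 j) (hess_lap2 j).
Proof.
apply: pder_eq (pderD (pderZ 2 (pderM (pder_dir j j) (pder_iradD j)))
  (pderZ e (pderM (pder_dir j j) (pderX 2 (pder_irad j))))) _ => x.
by rewrite /hess_lap2 eqxx mulr1n /= expr1; ring.
Qed.

Lemma hess_lap2_sum x : hess_lap2 false x + hess_lap2 true x = bump x.
Proof.
rewrite /hess_lap2 /bump.
set D := dir false x; set D' := dir true x; set i := irad x; set d := iradD x.
transitivity (2 * ((2 - (D ^+ 2 + D' ^+ 2)) * i * d - (D ^+ 2 + D' ^+ 2) * d ^+ 2)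
  + e * (i ^+ 3 * (2 - 3 * (D ^+ 2 + D' ^+ 2)))); first by ring.
rewrite /D /D' sqr_dir -/i /i /d /irad /iradD.
have r0 := lt0r_neq0 (rad_gt0 x); have rd0 := lt0r_neq0 (radD_gt0 x).
by field; apply/andP.
Qed.

Lemma bump_le x : bump x <= 4 / e ^+ 2.
Proof.
have i0 : 0 <= irad x by rewrite invr_ge0 ltW// rad_gt0.
have ie : irad x <= e^-1 by rewrite lef_pV2 ?posrE ?rad_gt0// rad_ge.
have e00 := lt0r_neq0 e0.
have -> : 4 / e ^+ 2 = e * e^-1 ^+ 3 + 3 * e ^+ 3 * e^-1 ^+ 5 by field.
apply: lerD; apply: ler_wpM2l.
- exact: ltW.
- by rewrite lerXn2r// nnegrE invr_ge0 ltW.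
- by rewrite mulr_ge0// exprn_ge0// ltW.
- by rewrite lerXn2r// nnegrE invr_ge0 ltW.
Qed.

Lemma bump_ge x : e * irad x ^+ 3 <= bump x.
Proof.
rewrite /bump lerDl; apply: mulr_ge0; first by rewrite mulr_ge0// exprn_ge0// ltW.
by rewrite exprn_ge0// invr_ge0 ltW// rad_gt0.
Qed.

End regularised_radius.

(** * The Morawetz weight *)

Section morawetz_weight.
Context {R : realType}.
Variables (M d : R).
Hypotheses (d0 : 0 < d) (dM : d < M).
Implicit Types (x : R * R) (j k : bool).

Let M0 : 0 < M. Proof. exact: lt_trans d0 dM. Qed.

(** The weight is the mean [M^-1 int_d^M sqrt (|x|^2 + e^2) de] of smoothed
    distances. Its gradient is [wgrad], the logarithms being the primitives of
    [1 / rad] in [e]. *)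
Definition wlog x : R := M^-1 * (lrad M x - lrad d x).
Definition wgrad j x : R := crd j x * wlog x.
Definition whess j k x : R := M^-1 * (hess M j k x - hess d j k x).
Definition wlap x : R := M^-1 * (hess_lap M x - hess_lap d x).
Definition wlap1 j x : R := M^-1 * (hess_lap1 M j x - hess_lap1 d j x).
Definition wlap2 j x : R := M^-1 * (hess_lap2 M j x - hess_lap2 d j x).

Lemma pder_wgrad j k : pder k (wgrad j) (whess j k).
Proof.
have -> : wgrad j = (fun x => M^-1 * (crd j x * lrad M x - crd j x * lrad d x)).
  by apply/funext => x; rewrite /wgrad /wlog; ring.
by apply: pderZ; apply: pderB; apply: pder_grad.
Qed.

Lemma whess_tr x : whess false false x + whess true true x = wlap x.
Proof.
rewrite /whess /wlap -mulrDr; congr (_ * _).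
transitivity ((hess M false false x + hess M true true x) -
  (hess d false false x + hess d true true x)); first by ring.
by rewrite !hess_tr//; ring.
Qed.

Lemma whessC j k x : whess j k x = whess k j x.
Proof. by rewrite /whess /hess eq_sym (mulrC (dir M j x)) (mulrC (dir d j x)). Qed.

Lemma pder_wlap j : pder j wlap (wlap1 j).
Proof. by apply: pderZ; apply: pderB; apply: pder_hess_lap. Qed.

Lemma pder_wlap1 j : pder j (wlap1 j) (wlap2 j).
Proof. by apply: pderZ; apply: pderB; apply: pder_hess_lap1. Qed.

(** Averaging over the scale turns the bilaplacian into a difference of two
    bumps, the one at the small scale [d] carrying the good sign. *)
Lemma wlap2_sum x : wlap2 false x + wlap2 true x = M^-1 * (bump M x - bump d x).
Proof. by rewrite -!hess_lap2_sum// /wlap2; ring. Qed.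

Lemma rad_opp e x : rad e (opp2 x) = rad e x.
Proof. by rewrite /rad /opp2/= !sqrrN. Qed.

Lemma whess_opp j k x : whess j k (opp2 x) = whess j k x.
Proof.
have h e : hess e j k (opp2 x) = hess e j k x.
  rewrite /hess /dir /lrad /irad /iradD rad_opp.
  have c i : crd i (opp2 x) = - crd i x by case: i.
  by rewrite !c; ring.
by rewrite /whess !h.
Qed.

Lemma lrad_diff_ge0 x : 0 <= lrad M x - lrad d x.
Proof.
rewrite subr_ge0 /lrad ler_ln ?posrE ?radD_gt0// lerD ?(ltW dM)//.
by rewrite ler_wsqrtr// lerD// lerXn2r ?nnegrE// ltW.
Qed.

(** Uses [ln (1 + t) <= t] and the fact that [rad] is 1-Lipschitz in the
    scale. *)
Lemma lrad_diff_le x : lrad M x - lrad d x <= 2 * (M - d) * iradD d x.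
Proof.
have rd := radD_gt0 d0 x; have rM := radD_gt0 M0 x.
rewrite -ln_div ?posrE//.
have h : rad M x - rad d x <= M - d.
  rewrite lerBlDr -(@ler_pXn2r _ 2)// ?nnegrE ?(ltW (rad_gt0 _ _))//; last first.
    by rewrite addr_ge0 ?subr_ge0 ?(ltW dM)// ltW// rad_gt0.
  rewrite sqrrD !sqr_rad//.
  have h1 : 0 <= (M - d) * (rad d x - d).
    by rewrite mulr_ge0 ?subr_ge0 ?(ltW dM)// rad_ge.
  rewrite mulr2n; nra.
have -> : (M + rad M x) / (d + rad d x) =
    1 + ((M - d) + (rad M x - rad d x)) / (d + rad d x).
  by field; exact: lt0r_neq0.
apply: le_trans (le_ln1Dx _) _.
  have : 0 < (M + rad M x) / (d + rad d x) by rewrite divr_gt0.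
  have -> : (M + rad M x) / (d + rad d x) =
    1 + ((M - d) + (rad M x - rad d x)) / (d + rad d x).
    by field; exact: lt0r_neq0.
  by rewrite -ltrBlDl sub0r.
by rewrite ler_pM2r ?invr_gt0//; lra.
Qed.

(** The bound is uniform in [d] and [M], which allows [d] to tend to zero at
    fixed boundary terms. *)
Lemma wgrad_le2 j x : `|wgrad j x| <= 2.
Proof.
rewrite normrM [`|wlog x|]ger0_norm; last first.
  by rewrite mulr_ge0 ?invr_ge0 ?(ltW M0)// lrad_diff_ge0.
have h : wlog x <= 2 * iradD d x.
  rewrite /wlog ler_pdivrMl//; apply: le_trans (lrad_diff_le x) _.
  rewrite mulrA; apply: ler_wpM2r.
    by rewrite invr_ge0 ltW// radD_gt0.
  by move: d0; lra.
apply: le_trans (ler_pM _ _ (crd_le_rad d0 j x) h) _ => //.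
  by rewrite mulr_ge0 ?invr_ge0 ?(ltW M0)// lrad_diff_ge0.
have rd := radD_gt0 d0 x.
by rewrite mulrCA ler_piMr// /iradD ler_pdivrMr// mul1r lerDr ltW.
Qed.

Lemma wlog_bounded : bounded_kernel wlog.
Proof.
split.
  move=> x; apply: cvgM; first exact: cvg_cst.
  by apply: cvgB; exact: lrad_continuous.
exists (M^-1 * (2 * (M - d) * d^-1)) => x.
rewrite ger0_norm; last first.
  by rewrite mulr_ge0 ?invr_ge0 ?(ltW M0)// lrad_diff_ge0.
rewrite ler_pM2l ?invr_gt0//; apply: le_trans (lrad_diff_le x) _.
apply: ler_wpM2l; first by rewrite mulr_ge0// subr_ge0 ltW.
by rewrite lef_pV2 ?posrE ?radD_gt0// lerDl ltW// rad_gt0.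
Qed.

Lemma wgrad_bounded j : bounded_kernel (wgrad j).
Proof.
split; last by exists 2; exact: wgrad_le2.
by move=> x; apply: cvgM; [exact: crd_continuous|exact: wlog_bounded.1].
Qed.

Lemma whess_bounded j k : bounded_kernel (whess j k).
Proof.
have -> : whess j k = (fun x => (j == k)%:R * wlog x +
    M^-1 * (dir M j x * dir M k x * (1 - M * iradD M x) -
            dir d j x * dir d k x * (1 - d * iradD d x))).
  by apply/funext => x; rewrite /whess /hess /wlog; ring.
have h (e : R) : 0 < e ->
    bounded_kernel (fun x => dir e j x * dir e k x * (1 - e * iradD e x)).
  move=> e0; apply: bounded_kernelM.
    by apply: bounded_kernelM; exact: dir_bounded.
  apply: bounded_kernelB; first exact: bounded_kernel_cst.
  by apply: bounded_kernelM; [exact: bounded_kernel_cst|exact: iradD_bounded].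
apply: bounded_kernelD; first apply: bounded_kernelM.
- exact: bounded_kernel_cst.
- exact: wlog_bounded.
- apply: bounded_kernelM; first exact: bounded_kernel_cst.
  by apply: bounded_kernelB; exact: h.
Qed.

Lemma wlap_bounded : bounded_kernel wlap.
Proof.
have := bounded_kernelD (whess_bounded false false) (whess_bounded true true).
by congr bounded_kernel; apply/funext => x; rewrite whess_tr.
Qed.

Lemma wlap1_bounded j : bounded_kernel (wlap1 j).
Proof.
have h (e : R) : 0 < e -> bounded_kernel (hess_lap1 e j).
  move=> e0; apply: bounded_kernelD; apply: bounded_kernelM;
    try exact: bounded_kernel_cst; apply: bounded_kernelM.
  - exact: dir_bounded.
  - exact: iradD_bounded.
  - exact: dir_bounded.
  - by apply: bounded_kernelX; exact: irad_bounded.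
apply: bounded_kernelM; first exact: bounded_kernel_cst.
by apply: bounded_kernelB; exact: h.
Qed.

Lemma wlap2_bounded j : bounded_kernel (wlap2 j).
Proof.
have h (e : R) : 0 < e -> bounded_kernel (hess_lap2 e j).
  move=> e0.
  have hc c := @bounded_kernel_cst R c.
  have hd n : bounded_kernel (fun x => dir e j x ^+ n).
    by apply: bounded_kernelX; exact: dir_bounded.
  have hi := irad_bounded e0; have hD := iradD_bounded e0.
  apply: bounded_kernelD; apply: bounded_kernelM => //.
  - apply: bounded_kernelB; apply: bounded_kernelM => //.
    + by apply: bounded_kernelM => //; apply: bounded_kernelB.
    + exact: bounded_kernelX.
  - apply: bounded_kernelM; first exact: bounded_kernelX.
    by apply: bounded_kernelB => //; apply: bounded_kernelM.
apply: bounded_kernelM; first exact: bounded_kernel_cst.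
by apply: bounded_kernelB; exact: h.
Qed.

(** Up to a constant, [lrad - e * irad] is the eigenvalue of [hess] in the
    radial direction. With [s] for [rad], its derivative in the scale is [e^2
    / s^3], which is non-negative. *)
Lemma radial_eigen_mono x :
  lrad d x - d * irad d x <= lrad M x - M * irad M x.
Proof.
pose r2 := x.1 ^+ 2 + x.2 ^+ 2.
have r20 : 0 <= r2 by rewrite addr_ge0// sqr_ge0.
pose s (e : R) := Num.sqrt (r2 + e ^+ 2).
pose f (e : R) := ln (e + s e) - e * (s e)^-1.
have s0 e : 0 < e -> 0 < s e by move=> e0; exact: (rad_gt0 e0 x).
have ds e : 0 < e -> der s e (e / s e).
  move=> e0.
  have -> : e / s e = (2 * s e)^-1 * (2%:R * e ^+ 1 * 1).
    by rewrite expr1; field; exact: lt0r_neq0 (s0 _ e0).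
  apply: (der_comp (f := Num.sqrt)).
    by rewrite -[X in der _ _ X]add0r; apply: derD (der_cst _ _) _; exact: derX (der_id _).
  by apply: is_derive1_sqrt; rewrite ltr_wpDl// exprn_gt0.
have df e : 0 < e -> der f e (e ^+ 2 / s e ^+ 3).
  move=> e0; have se := s0 _ e0; have se0 := lt0r_neq0 se.
  have ese : 0 < e + s e by rewrite addr_gt0.
  have d1 : der (fun t => ln (t + s t)) e ((e + s e)^-1 * (1 + e / s e)).
    apply: (der_comp (f := @ln R)); first exact: derD (der_id _) (ds _ e0).
    exact: is_derive1_ln.
  have d2 := derM (der_id e) (derV (f := s) se0 (ds _ e0)).
  apply: der_eq (derB d1 d2) _.
  by field; rewrite se0/= lt0r_neq0.
have [|c /andP[dc _] h] := der_mvt dM (f := f) (f' := fun e => e ^+ 2 / s e ^+ 3).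
  by move=> e /andP[de _]; apply: df; exact: lt_le_trans de.
have c0 : 0 < c := lt_trans d0 dc.
rewrite -subr_ge0.
have -> : lrad M x - M * irad M x - (lrad d x - d * irad d x) = f M - f d by [].
rewrite h mulr_ge0 ?subr_ge0 ?(ltW dM)//.
by rewrite divr_ge0 ?sqr_ge0// exprn_ge0// ltW// s0.
Qed.

(** The Hessian of a radial function has one angular and one radial
    eigenvalue. The angular one is [wlog], non-negative because [lrad]
    increases with the scale; the radial one is non-negative by
    [radial_eigen_mono]. *)
Lemma whess_psd x v1 v2 :
  0 <= whess false false x * v1 ^+ 2 + 2 * whess false true x * (v1 * v2) +
       whess true true x * v2 ^+ 2.
Proof.
pose gam e := irad e x ^+ 2 * (1 - e * iradD e x).
have hE e j k : hess e j k x = (j == k)%:R * lrad e x + crd j x * crd k x * gam e.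
  by rewrite /hess /dir /gam; ring.
pose g := M^-1 * (gam M - gam d).
have wE j k : whess j k x = (j == k)%:R * wlog x + crd j x * crd k x * g.
  by rewrite /whess !hE /wlog /g; ring.
have rg e : 0 < e -> (x.1 ^+ 2 + x.2 ^+ 2) * gam e = 1 - e * irad e x.
  move=> e0; have := hess_tr e0 x; rewrite !hE /hess_lap/= => h.
  by apply: (@addrI _ (2 * lrad e x)); rewrite [RHS]addrCA addrC -h; ring.
have w0 : 0 <= wlog x.
  by rewrite mulr_ge0 ?invr_ge0 ?(ltW M0)// lrad_diff_ge0.
have radial0 : 0 <= wlog x + (x.1 ^+ 2 + x.2 ^+ 2) * g.
  have -> : wlog x + (x.1 ^+ 2 + x.2 ^+ 2) * g = M^-1 *
      ((lrad M x - M * irad M x) - (lrad d x - d * irad d x)).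
    transitivity (wlog x + M^-1 * ((x.1 ^+ 2 + x.2 ^+ 2) * gam M -
      (x.1 ^+ 2 + x.2 ^+ 2) * gam d)); first by rewrite /g; ring.
    by rewrite !rg// /wlog; ring.
  by rewrite mulr_ge0 ?invr_ge0 ?(ltW M0)// subr_ge0 radial_eigen_mono.
rewrite !wE/= !mul0r add0r !mul1r.
set r2 := x.1 ^+ 2 + x.2 ^+ 2 in radial0.
have -> : (wlog x + x.1 * x.1 * g) * v1 ^+ 2 + 2 * (x.1 * x.2 * g) * (v1 * v2) +
    (wlog x + x.2 * x.2 * g) * v2 ^+ 2 =
    wlog x * (v1 ^+ 2 + v2 ^+ 2) + g * (x.1 * v1 + x.2 * v2) ^+ 2 by ring.
have r20 : 0 <= r2 by rewrite addr_ge0// sqr_ge0.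
have [r2z|r2p] := eqVneq r2 0.
  have x10 : x.1 = 0.
    by apply/eqP; rewrite -(@sqrf_eq0 R); move/eqP: r2z; rewrite paddr_eq0 ?sqr_ge0// => /andP[].
  have x20 : x.2 = 0.
    by apply/eqP; rewrite -(@sqrf_eq0 R); move/eqP: r2z; rewrite paddr_eq0 ?sqr_ge0// => /andP[].
  by rewrite x10 x20 !mul0r addr0 expr0n/= mulr0 addr0 mulr_ge0// addr_ge0// sqr_ge0.
(* Lagrange's identity splits the form into its radial and angular parts. *)
have r2gt : 0 < r2 by rewrite lt_neqAle eq_sym r2p r20.
rewrite -(pmulr_rge0 _ r2gt).
have -> : r2 * (wlog x * (v1 ^+ 2 + v2 ^+ 2) + g * (x.1 * v1 + x.2 * v2) ^+ 2) =
  (wlog x + r2 * g) * (x.1 * v1 + x.2 * v2) ^+ 2 +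
  wlog x * (x.1 * v2 - x.2 * v1) ^+ 2 by rewrite /r2; ring.
by rewrite addr_ge0// mulr_ge0// sqr_ge0.
Qed.

End morawetz_weight.

(** * The interaction Morawetz inequality at a fixed time *)

Section fixed_time.
Context {R : realType}.
Implicit Types (a b f ker : R * R -> R) (x y : R * R) (j k : bool).

Lemma triDl ker a a' b : bounded_kernel ker -> nice a -> nice a' -> nice b ->
  tri ker (fun x => a x + a' x) b = tri ker a b + tri ker a' b.
Proof.
move=> hk na na' nb; rewrite /tri -I4D; [|exact: tri_fun_dominated..].
by congr I4; apply/funext => z; rewrite /tri_fun; ring.
Qed.

Lemma triDr ker a b b' : bounded_kernel ker -> nice a -> nice b -> nice b' ->
  tri ker a (fun x => b x + b' x) = tri ker a b + tri ker a b'.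
Proof.
move=> hk na nb nb'; rewrite /tri -I4D; [|exact: tri_fun_dominated..].
by congr I4; apply/funext => z; rewrite /tri_fun; ring.
Qed.

Lemma triDk ker ker' a b : bounded_kernel ker -> bounded_kernel ker' -> nice a -> nice b ->
  tri (fun x => ker x + ker' x) a b = tri ker a b + tri ker' a b.
Proof.
move=> hk hk' na nb; rewrite /tri -I4D; [|exact: tri_fun_dominated..].
by congr I4; apply/funext => z; rewrite /tri_fun; ring.
Qed.

Lemma triZr ker a b (c : R) : bounded_kernel ker -> nice a -> nice b ->
  tri ker a (fun x => c * b x) = c * tri ker a b.
Proof.
move=> hk na nb; rewrite /tri -I4Z; last exact: tri_fun_dominated.
by congr I4; apply/funext => z; rewrite /tri_fun; ring.
Qed.

Variables (M d : R).
Hypotheses (d0 : 0 < d) (dM : d < M).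
Variables (u v : R * R -> R) (u1 v1 : bool -> R * R -> R).
Variables (u2 v2 u3 v3 : bool -> bool -> R * R -> R).
Hypotheses (nu : nice u) (nv : nice v).
Hypotheses (nu1 : forall j, nice (u1 j)) (nv1 : forall j, nice (v1 j)).
Hypotheses (nu2 : forall j k, nice (u2 j k)) (nv2 : forall j k, nice (v2 j k)).
Hypotheses (nu3 : forall j k, nice (u3 j k)) (nv3 : forall j k, nice (v3 j k)).
Hypotheses (du : forall j, pder j u (u1 j)) (dv : forall j, pder j v (v1 j)).
Hypotheses (du1 : forall k j, pder k (u1 j) (u2 k j)).
Hypotheses (dv1 : forall k j, pder k (v1 j) (v2 k j)).
Hypotheses (du2 : forall j k, pder j (u2 k k) (u3 j k)).
Hypotheses (dv2 : forall j k, pder j (v2 k k) (v3 j k)).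
Hypotheses (u2C : forall x, u2 false true x = u2 true false x).
Hypotheses (v2C : forall x, v2 false true x = v2 true false x).

(** Densities attached to [u + i v], where [u1 j], [u2 k j] and [u3 j k] stand
    for the derivatives [d_j u], [d_k d_j u] and [d_j d_k d_k u]. For a
    solution, the mass density [rho] has time derivative [rhot], which is
    minus twice the divergence of the momentum density [mom], and [mom j] has
    time derivative [momt j], the divergence of [stress]. *)
Definition rho x := u x ^+ 2 + v x ^+ 2.
Definition rho1 j x := 2 * (u x * u1 j x + v x * v1 j x).
Definition mom j x := u x * v1 j x - v x * u1 j x.
Definition lapl (f2 : bool -> bool -> R * R -> R) x := f2 false false x + f2 true true x.
Definition lapl1 (f3 : bool -> bool -> R * R -> R) j x := f3 j false x + f3 j true x.
Definition en j k x := u1 j x * u1 k x + v1 j x * v1 k x.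
Definition lapl_rho x :=
  2 * (en false false x + en true true x + u x * lapl u2 x + v x * lapl v2 x).
Definition press x := 2^-1 * (lapl_rho x - rho x ^+ 2).
Definition press1 j x := u1 j x * lapl u2 x + u x * lapl1 u3 j x +
  (v1 j x * lapl v2 x + v x * lapl1 v3 j x) - rho x * rho1 j x +
  2 * (u1 false x * u2 j false x + u1 true x * u2 j true x +
       (v1 false x * v2 j false x + v1 true x * v2 j true x)).
Definition stress j k x := (j == k)%:R * press x - 2 * en j k x.
Definition stress1 j k x := (j == k)%:R * press1 k x -
  2 * (u2 k j x * u1 k x + u1 j x * u2 k k x + (v2 k j x * v1 k x + v1 j x * v2 k k x)).
Definition momt j x := stress1 j false x + stress1 j true x.
Definition rhot x := - 2 * (u x * lapl v2 x - v x * lapl u2 x).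

Let nsq a : nice a -> nice (fun x => a x ^+ 2).
Proof.
by move=> na; apply: nice_eq (niceM na na) _ => x; rewrite expr2.
Qed.

Lemma nice_rho : nice rho.
Proof. by apply: niceD; apply: nsq. Qed.

Lemma nice_rho1 j : nice (rho1 j).
Proof. by apply: niceZ; apply: niceD; apply: niceM. Qed.

Lemma nice_mom j : nice (mom j).
Proof. by apply: niceB; apply: niceM. Qed.

Lemma nice_en j k : nice (en j k).
Proof. by apply: niceD; apply: niceM. Qed.

Lemma nice_lapl_rho : nice lapl_rho.
Proof.
apply: niceZ; apply: niceD; last by apply: niceM => //; apply: niceD.
apply: niceD; last by apply: niceM => //; apply: niceD.
by apply: niceD; exact: nice_en.
Qed.

Lemma nice_press : nice press.
Proof.
by apply: niceZ; apply: niceB; [exact: nice_lapl_rho|apply/nsq/nice_rho].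
Qed.

Lemma nice_press1 j : nice (press1 j).
Proof.
have nl (f2 : bool -> bool -> R * R -> R) : (forall j k, nice (f2 j k)) -> nice (lapl f2).
  by move=> n2; apply: niceD.
have nl1 (f3 : bool -> bool -> R * R -> R) : (forall j k, nice (f3 j k)) -> nice (lapl1 f3 j).
  by move=> n3; apply: niceD.
apply: niceD; last by apply: niceZ; apply: niceD; apply: niceD; apply: niceM.
apply: niceB; last by apply: niceM; [exact: nice_rho|exact: nice_rho1].
by apply: niceD; apply: niceD; apply: niceM => //; (exact: nl || exact: nl1).
Qed.

Lemma nice_stress j k : nice (stress j k).
Proof. by apply: niceB; apply: niceZ; [exact: nice_press|exact: nice_en]. Qed.

Lemma nice_stress1 j k : nice (stress1 j k).
Proof.
apply: niceB; apply: niceZ; first exact: nice_press1.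
by apply: niceD; apply: niceD; apply: niceM.
Qed.

Lemma pder_rho j : pder j rho (rho1 j).
Proof.
by apply: pder_eq (pderD (pderX 2 (du j)) (pderX 2 (dv j))) _ => x;
  rewrite /rho1 /=; ring.
Qed.

Lemma pder_rho1 j : pder j (rho1 j)
  (fun x => 2 * (en j j x + u x * u2 j j x + v x * v2 j j x)).
Proof.
apply: pder_eq (pderZ 2 (pderD (pderM (du j) (du1 j j)) (pderM (dv j) (dv1 j j)))) _.
by move=> x; rewrite /en; ring.
Qed.

Lemma pder_mom j : pder j (mom j) (fun x => u x * v2 j j x - v x * u2 j j x).
Proof.
apply: pder_eq (pderB (pderM (du j) (dv1 j j)) (pderM (dv j) (du1 j j))) _ => x.
by ring.
Qed.

Lemma pder_en k i j : pder k (en i j) (fun x => u2 k i x * u1 j x + u1 i x * u2 k j x +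
  (v2 k i x * v1 j x + v1 i x * v2 k j x)).
Proof. by apply: pderD; apply: pderM. Qed.

Lemma pder_press k : pder k press (press1 k).
Proof.
have dlu : pder k (lapl u2) (lapl1 u3 k) by apply: pderD.
have dlv : pder k (lapl v2) (lapl1 v3 k) by apply: pderD.
have := pderZ 2^-1 (pderB (pderZ 2 (pderD (pderD (pderD (pder_en k false false)
  (pder_en k true true)) (pderM (du k) dlu)) (pderM (dv k) dlv)))
  (pderX 2 (pder_rho k))).
by move=> h; apply: pder_eq h _ => x; rewrite /press1 /=; field.
Qed.

Lemma pder_stress j k : pder k (stress j k) (stress1 j k).
Proof. by apply: pderB; apply: pderZ; [exact: pder_press|exact: pder_en]. Qed.

Lemma tri_momt j : tri (wgrad M d j) (momt j) rho =
  - tri (whess M d j false) (stress j false) rho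
  - tri (whess M d j true) (stress j true) rho.
Proof.
rewrite triDl; [|exact: wgrad_bounded|exact: nice_stress1..|exact: nice_rho].
by congr (_ + _); apply: tri_pderl;
  [exact: wgrad_bounded|exact: whess_bounded|exact: pder_wgrad|
   exact: nice_stress|exact: nice_stress1|exact: pder_stress|exact: nice_rho|
   exact: wgrad_bounded|exact: whess_bounded|exact: pder_wgrad|
   exact: nice_stress|exact: nice_stress1|exact: pder_stress|exact: nice_rho].
Qed.

Lemma tri_rhot j : tri (wgrad M d j) (mom j) rhot =
  - 2 * (tri (whess M d j false) (mom j) (mom false) +
         tri (whess M d j true) (mom j) (mom true)).
Proof.
have n1 k : nice (fun x => u x * v2 k k x - v x * u2 k k x).
  by apply: niceB; apply: niceM.
have -> : rhot = (fun x => - 2 * ((u x * v2 false false x - v x * u2 false false x) +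
  (u x * v2 true true x - v x * u2 true true x))).
  by apply/funext => x; rewrite /rhot /lapl; ring.
rewrite triZr; [|exact: wgrad_bounded|exact: nice_mom|exact: niceD].
rewrite triDr; [|exact: wgrad_bounded|exact: nice_mom|exact: n1..].
by congr (_ * (_ + _)); apply: tri_pderr;
  [exact: wgrad_bounded|exact: whess_bounded|exact: pder_wgrad|
   exact: nice_mom|exact: nice_mom|exact: n1|exact: pder_mom|
   exact: wgrad_bounded|exact: whess_bounded|exact: pder_wgrad|
   exact: nice_mom|exact: nice_mom|exact: n1|exact: pder_mom].
Qed.

(** Two integrations by parts carry the Laplacian of [rho] over to the weight,
    whose bilaplacian is a difference of bumps. *)
Lemma tri_lapl_rho : tri (wlap M d) lapl_rho rho =
  tri (fun x => M^-1 * (bump M x - bump d x)) rho rho.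
Proof.
pose r2 j x := 2 * (en j j x + u x * u2 j j x + v x * v2 j j x).
have n2 j : nice (r2 j).
  by apply: niceZ; apply: niceD; [apply: niceD; [exact: nice_en|exact: niceM]|exact: niceM].
have -> : lapl_rho = (fun x => r2 false x + r2 true x).
  by apply/funext => x; rewrite /lapl_rho /r2 /lapl; ring.
rewrite triDl; [|exact: wlap_bounded|exact: n2..|exact: nice_rho].
have h j : tri (wlap M d) (r2 j) rho = tri (wlap2 M d j) rho rho.
  have -> : tri (wlap M d) (r2 j) rho = - tri (wlap1 M d j) (rho1 j) rho.
    exact: tri_pderl (wlap_bounded d0 dM) (wlap1_bounded d0 dM j)
      (pder_wlap d0 dM j) (nice_rho1 j) (n2 j) (pder_rho1 j) nice_rho.
  have -> : tri (wlap1 M d j) (rho1 j) rho = - tri (wlap2 M d j) rho rho.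
    exact: tri_pderl (wlap1_bounded d0 dM j) (wlap2_bounded d0 dM j)
      (pder_wlap1 d0 dM j) nice_rho (nice_rho1 j) (pder_rho j) nice_rho.
  by rewrite opprK.
rewrite !h -triDk; [|exact: wlap2_bounded..|exact: nice_rho|exact: nice_rho].
by congr tri; apply/funext => x; rewrite wlap2_sum.
Qed.

(** After integration by parts the terms quadratic in the gradient pair with
    the Hessian of the weight. Symmetrised in [x] and [y], the tensor [en rho
    + rho en - 2 mom mom] contracted with it is half the sum of the tensors
    [Re (D_j conj D_k)] for [D_j = u_j(x) u(y) - u(x) u_j(y)] and for [D_j =
    u_j(x) conj (u(y)) + u(x) conj (u_j(y))], hence non-negative by
    [whess_psd]. The defocusing nonlinearity adds a multiple of the Laplacian
    of the weight, which is the trace of that Hessian, times [rho^2 rho]. *)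
Lemma morawetz_fixed_time :
  2^-1 * tri (fun x => M^-1 * (bump d x - bump M x)) rho rho <=
  \sum_(j : bool) (tri (wgrad M d j) (momt j) rho + tri (wgrad M d j) (mom j) rhot).
Proof.
rewrite big_bool /= !tri_momt !tri_rhot.
pose H j k := whess M d j k.
pose L : seq (@term R) := [::
  (-1, (H false false, stress false false, rho));
  (-1, (H false true, stress false true, rho));
  (-1, (H true false, stress true false, rho));
  (-1, (H true true, stress true true, rho));
  (-2, (H false false, mom false, mom false));
  (-2, (H false true, mom false, mom true));
  (-2, (H true false, mom true, mom false));
  (-2, (H true true, mom true, mom true));
  (2^-1, (wlap M d, lapl_rho, rho))].
have L0 : 0 <= sum_tri L.
  apply: sum_tri_ge0.
    have hH j k := whess_bounded d0 dM j k; have hw := wlap_bounded d0 dM.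
    have nr := nice_rho; have nm := nice_mom; have nst := nice_stress.
    have nlr := nice_lapl_rho.
    by rewrite /=; do 9! (split; first by split).
  move=> x y; rewrite /L /sum_tri_fun /tri_fun /=.
  have -> : sub2 y x = opp2 (sub2 x y) by rewrite /sub2 /opp2/= !opprB.
  set z := sub2 x y; rewrite /H -!whess_tr// !whess_opp//.
  have psd := whess_psd d0 dM z.
  rewrite (whessC _ _ true false) /stress /press /= !mul1r !mul0r.
  set A := whess M d false false z; set B := whess M d false true z.
  set C := whess M d true true z.
  rewrite -/A -/B -/C in psd.
  have W0 : 0 <= A + C by have := psd 1 0; have := psd 0 1; lra.
  pose re1 j := (u1 j x * u y - v1 j x * v y) - (u x * u1 j y - v x * v1 j y).
  pose im1 j := (u1 j x * v y + v1 j x * u y) - (u x * v1 j y + v x * u1 j y).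
  pose re2 j := u1 j x * u y + v1 j x * v y + u x * u1 j y + v x * v1 j y.
  pose im2 j := v1 j x * u y - u1 j x * v y + v x * u1 j y - u x * v1 j y.
  rewrite [leRHS](_ : _ =
    (A * re1 false ^+ 2 + 2 * B * (re1 false * re1 true) + C * re1 true ^+ 2) +
    (A * im1 false ^+ 2 + 2 * B * (im1 false * im1 true) + C * im1 true ^+ 2) +
    (A * re2 false ^+ 2 + 2 * B * (re2 false * re2 true) + C * re2 true ^+ 2) +
    (A * im2 false ^+ 2 + 2 * B * (im2 false * im2 true) + C * im2 true ^+ 2) +
    2^-1 * ((A + C) * (rho x ^+ 2 * rho y + rho y ^+ 2 * rho x))); last first.
    by rewrite /en /mom /rho /re1 /re2 /im1 /im2; field.
  have rho0 t : 0 <= rho t by rewrite addr_ge0// sqr_ge0.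
  apply: addr_ge0.
    have p1 := psd (re1 false) (re1 true); have p2 := psd (im1 false) (im1 true).
    have p3 := psd (re2 false) (re2 true); have p4 := psd (im2 false) (im2 true).
    exact: addr_ge0 (addr_ge0 (addr_ge0 p1 p2) p3) p4.
  apply: mulr_ge0; first by rewrite invr_ge0.
  apply: mulr_ge0 => //.
  by apply: addr_ge0; apply: mulr_ge0 => //; exact: sqr_ge0.
have nr := nice_rho.
have e : tri (fun x => M^-1 * (bump d x - bump M x)) rho rho =
    - tri (wlap M d) lapl_rho rho.
  rewrite tri_lapl_rho.
  rewrite /tri -mulN1r -I4Z; last first.
    have hw := wlap2_bounded d0 dM.
    apply: tri_fun_dominated => //.
    have := bounded_kernelD (hw false) (hw true).
    by congr bounded_kernel; apply/funext => x; rewrite wlap2_sum.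
  by congr I4; apply/funext => z; rewrite /tri_fun; ring.
rewrite e; move: L0; rewrite /L /H /=.
lra.
Qed.

End fixed_time.

(** * Integration over the time interval *)

Section time_dependent_fields.
Context {R : realType}.
Local Notation mR := (measurableTypeR R).
Local Notation mu := (@lebesgue_measure R).
Implicit Types (a b : R -> R * R -> R) (ker : R * R -> R).

(** The analogue of [nice] for functions of space and time, with a decay
    uniform in time. *)
Definition field a := continuous (fun p : R * (R * R) => a p.1 p.2) /\
  exists C, forall t x, `|a t x| <= C * w2 x.

Lemma field_nice a t : field a -> nice (a t).
Proof.
move=> [ca [C hC]]; split; last by exists C.
have h : continuous (fun x : R * R => (t, x)).
  by apply: continuous_pair => x; [exact: cvg_cst|exact: cvg_id].
by move=> x; exact: (continuous_comp (h x) (ca (t, x))).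
Qed.

Lemma field_time_continuous a x : field a -> continuous (a ^~ x).
Proof.
move=> [ca _].
have h : continuous (fun t : R => (t, x)).
  by apply: continuous_pair => t; [exact: cvg_id|exact: cvg_cst].
by move=> t; exact: (continuous_comp (h t) (ca (t, x))).
Qed.

Lemma fieldD a b : field a -> field b -> field (fun t x => a t x + b t x).
Proof.
move=> [ca [C hC]] [cb [D hD]]; split.
  by move=> p; apply: cvgD; [exact: ca|exact: cb].
by exists (C + D) => t x; rewrite mulrDl (le_trans (ler_normD _ _))// lerD.
Qed.

Lemma fieldN a : field a -> field (fun t x => - a t x).
Proof.
move=> [ca [C hC]]; split; first by move=> p; apply: cvgN; exact: ca.
by exists C => t x; rewrite normrN.
Qed.

Lemma fieldB a b : field a -> field b -> field (fun t x => a t x - b t x).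
Proof. by move=> ha hb; apply: fieldD => //; exact: fieldN. Qed.

Lemma fieldM a b : field a -> field b -> field (fun t x => a t x * b t x).
Proof.
move=> [ca [C hC]] [cb [D hD]]; split.
  by move=> p; apply: cvgM; [exact: ca|exact: cb].
exists (`|C| * `|D|) => t x; rewrite normrM -mulrA.
have w0 := w2_gt0 x; have w1 := w2_le1 x.
have h1 : `|a t x| <= `|C|.
  rewrite (le_trans (hC t x))// (le_trans (ler_norm _))// normrM ler_piMr//.
  by rewrite ger0_norm// ltW.
have h2 : `|b t x| <= `|D| * w2 x.
  by rewrite (le_trans (hD t x))// ler_wpM2r ?(ltW w0)// ler_norm.
by apply: ler_pM.
Qed.

Lemma fieldZ (c : R) a : field a -> field (fun t x => c * a t x).
Proof.
move=> [ca [C hC]]; split; first by move=> p; apply: cvgM; [exact: cvg_cst|exact: ca].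
exists (`|c| * C) => t x; rewrite normrM -mulrA.
by apply: ler_wpM2l.
Qed.

Lemma field_measurable a : field a ->
  measurable_fun [set: mR * (mR * mR)] (fun p => a p.1 p.2).
Proof. by move=> [ca _]; exact: continuous3_measurable. Qed.

Variable T : R.
Hypothesis T0 : 0 < T.

(** Interior times suffice, since the fundamental theorem of calculus asks
    only for continuity at the end points. *)
Definition tder a a' :=
  forall t x, 0 < t < T -> der (a ^~ x) t (a' t x).

Lemma tderD a a' b b' : tder a a' -> tder b b' ->
  tder (fun t x => a t x + b t x) (fun t x => a' t x + b' t x).
Proof. by move=> ha hb t x tT; apply: derD; [exact: ha|exact: hb]. Qed.

Lemma tderB a a' b b' : tder a a' -> tder b b' ->
  tder (fun t x => a t x - b t x) (fun t x => a' t x - b' t x).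
Proof. by move=> ha hb t x tT; apply: derB; [exact: ha|exact: hb]. Qed.

Lemma tderM a a' b b' : tder a a' -> tder b b' ->
  tder (fun t x => a t x * b t x) (fun t x => a' t x * b t x + a t x * b' t x).
Proof.
by move=> ha hb t x tT; apply: derM; [exact: ha|exact: hb].
Qed.

Lemma tder_eq a a' b' : tder a a' -> (forall t x, a' t x = b' t x) -> tder a b'.
Proof. by move=> h e t x tT; rewrite -e; exact: h. Qed.

(** Integrals over the time interval are integrals over the line with this
    weight, to which Fubini's theorem in the weighted form above applies. *)
Definition wT (t : R) : R := \1_`[0, T] t.

Lemma weight_wT : weight mu wT.
Proof.
split; first by move=> t; rewrite /wT indicE ler0n.
exact: (@integrable_indic_itv R 0 T true false).
Qed.

Definition IT (f : R -> R) : R := Rintegral mu setT (fun t => wT t * f t).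

Lemma ITE (f : R -> R) : IT f = Rintegral mu `[0, T] f.
Proof.
rewrite /IT [RHS]Rintegral_mkcond; apply: eq_Rintegral => t _.
by rewrite patchE /wT indicE; case: ifPn => _; rewrite ?mul1r ?mul0r.
Qed.

Lemma IT_FTC (F f : R -> R) : continuous F -> continuous f ->
  (forall t, 0 < t < T -> der F t (f t)) -> IT f = F T - F 0.
Proof.
move=> cF cf dF; rewrite ITE /Rintegral (@continuous_FTC2 _ f F)//.
- exact: continuous_subspaceT.
- split; first by move=> t; rewrite in_itv/= => tT; have [] := dF t tT.
  + exact: cvg_at_right_filter (cF _).
  + exact: cvg_at_left_filter (cF _).
- move=> t; rewrite in_itv/= => tT; rewrite derive1E.
  by have [] := dF t tT.
Qed.

Local Notation mR4 := ((mR * mR) * (mR * mR))%type.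

Lemma tri_field_dominated ker a b : bounded_kernel ker -> field a -> field b ->
  dominated (prodw wT w4 : mR * mR4 -> R)
    (fun p => wT p.1 * tri_fun ker (a p.1) (b p.1) p.2).
Proof.
move=> [ck [K hK]] fa fb.
have [A hA] := fa.2; have [B hB] := fb.2.
have mab c (pr : mR4 -> mR * mR) : field c ->
    measurable_fun [set: mR4] pr ->
    measurable_fun [set: mR * mR4] (fun p => c p.1 (pr p.2)).
  move=> fc mpr.
  have hm : measurable_fun [set: mR * mR4] (fun p => (p.1, pr p.2)).
    by apply: measurable_fun_pair => //; exact: (measurableT_comp mpr measurable_snd).
  exact: (measurableT_comp (field_measurable fc) hm).
split.
  apply: measurable_funM.
    by case: (dominated_weight weight_wT) => mw _; exact: (measurableT_comp mw measurable_fst).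
  apply: measurable_funM.
    have hm : measurable_fun [set: mR * mR4]
        (fun p => sub2 p.2.1 p.2.2 : (mR * mR)%type).
      exact: (measurableT_comp measurable_sub2 measurable_snd).
    exact: (measurableT_comp (continuous2_measurable ck) hm).
  by apply: measurable_funM; apply: mab.
exists (K * (A * B)) => -[t [x y]] /=.
rewrite /prodw/= normrM [`|wT t|]ger0_norm ?weight_wT.1// mulrCA.
apply: ler_wpM2l; first exact: weight_wT.1.
rewrite /tri_fun/= normrM -mulrA /w4 /prodw/=.
apply: ler_pM => //.
by rewrite normrM mulrACA ler_pM.
Qed.

Lemma IT_tri_swap ker a b : bounded_kernel ker -> field a -> field b ->
  IT (fun t => tri ker (a t) (b t)) =
  I4 (fun z => IT (fun t => tri_fun ker (a t) (b t) z)).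
Proof.
move=> hk fa fb; have hd := tri_field_dominated hk fa fb.
have := Rintegral_fubini1 weight_wT weight_w4 hd.
rewrite (Rintegral_fubini2 weight_wT weight_w4 hd) /I4 /IT => ->.
apply: eq_Rintegral => t _; rewrite /tri /I4 -RintegralZl//=.
apply: (dominated_integrable weight_w4).
by apply: tri_fun_dominated => //; exact: field_nice.
Qed.

Lemma tri_IT_dominated ker a b : bounded_kernel ker -> field a -> field b ->
  dominated wT (fun t => wT t * tri ker (a t) (b t)).
Proof.
move=> hk fa fb.
have := dominated_fubini1 weight_wT weight_w4 (tri_field_dominated hk fa fb).
congr dominated; apply/funext => t; rewrite /tri /I4 -RintegralZl//=.
apply: (dominated_integrable weight_w4).
by apply: tri_fun_dominated => //; exact: field_nice.
Qed.

End time_dependent_fields.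

Section time_integration.
Context {R : realType}.
Local Notation mu := (@lebesgue_measure R).
Implicit Types (a b : R -> R * R -> R) (ker : R * R -> R).
Variable T : R.
Hypothesis T0 : 0 < T.

Lemma ITD (f g : R -> R) :
  dominated (wT T) (fun t => wT T t * f t) -> dominated (wT T) (fun t => wT T t * g t) ->
  IT T (fun t => f t + g t) = IT T f + IT T g.
Proof.
move=> df dg; rewrite /IT -RintegralD//=; last 2 first.
- exact: (dominated_integrable (weight_wT T)).
- exact: (dominated_integrable (weight_wT T)).
by apply: eq_Rintegral => t _; rewrite mulrDr.
Qed.

Lemma ITZ (c : R) (f : R -> R) :
  dominated (wT T) (fun t => wT T t * f t) ->
  IT T (fun t => c * f t) = c * IT T f.
Proof.
move=> df; rewrite /IT -RintegralZl//=; last first.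
  exact: (dominated_integrable (weight_wT T)).
by apply: eq_Rintegral => t _; rewrite mulrCA.
Qed.

Lemma le_IT (f g : R -> R) :
  dominated (wT T) (fun t => wT T t * f t) -> dominated (wT T) (fun t => wT T t * g t) ->
  (forall t, 0 <= t <= T -> f t <= g t) -> IT T f <= IT T g.
Proof.
move=> df dg fg; apply: le_Rintegral => //=.
- exact: (dominated_integrable (weight_wT T)).
- exact: (dominated_integrable (weight_wT T)).
move=> t _; rewrite /wT indicE; case: (boolP (t \in _)); last by rewrite !mul0r.
by rewrite inE/= in_itv/= => tT; rewrite !mul1r fg.
Qed.

Lemma dominated_wTD (f g : R -> R) :
  dominated (wT T) (fun t => wT T t * f t) -> dominated (wT T) (fun t => wT T t * g t) ->
  dominated (wT T) (fun t => wT T t * (f t + g t)).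
Proof.
move=> df dg; have := dominatedD df dg.
by congr dominated; apply/funext => t; rewrite mulrDr.
Qed.

Lemma dominated_wTZ (c : R) (f : R -> R) :
  dominated (wT T) (fun t => wT T t * f t) ->
  dominated (wT T) (fun t => wT T t * (c * f t)).
Proof.
move=> df; have := dominatedZ (weight_wT T) c df.
by congr dominated; apply/funext => t; rewrite mulrCA.
Qed.

(** For fixed [x] and [y] this is the fundamental theorem of calculus in time;
    Fubini's theorem moves the time integral inside. *)
Lemma tri_time ker a a' b b' : bounded_kernel ker ->
  field a -> field a' -> field b -> field b' ->
  tder T a a' -> tder T b b' ->
  IT T (fun t => tri ker (a' t) (b t) + tri ker (a t) (b' t)) =
  tri ker (a T) (b T) - tri ker (a 0) (b 0).
Proof.
move=> hk fa fa' fb fb' da db.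
rewrite ITD; [|exact: tri_IT_dominated..].
rewrite !IT_tri_swap//.
have dm := dominated_fubini2 (weight_wT T) weight_w4 (tri_field_dominated T hk _ _).
rewrite -I4D; [|exact: dm..].
have -> : tri ker (a T) (b T) - tri ker (a 0) (b 0) =
    I4 (fun z => tri_fun ker (a T) (b T) z + (-1) * tri_fun ker (a 0) (b 0) z).
  have d1 t : dominated w4 (tri_fun ker (a t) (b t)).
    by apply: tri_fun_dominated => //; exact: field_nice.
  by rewrite I4D ?I4Z ?mulN1r//; exact: (dominatedZ weight_w4).
congr I4; apply/funext => -[x y].
have ctf c e : field c -> field e -> continuous (fun t => tri_fun ker (c t) (e t) (x, y)).
  move=> fc fe t; apply: cvgM; first exact: cvg_cst.
  by apply: cvgM; exact: field_time_continuous.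
have dwT (f : R -> R) : continuous f ->
    dominated (wT T) (fun t => wT T t * f t).
  move=> cf.
  have cn : {within `[0, T], continuous (fun t => `|f t|)}.
    by apply: continuous_subspaceT => t; apply: cvg_norm; exact: cf.
  have [t1 _ h1] := EVT_max (ltW T0) cn.
  split.
    apply: measurable_funM; first by case: (dominated_weight (weight_wT T)).
    exact: continuous_measurable_fun.
  exists `|f t1| => t; rewrite normrM mulrC [`|wT T t|]ger0_norm ?(weight_wT T).1//.
  rewrite /wT indicE; case: (boolP (t \in _)); last by rewrite !mulr0.
  by rewrite inE/= => tT; rewrite !mulr1; exact: h1.
rewrite -ITD; [|exact/dwT/ctf..].
rewrite (@IT_FTC _ T T0 (fun t => tri_fun ker (a t) (b t) (x, y))).
- by rewrite mulN1r.
- exact: ctf.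
- by move=> t; apply: cvgD; exact: ctf.
- move=> t tT; apply: der_eq (derM (der_cst _ _) (derM (da t x tT) (db t y tT))) _.
  by rewrite /tri_fun/=; ring.
Qed.

End time_integration.

(** * The integrated Morawetz inequality *)

Section nls.
Context {R : realType}.
Implicit Types (T M d : R).

(** Real and imaginary parts of a solution together with the derivatives that
    enter the Morawetz identity. The fields [nls_ut] and [nls_vt] are the
    equation itself, and [nls_u1t] and [nls_v1t] are its space derivatives. *)
Record nls_data T (u v : R -> R * R -> R) (u1 v1 : bool -> R -> R * R -> R)
    (u2 v2 u3 v3 : bool -> bool -> R -> R * R -> R) : Prop := NlsData {
  nls_u : field u ; nls_v : field v ;
  nls_u1 : forall j, field (u1 j) ; nls_v1 : forall j, field (v1 j) ;
  nls_u2 : forall j k, field (u2 j k) ; nls_v2 : forall j k, field (v2 j k) ;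
  nls_u3 : forall j k, field (u3 j k) ; nls_v3 : forall j k, field (v3 j k) ;
  nls_du : forall j t, pder j (u t) (u1 j t) ;
  nls_dv : forall j t, pder j (v t) (v1 j t) ;
  nls_du1 : forall k j t, pder k (u1 j t) (u2 k j t) ;
  nls_dv1 : forall k j t, pder k (v1 j t) (v2 k j t) ;
  nls_du2 : forall j k t, pder j (u2 k k t) (u3 j k t) ;
  nls_dv2 : forall j k t, pder j (v2 k k t) (v3 j k t) ;
  nls_u2C : forall t x, u2 false true t x = u2 true false t x ;
  nls_v2C : forall t x, v2 false true t x = v2 true false t x ;
  nls_ut : tder T u (fun t x =>
    - lapl (fun j k => v2 j k t) x + rho (u t) (v t) x * v t x) ;
  nls_vt : tder T v (fun t x =>
    lapl (fun j k => u2 j k t) x - rho (u t) (v t) x * u t x) ;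
  nls_u1t : forall j, tder T (u1 j) (fun t x =>
    - lapl1 (fun j k => v3 j k t) j x + (rho1 (u t) (v t) (u1^~ t) (v1^~ t) j x * v t x
      + rho (u t) (v t) x * v1 j t x)) ;
  nls_v1t : forall j, tder T (v1 j) (fun t x =>
    lapl1 (fun j k => u3 j k t) j x - (rho1 (u t) (v t) (u1^~ t) (v1^~ t) j x * u t x
      + rho (u t) (v t) x * u1 j t x)) }.

Section data.
Variables (T : R) (u v : R -> R * R -> R) (u1 v1 : bool -> R -> R * R -> R).
Variables (u2 v2 u3 v3 : bool -> bool -> R -> R * R -> R).
Hypothesis T0 : 0 < T.
Hypothesis H : nls_data T u v u1 v1 u2 v2 u3 v3.

Definition rhoT t := rho (u t) (v t).
Definition momT j t := mom (u t) (v t) (u1^~ t) (v1^~ t) j.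
Definition momtT j t := momt (u t) (v t) (u1^~ t) (v1^~ t)
  (fun j k => u2 j k t) (fun j k => v2 j k t) (fun j k => u3 j k t) (fun j k => v3 j k t) j.
Definition rhotT t := rhot (u t) (v t) (fun j k => u2 j k t) (fun j k => v2 j k t).

Let fsq (a : R -> R * R -> R) : field a -> field (fun t x => a t x ^+ 2).
Proof.
by move=> fa; exact: (fieldM fa fa).
Qed.

Lemma field_rho : field rhoT.
Proof. by apply: fieldD; apply: fsq; [exact: (nls_u H)|exact: nls_v H]. Qed.

Lemma field_mom j : field (momT j).
Proof.
by apply: fieldB; apply: fieldM;
  [exact: (nls_u H)|exact: (nls_v1 H)|exact: nls_v H|exact: (nls_u1 H)].
Qed.

Lemma field_rhot : field rhotT.
Proof.
apply: fieldZ; apply: fieldB; apply: fieldM.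
- exact: (nls_u H).
- by apply: fieldD; exact: (nls_v2 H).
- exact: (nls_v H).
- by apply: fieldD; exact: (nls_u2 H).
Qed.

Let field_stress1 j k : field (fun t => stress1 (u t) (v t) (u1^~ t) (v1^~ t)
  (fun j k => u2 j k t) (fun j k => v2 j k t) (fun j k => u3 j k t) (fun j k => v3 j k t) j k).
Proof.
have fu := nls_u H; have fv := nls_v H; have fu1 := nls_u1 H; have fv1 := nls_v1 H.
have fu2 := nls_u2 H; have fv2 := nls_v2 H; have fu3 := nls_u3 H; have fv3 := nls_v3 H.
have fr := field_rho.
apply: fieldB; apply: fieldZ; last by do 2 apply: fieldD; apply: fieldM.
apply: fieldD; last by apply: fieldZ; do 2 apply: fieldD; apply: fieldM.
apply: fieldB; last first.
  apply: fieldM => //; apply: fieldZ; apply: fieldD; exact: fieldM.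
by do 2 apply: fieldD; apply: fieldM => //; apply: fieldD.
Qed.

Lemma field_momt j : field (momtT j).
Proof. by apply: fieldD; exact: field_stress1. Qed.

Lemma tder_rho : tder T rhoT rhotT.
Proof.
have d1 := tderM (nls_ut H) (nls_ut H).
have h := tderD (tderM (nls_ut H) (nls_ut H)) (tderM (nls_vt H) (nls_vt H)).
have -> : rhoT = (fun t x => u t x * u t x + v t x * v t x).
  by apply/funext => t; apply/funext => x; rewrite /rhoT /rho !expr2.
apply: tder_eq h _ => t x.
by rewrite /rhotT /rhot; ring.
Qed.

(** The conservation law of momentum. The nonlinearity contributes the
    gradient of [- rho^2 / 2], which is part of [press]. *)
Lemma tder_mom j : tder T (momT j) (momtT j).
Proof.
have h := tderB (tderM (nls_ut H) (nls_v1t H j)) (tderM (nls_vt H) (nls_u1t H j)).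
apply: tder_eq h _ => t x.
have eu := nls_u2C H t x; have ev := nls_v2C H t x.
rewrite /momtT /momt /stress1 /press1 /rho1 /lapl /lapl1 /rho.
by case: j; rewrite /= ?eu ?ev; ring.
Qed.

Theorem morawetz_integrated M d : 0 < d -> d < M ->
  2^-1 * IT T (fun t => tri (fun x => M^-1 * (bump d x - bump M x)) (rhoT t) (rhoT t)) <=
  \sum_(j : bool) (tri (wgrad M d j) (momT j T) (rhoT T) -
                   tri (wgrad M d j) (momT j 0) (rhoT 0)).
Proof.
move=> d0 dM.
have hK : bounded_kernel (fun x => M^-1 * (bump d x - bump M x)).
  have hw := wlap2_bounded d0 dM.
  have := bounded_kernelN (bounded_kernelD (hw false) (hw true)).
  by congr bounded_kernel; apply/funext => x; rewrite wlap2_sum//; ring.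
have fr := field_rho; have frt := field_rhot; have fm := field_mom; have fmt := field_momt.
have hg j := wgrad_bounded d0 dM j.
have dmg j : dominated (wT T) (fun t => wT T t * (tri (wgrad M d j) (momtT j t) (rhoT t) +
    tri (wgrad M d j) (momT j t) (rhotT t))).
  by apply: dominated_wTD; apply: tri_IT_dominated.
have dmK : dominated (wT T) (fun t => wT T t *
    tri (fun x => M^-1 * (bump d x - bump M x)) (rhoT t) (rhoT t)).
  exact: tri_IT_dominated.
rewrite -ITZ// big_bool/=.
have ftc j := tri_time T0 (hg j) (fm j) (fmt j) fr frt (tder_mom j) tder_rho.
rewrite -(ftc true) -(ftc false).
rewrite -ITD//; apply: le_IT.
- exact: dominated_wTZ.
- exact: dominated_wTD.
move=> t _.
have := @morawetz_fixed_time R M d d0 dM (u t) (v t) (u1^~ t) (v1^~ t)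
  (fun j k => u2 j k t) (fun j k => v2 j k t) (fun j k => u3 j k t) (fun j k => v3 j k t).
rewrite big_bool/=; apply.
- exact: field_nice (nls_u H).
- exact: field_nice (nls_v H).
- by move=> j; exact: field_nice (nls_u1 H j).
- by move=> j; exact: field_nice (nls_v1 H j).
- by move=> j k; exact: field_nice (nls_u2 H j k).
- by move=> j k; exact: field_nice (nls_v2 H j k).
- by move=> j k; exact: field_nice (nls_u3 H j k).
- by move=> j k; exact: field_nice (nls_v3 H j k).
- by move=> j; exact: (nls_du H j t).
- by move=> j; exact: (nls_dv H j t).
- by move=> k j; exact: (nls_du1 H k j t).
- by move=> k j; exact: (nls_dv1 H k j t).
- by move=> j k; exact: (nls_du2 H j k t).
- by move=> j k; exact: (nls_dv2 H j k t).
Qed.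

End data.
End nls.

(** * Approximate identities *)

Lemma continuous_compose (S T U : topologicalType) (f : S -> T) (g : T -> U) :
  continuous f -> continuous g -> continuous (fun x => g (f x)).
Proof. by move=> cf cg x; apply: continuous_comp; [exact: cf|exact: cg]. Qed.

Section approximate_identity.
Context {R : realType}.
Local Notation mR := (measurableTypeR R).
Local Notation mu := (@lebesgue_measure R).
Variable kap : R -> R.
Hypotheses (ck : continuous kap) (k0 : forall s, 0 <= kap s).
Hypotheses (kjw : exists C, forall s, `|kap s| <= C * jw s).
Hypothesis (keven : forall s, kap (- s) = kap s).

Lemma affine_continuous (x d : R) : continuous (fun z : R => x + d * z).
Proof.
by move=> z; apply: cvgD; [exact: cvg_cst|apply: cvgM; [exact: cvg_cst|exact: cvg_id]].
Qed.

Lemma der_affine (x d s : R) : der (fun z => x + d * z) s d.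
Proof.
by apply: der_eq (derD (der_cst _ _) (derM (der_cst d s) (der_id s))) _; ring.
Qed.

Lemma ge0_integral_affine (g : R -> R) (x d : R) : 0 < d ->
  continuous g -> (forall s, 0 <= g s) ->
  (\int[mu]_y (g y)%:E = \int[mu]_z (d * g (x + d * z))%:E)%E.
Proof.
move=> d0 cg g0; pose F z := x + d * z.
have dF : F^`()%classic = (fun=> d).
  by apply/funext => s; rewrite derive1E; have [] := der_affine x d s.
rewrite (@increasing_ge0_integration_by_substitutionT R F g)//.
- by apply: eq_integral => s _; rewrite dF /= mulrC.
- by move=> s t st; rewrite ltrD2l ltr_pM2l.
- by rewrite dF => s; exact: cvg_cst.
- by rewrite dF; exact: is_cvg_cst.
- by rewrite dF; exact: is_cvg_cst.
- apply/cvgrNyPle => A; near=> s; rewrite /F -lerBrDl mulrC -ler_pdivlMr//.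
- apply/cvgryPge => A; near=> s; rewrite /F -lerBlDl mulrC -ler_pdivrMr//.
Unshelve. all: by end_near. Qed.

Lemma kap_dominated : dominated (jw : mR -> R) kap.
Proof. by split => //; exact: continuous_measurable_fun. Qed.

Lemma kap_bounded : exists2 C, 0 <= C & forall s, `|kap s| <= C.
Proof.
have [C C0 hC] := dominated_const_ge0 weight_jw kjw; exists C => // s.
by rewrite (le_trans (hC s))// ler_piMr// jw_le1.
Qed.

Let kd (d x y : R) := d^-1 * kap ((y - x) / d).

Let ckd d x : continuous (kd d x).
Proof.
move=> y; apply: cvgM; first exact: cvg_cst.
have h : continuous (fun y => (y - x) / d).
  by move=> s; apply: cvgM; [apply: cvgB; [exact: cvg_id|exact: cvg_cst]|exact: cvg_cst].
exact: (continuous_compose h ck).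
Qed.

Lemma kd_dominated (f : R -> R) d x : continuous f ->
  (exists D, forall s, `|f s| <= D * jw s) ->
  dominated (jw : mR -> R) (fun y => kd d x y * f y).
Proof.
move=> cf hf; have [K K0 hK] := kap_bounded.
apply: (dominatedMl weight_jw).
- exact: (continuous_measurable_fun (@ckd d x)).
- by exists (`|d^-1| * K) => y; rewrite normrM ler_wpM2l.
- by split => //; exact: continuous_measurable_fun.
Qed.

Lemma kap_comp_dominated (f : R -> R) d x : continuous f ->
  (exists D, forall s, `|f s| <= D) ->
  dominated (jw : mR -> R) (fun z => kap z * f (x + d * z)).
Proof.
move=> cf [D hD].
have cs : continuous (fun z => f (x + d * z)).
  exact: (continuous_compose (@affine_continuous x d) cf).
have := dominatedMl weight_jw (continuous_measurable_fun cs)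
  (ex_intro _ D (fun s => hD (x + d * s))) kap_dominated.
by congr dominated; apply/funext => z; rewrite mulrC.
Qed.

(** Substitution is first made for non-negative integrands; [g] is reduced to
    this case by adding a multiple of [jw]. *)
Lemma Rintegral_rescale (g : R -> R) (x d : R) : 0 < d ->
  continuous g -> (exists C, forall s, `|g s| <= C * jw s) ->
  Rintegral mu setT (fun y => kd d x y * g y) =
  Rintegral mu setT (fun z => kap z * g (x + d * z)).
Proof.
move=> d0 cg hg; have [C C0 hC] := dominated_const_ge0 weight_jw hg.
have [K K0 hK] := kap_bounded.
have cshift (f : R -> R) : continuous f -> continuous (fun z => f (x + d * z)).
  by move=> cf; exact: (continuous_compose (@affine_continuous x d) cf).
have ge0case (f : R -> R) : continuous f -> (forall s, 0 <= f s) ->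
    Rintegral mu setT (fun y => kd d x y * f y) =
    Rintegral mu setT (fun z => kap z * f (x + d * z)).
  move=> cf f0; congr fine.
  rewrite (@ge0_integral_affine (fun y => kd d x y * f y) x d)//.
  - apply: eq_integral => z _; congr EFin; rewrite /kd.
    have -> : (x + d * z - x) / d = z by field; exact: lt0r_neq0.
    by field; exact: lt0r_neq0.
  - by move=> y; apply: cvgM; [exact: ckd|exact: cf].
  - by move=> s; rewrite mulr_ge0// mulr_ge0// invr_ge0 ltW.
have cCj : continuous (fun s : R => C * jw s).
  by move=> s; apply: cvgM; [exact: cvg_cst|exact: jw_continuous].
have cgC : continuous (fun s : R => g s + C * jw s).
  by move=> s; apply: cvgD; [exact: cg|exact: cCj].
have e1 := ge0case _ cCj (fun s => mulr_ge0 C0 (ltW (jw_gt0 s))).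
have e2 : Rintegral mu setT (fun y => kd d x y * (g y + C * jw y)) =
    Rintegral mu setT (fun z => kap z * (g (x + d * z) + C * jw (x + d * z))).
  apply: ge0case => // s; rewrite -lerBlDr sub0r.
  by have := hC s; rewrite ler_norml => /andP[].
have hCj : forall s : R, `|C * jw s| <= C * jw s.
  by move=> s; rewrite ger0_norm// mulr_ge0// ltW// jw_gt0.
have bd (f : R -> R) : (forall s, `|f s| <= C * jw s) -> exists D, forall s, `|f s| <= D.
  by move=> hf; exists C => s; rewrite (le_trans (hf s))// ler_piMr// jw_le1.
have iw := dominated_integrable weight_jw.
have eL : Rintegral mu setT (fun y => kd d x y * (g y + C * jw y)) =
    Rintegral mu setT (fun y => kd d x y * g y) +
    Rintegral mu setT (fun y => kd d x y * (C * jw y)).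
  rewrite -RintegralD//.
  - by apply: eq_Rintegral => y _; rewrite mulrDr.
  - by apply: iw; exact: kd_dominated.
  - by apply: iw; apply: kd_dominated => //; exists C.
have eR : Rintegral mu setT (fun z => kap z * (g (x + d * z) + C * jw (x + d * z))) =
    Rintegral mu setT (fun z => kap z * g (x + d * z)) +
    Rintegral mu setT (fun z => kap z * (C * jw (x + d * z))).
  rewrite -RintegralD//.
  - by apply: eq_Rintegral => y _; rewrite mulrDr.
  - by apply: iw; apply: kap_comp_dominated => //; exact: bd.
  - by apply: iw; apply: (@kap_comp_dominated (fun s => C * jw s)) => //; exact: bd.
by move: e2; rewrite eL eR e1 => /addIr.
Qed.

Definition kap2 (z : R * R) : R := kap z.1 * kap z.2.

Definition rescaled_kap2 (d : R) (z : R * R) : R :=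
  d^-1 * kap (z.1 / d) * (d^-1 * kap (z.2 / d)).

Definition shift2 (d : R) (x z : R * R) : R * R := (x.1 + d * z.1, x.2 + d * z.2).

Lemma rescaled_kap2_bounded d : bounded_kernel (rescaled_kap2 d).
Proof.
have [K K0 hK] := kap_bounded.
have h j : bounded_kernel (fun z : R * R => d^-1 * kap (crd j z / d)).
  split.
    move=> z; apply: cvgM; first exact: cvg_cst.
    have hc : continuous (fun z : R * R => crd j z / d).
      by move=> t; apply: cvgM; [exact: crd_continuous|exact: cvg_cst].
    exact: (continuous_compose hc ck).
  by exists (`|d^-1| * K) => z; rewrite normrM ler_wpM2l.
exact: bounded_kernelM (h false) (h true).
Qed.

Lemma rescaled_kap2_even d x y :
  rescaled_kap2 d (sub2 x y) = rescaled_kap2 d (sub2 y x).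
Proof.
rewrite /rescaled_kap2 /sub2 /=.
by rewrite -(opprB y.1) -(opprB y.2) !mulNr !keven.
Qed.

Lemma kap2_nice : nice kap2.
Proof.
have [C C0 hC] := dominated_const_ge0 weight_jw kjw; split.
  by move=> z; apply: cvgM; [exact: (continuous_compose (crd_continuous (j := false)) ck)|
    exact: (continuous_compose (crd_continuous (j := true)) ck)].
exists (C * C) => z; rewrite normrM /w2 mulrACA.
by apply: ler_pM.
Qed.

(** One coordinate at a time, by [Rintegral_rescale] and Fubini's theorem. *)
Lemma I2_rescale (g : R * R -> R) x d : 0 < d -> nice g ->
  I2 (fun y => rescaled_kap2 d (sub2 y x) * g y) =
  I2 (fun z => kap2 z * g (shift2 d x z)).
Proof.
move=> d0 ng; have [C C0 hC] := nice_const_ge0 ng.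
have [K K0 hK] := kap_bounded.
have [L L0 hL] := dominated_const_ge0 weight_jw kjw.
have hgx s1 s2 : `|g (s1, s2)| <= C * jw s1.
  by rewrite (le_trans (hC _))// ler_wpM2l// /w2/= ler_piMr ?jw_le1// ltW// jw_gt0.
have hgy s1 s2 : `|g (s1, s2)| <= C * jw s2.
  by rewrite (le_trans (hC _))// ler_wpM2l// /w2/= ler_piMl ?jw_le1// ltW// jw_gt0.
have cupd j s := continuous_compose (@upd_continuous R j s) ng.1.
have dL : dominated (prodw jw jw : mR * mR -> R)
    (fun y => rescaled_kap2 d (sub2 y x) * g y).
  apply: nice_dominated; apply: niceMl => //.
  exact: (bounded_kernel_shift x (rescaled_kap2_bounded d)).
pose Phi (p : R * R) := kd d x.1 p.1 * (kap p.2 * g (p.1, x.2 + d * p.2)).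
have dPhi : dominated (prodw jw jw : mR * mR -> R) Phi.
  split.
    apply: continuous2_measurable => p.
    have h1 : continuous (fun p : R * R => (p.1 - x.1) / d).
      by move=> t; apply: cvgM; [apply: cvgB; [exact: cvg_fst|exact: cvg_cst]|exact: cvg_cst].
    have h2 : continuous (fun p : R * R => (p.1, x.2 + d * p.2)).
      apply: continuous_pair => t; first exact: cvg_fst.
      by apply: cvgD; [exact: cvg_cst|apply: cvgM; [exact: cvg_cst|exact: cvg_snd]].
    apply: cvgM; first apply: cvgM; first exact: cvg_cst.
    - exact: (continuous_compose h1 ck).
    - apply: cvgM; first exact: (continuous_compose (crd_continuous (j := true)) ck).
      exact: (continuous_compose h2 ng.1).
  exists (d^-1 * K * (L * C)) => p; rewrite /Phi /prodw normrM -!mulrA.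
  rewrite normrM [`|d^-1|]ger0_norm ?invr_ge0 ?(ltW d0)// -mulrA.
  rewrite ler_pM2l ?invr_gt0//; apply: ler_pM => //.
  rewrite normrM (mulrC (jw p.1)) mulrA mulrACA -mulrA.
  rewrite [leRHS](_ : _ = (L * jw p.2) * (C * jw p.1)); last by ring.
  by apply: ler_pM.
have dR : dominated (prodw jw jw : mR * mR -> R) (fun z => kap2 z * g (shift2 d x z)).
  have := @niceMl _ (fun z => g (shift2 d x z)) kap2 _ kap2_nice.
  have hb : bounded_kernel (fun z => g (shift2 d x z)).
    have [cg [G hG]] := nice_bounded ng; split; last by exists G.
    have h2 : continuous (shift2 d x).
      apply: continuous_pair => t; (apply: cvgD; [exact: cvg_cst|apply: cvgM;
        [exact: cvg_cst|(exact: cvg_fst || exact: cvg_snd)]]).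
    exact: (continuous_compose h2 cg).
  move=> /(_ hb) /nice_dominated; congr dominated.
  by apply/funext => z; rewrite mulrC.
have iw := dominated_integrable weight_jw.
transitivity (Rintegral (sf_product mu mu) setT Phi).
  rewrite /I2 (Rintegral_fubini1 weight_jw weight_jw dL).
  rewrite (Rintegral_fubini1 weight_jw weight_jw dPhi).
  apply: eq_Rintegral => s _.
  have cg : continuous (fun y => g (s, y)) := cupd true (s, 0).
  have hg : exists D, forall y, `|g (s, y)| <= D * jw y by exists C.
  transitivity (kd d x.1 s * Rintegral mu setT (fun y => kd d x.2 y * g (s, y))).
    rewrite -RintegralZl//; last by apply: iw; exact: kd_dominated.
    by apply: eq_Rintegral => y _; rewrite mulrA.
  rewrite Rintegral_rescale// -RintegralZl//.
  apply: iw; apply: (kap_comp_dominated (f := fun y => g (s, y))) => //.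
  by exists C => y; rewrite (le_trans (hgy s y))// ler_piMr// jw_le1.
rewrite (Rintegral_fubini2 weight_jw weight_jw dPhi).
rewrite /I2 (Rintegral_fubini2 weight_jw weight_jw dR).
apply: eq_Rintegral => s _.
have cg : continuous (fun y => g (y, x.2 + d * s)) := cupd false (0, x.2 + d * s).
have hg : exists D, forall y, `|g (y, x.2 + d * s)| <= D * jw y by exists C.
transitivity (kap s * Rintegral mu setT (fun y => kd d x.1 y * g (y, x.2 + d * s))).
  rewrite -RintegralZl//; last by apply: iw; exact: kd_dominated.
  by apply: eq_Rintegral => y _; rewrite /Phi/=; ring.
rewrite Rintegral_rescale// -RintegralZl//.
  by apply: eq_Rintegral => y _; rewrite /kap2 /shift2/=; ring.
apply: iw; apply: (kap_comp_dominated (f := fun y => g (y, x.2 + d * s))) => //.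
by exists C => y; rewrite (le_trans (hgx y _))// ler_piMr// jw_le1.
Qed.

Lemma continuous_shift2 d : continuous (fun p : (R * R) * (R * R) => shift2 d p.1 p.2).
Proof.
have h1 : continuous (fun p : (R * R) * (R * R) => p.1) by move=> p; exact: cvg_fst.
have h2 : continuous (fun p : (R * R) * (R * R) => p.2) by move=> p; exact: cvg_snd.
have h j := continuous_compose h1 (crd_continuous (j := j)).
have h' j := continuous_compose h2 (crd_continuous (j := j)).
apply: continuous_pair => p; apply: cvgD.
- exact: (h false).
- by apply: cvgM; [exact: cvg_cst|exact: (h' false)].
- exact: (h true).
- by apply: cvgM; [exact: cvg_cst|exact: (h' true)].
Qed.

Lemma rescaled_measurable (f g : R * R -> R) d : nice f -> nice g ->
  measurable_fun [set: (mR * mR) * (mR * mR)]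
    (fun p => f p.1 * (kap2 p.2 * g (shift2 d p.1 p.2))).
Proof.
move=> nf ng.
apply: measurable_funM.
  exact: (measurableT_comp (continuous2_measurable nf.1) measurable_fst).
apply: measurable_funM.
  exact: (measurableT_comp (continuous2_measurable kap2_nice.1) measurable_snd).
have hm : measurable_fun [set: (mR * mR) * (mR * mR)]
    (fun p => shift2 d p.1 p.2 : (mR * mR)%type).
  apply: measurable_fun_pair; apply: measurable_funD.
  - exact: (measurableT_comp measurable_fst measurable_fst).
  - apply: measurable_funM => //.
    exact: (measurableT_comp measurable_fst measurable_snd).
  - exact: (measurableT_comp measurable_snd measurable_fst).
  - apply: measurable_funM => //.
    exact: (measurableT_comp measurable_snd measurable_snd).
exact: (measurableT_comp (continuous2_measurable ng.1) hm).
Qed.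

Lemma rescaled_bound : exists2 K, 0 <= K & forall (f g : R * R -> R) d F G,
  0 <= F -> (forall x, `|f x| <= F * w2 x) -> (forall x, `|g x| <= G) ->
  forall p, `|f p.1 * (kap2 p.2 * g (shift2 d p.1 p.2))| <= F * G * K * w4 p.
Proof.
have [K K0 hK] := nice_const_ge0 kap2_nice; exists K => // f g d F G F0 hF hG p.
rewrite normrM (normrM (kap2 _)) /w4 /prodw.
rewrite [leRHS](_ : _ = (F * w2 p.1) * ((K * w2 p.2) * G)); last by ring.
by apply: ler_pM => //; apply: ler_pM.
Qed.

Lemma rescaled_dominated (f g : R * R -> R) d : nice f -> nice g ->
  dominated w4 (fun p => f p.1 * (kap2 p.2 * g (shift2 d p.1 p.2))).
Proof.
move=> nf ng; have [F F0 hF] := nice_const_ge0 nf.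
have [_ [G hG]] := nice_bounded ng; have [K _ hK] := rescaled_bound.
by split; [exact: rescaled_measurable|exists (F * G * K); exact: hK].
Qed.

Lemma tri_rescale (f g : R * R -> R) d : 0 < d -> nice f -> nice g ->
  tri (rescaled_kap2 d) f g =
  I4 (fun p => f p.1 * (kap2 p.2 * g (shift2 d p.1 p.2))).
Proof.
move=> d0 nf ng; have hK := rescaled_kap2_bounded d.
rewrite /tri /I4 (Rintegral_fubini1 weight_w2 weight_w2 (tri_fun_dominated hK nf ng)).
rewrite (Rintegral_fubini1 weight_w2 weight_w2 (rescaled_dominated d nf ng)).
apply: eq_Rintegral => x _; rewrite /tri_fun/=.
have n1 : nice (fun y => rescaled_kap2 d (sub2 y x) * g y).
  by apply: niceMl => //; exact: bounded_kernel_shift.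
have n2 : nice (fun z => kap2 z * g (shift2 d x z)).
  have hb : bounded_kernel (fun z => g (shift2 d x z)).
    have [cg [G hG]] := nice_bounded ng; split; last by exists G.
    have h : continuous (fun z : R * R => (x, z)).
      by apply: continuous_pair => t; [exact: cvg_cst|exact: cvg_id].
    exact: (continuous_compose (continuous_compose h (@continuous_shift2 d)) cg).
  by apply: nice_eq (niceMl hb kap2_nice) _ => z; rewrite mulrC.
transitivity (f x * I2 (fun y => rescaled_kap2 d (sub2 y x) * g y)).
  rewrite /I2 -RintegralZl//; last first.
    exact: (dominated_integrable weight_w2 (nice_dominated n1)).
  by apply: eq_Rintegral => y _; rewrite rescaled_kap2_even; ring.
rewrite I2_rescale// /I2 -RintegralZl//.
exact: (dominated_integrable weight_w2 (nice_dominated n2)).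
Qed.

Lemma tri_rescale_bound : exists B, forall (f g : R * R -> R) d F G,
  0 < d -> nice f -> nice g ->
  0 <= F -> (forall x, `|f x| <= F * w2 x) -> (forall x, `|g x| <= G) ->
  `|tri (rescaled_kap2 d) f g| <= F * G * B.
Proof.
have [K _ hK] := rescaled_bound.
exists (K * I4 w4) => f g d F G d0 nf ng F0 hF hG.
rewrite tri_rescale// mulrA; apply: (dominated_Rintegral_bound weight_w4).
  exact: rescaled_measurable.
exact: hK.
Qed.

Definition kmass : R := I2 kap2.

(** After substitution the small parameter appears only inside [g], so that
    dominated convergence applies with a majorant that does not depend on it. *)
Lemma tri_rescale_cvg (f g : R * R -> R) (d_ : nat -> R) :
  (forall n, 0 < d_ n) -> d_ n @[n --> \oo] --> (0 : R) -> nice f -> nice g ->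
  tri (rescaled_kap2 (d_ n)) f g @[n --> \oo] --> kmass * I2 (fun x => f x * g x).
Proof.
move=> d0 cd nf ng.
have [F F0 hF] := nice_const_ge0 nf.
have [_ [G hG]] := nice_bounded ng; have [K _ hK] := rescaled_bound.
have -> : kmass * I2 (fun x => f x * g x) =
    I4 (fun p => f p.1 * (kap2 p.2 * g p.1)).
  have dom : dominated w4 (fun p : (R * R) * (R * R) => f p.1 * (kap2 p.2 * g p.1)).
    have := rescaled_dominated 0 nf ng; congr dominated; apply/funext => -[x z].
    by rewrite /shift2/= !mul0r !addr0; case: x.
  rewrite /I4 (Rintegral_fubini1 weight_w2 weight_w2 dom) /I2 -RintegralZl//; last first.
    exact: (dominated_integrable weight_w2 (nice_dominated (niceM nf ng))).
  apply: eq_Rintegral => x _; rewrite /kmass /I2/=.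
  rewrite mulrC -RintegralZl//; last first.
    exact: (dominated_integrable weight_w2 (nice_dominated kap2_nice)).
  by apply: eq_Rintegral => z _; rewrite /kap2; ring.
have -> : (fun n => tri (rescaled_kap2 (d_ n)) f g) =
    (fun n => I4 (fun p => f p.1 * (kap2 p.2 * g (shift2 (d_ n) p.1 p.2)))).
  by apply/funext => n; rewrite tri_rescale.
have key (x z : R * R) : g (shift2 (d_ n) x z) @[n --> \oo] --> g x.
  have cs : continuous (fun d => g (shift2 d x z)).
    have h : continuous (fun d => shift2 d x z).
      by apply: continuous_pair => t; apply: cvgD; [exact: cvg_cst|apply: cvgM;
        [exact: cvg_id|exact: cvg_cst]|exact: cvg_cst|apply: cvgM;
        [exact: cvg_id|exact: cvg_cst]].
    exact: (continuous_compose h ng.1).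
  have := cvg_comp _ _ cd (cs 0).
  by rewrite /shift2 !mul0r !addr0; case: x {cs}.
apply: (Rintegral_dct weight_w4 (C := F * G * K)).
- by move=> n; exact: rescaled_measurable.
- by move=> n p; exact: hK.
- move=> [x z] /=; apply: cvgM; first exact: cvg_cst.
  apply: cvgM; first exact: cvg_cst.
  exact: key.
Qed.

End approximate_identity.

(** * Bounds for interaction integrals *)

Section plane_integrals.
Context {R : realType}.
Local Notation mR := (measurableTypeR R).
Local Notation mu := (@lebesgue_measure R).
Implicit Types (f g ker : R * R -> R).

Lemma nice_norm f : nice f -> nice (fun x => `|f x|).
Proof.
move=> [cf [C hC]]; split; first by move=> x; apply: cvg_norm; exact: cf.
by exists C => x; rewrite normr_id.
Qed.

Lemma nice_integrable f : nice f ->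
  (@plane_measure R).-integrable [set: mR * mR] (EFin \o (f : mR * mR -> R)).
Proof. by move=> nf; exact: (dominated_integrable weight_w2 (nice_dominated nf)). Qed.

Lemma le_I2 f g : nice f -> nice g -> (forall x, f x <= g x) -> I2 f <= I2 g.
Proof. by move=> nf ng fg; apply: le_Rintegral => //; exact: nice_integrable. Qed.

Lemma I2D f g : nice f -> nice g -> I2 (fun x => f x + g x) = I2 f + I2 g.
Proof. by move=> nf ng; rewrite /I2 RintegralD//; exact: nice_integrable. Qed.

Lemma I2Z (c : R) f : nice f -> I2 (fun x => c * f x) = c * I2 f.
Proof. by move=> nf; rewrite /I2 RintegralZl//; exact: nice_integrable. Qed.

Lemma I2_ge0 f : (forall x, 0 <= f x) -> 0 <= I2 f.
Proof. by move=> f0; apply: Rintegral_ge0 => x _. Qed.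

Lemma tri_cst (c : R) f g : nice f -> nice g ->
  tri (fun=> c) f g = c * (I2 f * I2 g).
Proof.
move=> nf ng; have hk := @bounded_kernel_cst R c.
rewrite /tri /I4 (Rintegral_fubini1 weight_w2 weight_w2 (tri_fun_dominated hk nf ng)).
transitivity (I2 (fun x => (c * I2 g) * f x)); last by rewrite I2Z//; ring.
apply: eq_Rintegral => x _; rewrite mulrAC -I2Z//; apply: eq_Rintegral => y _.
by rewrite /tri_fun/=; ring.
Qed.

Lemma tri_le ker f g K : bounded_kernel ker -> (forall x, `|ker x| <= K) ->
  nice f -> nice g ->
  `|tri ker f g| <= K * (I2 (fun x => `|f x|) * I2 (fun x => `|g x|)).
Proof.
move=> hk hK nf ng; have nf' := nice_norm nf; have ng' := nice_norm ng.
have hk' := @bounded_kernel_cst R K.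
rewrite -tri_cst//; apply: le_trans.
  apply: le_normr_Rintegral => //.
  exact: (dominated_integrable weight_w4 (tri_fun_dominated hk nf ng)).
apply: le_Rintegral => //.
- have [mF [C hC]] := tri_fun_dominated hk nf ng.
  apply: (dominated_integrable weight_w4); split; first exact: measurableT_comp.
  by exists C => z; rewrite normr_id; exact: hC.
- exact: (dominated_integrable weight_w4 (tri_fun_dominated hk' nf' ng')).
by move=> z _; rewrite /tri_fun !normrM ler_wpM2r// mulr_ge0.
Qed.

(** The best [l] is [G / A]. Replacing [A] and [G] by [A + r] and [G + r] with
    a small [r] covers the degenerate cases. *)
Lemma amgm_optimise (X A G : R) : 0 <= A -> 0 <= G ->
  (forall l, 0 < l -> X <= 2^-1 * (l * A ^+ 2 + G ^+ 2 / l)) -> X <= A * G.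
Proof.
move=> A0 G0 h; apply/ler_addgt0Pr => e e0.
pose s := e / (A + G + 1).
have AG1 : 0 < A + G + 1 by rewrite ltr_wpDl// addr_ge0.
have s0 : 0 < s by rewrite divr_gt0.
have As : 0 < A + s by rewrite ltr_wpDl.
have Gs : 0 < G + s by rewrite ltr_wpDl.
(* The cap at 1 makes [r * r <= r] available. *)
pose r := Num.min s 1.
have r0 : 0 < r by rewrite lt_min s0 ltr01.
have rs : r <= s by rewrite ge_min lexx.
have r1 : r <= 1 by rewrite ge_min lexx orbT.
have Ar : 0 < A + r by rewrite ltr_wpDl.
have Gr : 0 < G + r by rewrite ltr_wpDl.
apply: le_trans (h ((G + r) / (A + r)) _) _; first by rewrite divr_gt0.
have b1 : (G + r) / (A + r) * A ^+ 2 <= (G + r) * (A + r).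
  rewrite mulrAC ler_pdivrMr// -mulrA ler_pM2l//; nra.
have b2 : G ^+ 2 / ((G + r) / (A + r)) <= (G + r) * (A + r).
  rewrite invf_div mulrA ler_pdivrMr//.
  have : 0 <= (A + r) * ((G + r) ^+ 2 - G ^+ 2) by rewrite mulr_ge0 ?ltW//; nra.
  nra.
have b3 : r * (A + G + 1) <= e.
  by rewrite -ler_pdivlMr.
have : (G + r) * (A + r) <= A * G + r * (A + G + 1).
  have : r * r <= r by rewrite ler_piMr// ltW.
  nra.
lra.
Qed.

End plane_integrals.

Section kappa.
Context {R : realType}.
Local Notation mu := (@lebesgue_measure R).

(** A minorant of the profile of [bump] that splits into a product over the
    coordinates, which reduces the approximate identity in the plane to one on
    the line. *)
Definition kappa (s : R) : R := jw s ^+ 2.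

Lemma kappa_continuous : continuous kappa.
Proof. by move=> s; apply: cvgM; exact: jw_continuous. Qed.

Lemma kappa_ge0 s : 0 <= kappa s. Proof. exact: sqr_ge0. Qed.

Lemma kappa_le_jw : exists C, forall s, `|kappa s| <= C * jw s.
Proof.
exists 1 => s; rewrite ger0_norm ?kappa_ge0// mul1r /kappa expr2.
by rewrite ler_piMr ?jw_le1// ltW// jw_gt0.
Qed.

Lemma kappa_even s : kappa (- s) = kappa s.
Proof. by rewrite /kappa jwN. Qed.

(** By [(x1^2 + d^2) (x2^2 + d^2) >= d^2 (rad x)^2], and likewise with [d^3
    rad x] on the right, the product of kernels is at most the first term of
    [bump]. *)
Lemma rescaled_kappa_le (d : R) x : 0 < d ->
  rescaled_kap2 kappa d x <= bump d x.
Proof.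
move=> d0; apply: le_trans (bump_ge d0 x).
have s0 := rad_gt0 d0 x; have hs := sqr_rad d x; have hd := rad_ge d0 x.
set s := rad d x in s0 hs hd.
pose p1 := x.1 ^+ 2 + d ^+ 2; pose p2 := x.2 ^+ 2 + d ^+ 2.
have d20 : 0 < d ^+ 2 by rewrite exprn_gt0.
have p10 : 0 < p1 by rewrite ltr_wpDl// sqr_ge0.
have p20 : 0 < p2 by rewrite ltr_wpDl// sqr_ge0.
have dn0 := lt0r_neq0 d0; have sn0 := lt0r_neq0 s0.
have e (c : R) : kappa (c / d) = d ^+ 4 / (c ^+ 2 + d ^+ 2) ^+ 2.
  have : c ^+ 2 + d ^+ 2 != 0 by rewrite lt0r_neq0// ltr_wpDl// sqr_ge0.
  have : 1 + (c / d) ^+ 2 != 0 by exact: lt0r_neq0 (oneDsq_gt0 _).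
  rewrite /kappa /jw expr_div_n => h1 h2; field.
  by rewrite h2 dn0.
rewrite /rescaled_kap2 !e /irad -/s -/p1 -/p2.
have -> : d^-1 * (d ^+ 4 / p1 ^+ 2) * (d^-1 * (d ^+ 4 / p2 ^+ 2)) =
    d ^+ 6 / (p1 * p2) ^+ 2.
  by field; rewrite dn0 !lt0r_neq0.
rewrite exprVn ler_pdivrMr ?exprn_gt0 ?mulr_gt0// mulrAC ler_pdivlMr ?exprn_gt0//.
have h1 : s ^+ 2 * d ^+ 2 <= p1 * p2.
  rewrite hs /p1 /p2; have := mulr_ge0 (sqr_ge0 x.1) (sqr_ge0 x.2); nra.
have h2 : s * d ^+ 3 <= p1 * p2.
  apply: le_trans h1.
  have -> : s * d ^+ 3 = (s * d ^+ 2) * d by ring.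
  have -> : s ^+ 2 * d ^+ 2 = (s * d ^+ 2) * s by ring.
  by rewrite ler_pM2l// mulr_gt0.
have -> : d ^+ 6 * s ^+ 3 = d * ((s ^+ 2 * d ^+ 2) * (s * d ^+ 3)) by ring.
have h3 : 0 <= s ^+ 2 * d ^+ 2 by rewrite mulr_ge0// exprn_ge0// ltW.
have h4 : 0 <= s * d ^+ 3 by rewrite mulr_ge0 ?exprn_ge0 ?ltW.
by rewrite ler_pM2l// [leRHS]expr2; exact: ler_pM.
Qed.

Lemma kmass_kappa_gt0 : 0 < kmass kappa.
Proof.
have h1 : Rintegral mu setT (wT 1) = 1 :> R.
  have e : IT 1 (fun=> 1) = 1 - 0 :> R.
    apply: (@IT_FTC R 1 ltr01 (fun s => s) (fun=> 1)).
    - by move=> s; exact: cvg_id.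
    - by move=> s; exact: cvg_cst.
    - by move=> t _; exact: der_id.
  rewrite subr0 in e; rewrite -[RHS]e /IT.
  by apply: eq_Rintegral => t _; rewrite mulr1.
have dw : dominated (prodw (wT 1) (wT 1)) (prodw (wT 1) (wT 1) : R * R -> R).
  exact: (dominated_weight (weight_prod (weight_wT 1) (weight_wT 1))).
have h2 : I2 (prodw (wT 1) (wT 1)) = 1 :> R.
  rewrite /I2 (Rintegral_fubini1 (weight_wT 1) (weight_wT 1) dw).
  rewrite -[RHS]h1; apply: eq_Rintegral => s _.
  rewrite /prodw/= RintegralZl ?h1 ?mulr1//.
  exact: (weight_wT 1).2.
have k16 s : 4^-1 * wT 1 s <= kappa s.
  rewrite /wT indicE; case: (boolP (s \in _)); last by rewrite mulr0 kappa_ge0.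
  rewrite inE/= in_itv/= => /andP[s0 s1].
  rewrite mulr1 /kappa /jw exprVn lef_pV2 ?posrE ?exprn_gt0 ?oneDsq_gt0//.
  have : 1 + s ^+ 2 <= 2 by nra.
  have := oneDsq_gt0 s; nra.
suff : 16^-1 <= kmass kappa by apply: lt_le_trans; rewrite invr_gt0.
have -> : 16^-1 = 16^-1 * I2 (prodw (wT 1) (wT 1)) :> R by rewrite h2 mulr1.
rewrite /kmass /I2 -RintegralZl//; last first.
  exact: (weight_prod (weight_wT 1) (weight_wT 1)).2.
apply: le_Rintegral => //.
- have := dominatedZ (weight_prod (weight_wT 1) (weight_wT 1)) 16^-1 dw.
  exact: (dominated_integrable (weight_prod (weight_wT 1) (weight_wT 1))).
- by apply: nice_integrable; exact: (kap2_nice kappa_continuous kappa_le_jw).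
- move=> z _; rewrite /prodw /kap2.
  have -> : 16^-1 * (wT 1 z.1 * wT 1 z.2) = (4^-1 * wT 1 z.1) * (4^-1 * wT 1 z.2).
    by field.
  have w0 (s : R) : 0 <= 4^-1 * wT 1 s by rewrite mulr_ge0 ?invr_ge0//; exact: (weight_wT 1).1.
  exact: (ler_pM (w0 z.1) (w0 z.2) (k16 z.1) (k16 z.2)).
Qed.

End kappa.

(** * The space-time bound *)

Section space_time_bound.
Context {R : realType}.
Local Notation mu := (@lebesgue_measure R).
Variables (T : R) (u v : R -> R * R -> R) (u1 v1 : bool -> R -> R * R -> R).
Variables (u2 v2 u3 v3 : bool -> bool -> R -> R * R -> R).
Hypothesis T0 : 0 < T.
Hypothesis H : nls_data T u v u1 v1 u2 v2 u3 v3.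

Local Notation rhoT := (rhoT u v).
Local Notation momT := (momT u v u1 v1).

Lemma I2_field_dominated (a : R -> R * R -> R) : field a ->
  dominated (wT T) (fun t => wT T t * I2 (a t)).
Proof.
move=> fa; have [C hC] := fa.2.
have dom : dominated (prodw (wT T) w2) (fun p : R * (R * R) => wT T p.1 * a p.1 p.2).
  split.
    apply: measurable_funM; last exact: field_measurable.
    by case: (dominated_weight (weight_wT T)) => mw _; exact: (measurableT_comp mw measurable_fst).
  exists C => p; rewrite normrM ger0_norm; last exact: (weight_wT T).1.
  by rewrite /prodw mulrCA ler_wpM2l//; exact: (weight_wT T).1.
have := dominated_fubini1 (weight_wT T) weight_w2 dom.
congr dominated; apply/funext => t; rewrite /I2 -RintegralZl//=.
by apply: nice_integrable; exact: field_nice.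
Qed.

Definition kin j t := I2 (en (u1^~ t) (v1^~ t) j j).

Variables (A G : R).
Hypotheses (A0 : 0 <= A) (G0 : 0 <= G).
Hypothesis massA : forall t, 0 <= t <= T -> I2 (rhoT t) <= A ^+ 2.
Hypothesis kinG : forall j t, 0 <= t <= T -> kin j t <= G ^+ 2.

Let nrho t : nice (rhoT t).
Proof. exact: field_nice (field_rho H). Qed.

Let nmom j t : nice (momT j t).
Proof. exact: field_nice (field_mom H j). Qed.

Let rho0 t x : 0 <= rhoT t x.
Proof. by rewrite addr_ge0// sqr_ge0. Qed.

(** Cauchy-Schwarz, in the form of a weighted arithmetic-geometric mean
    inequality for the densities that is optimised after integration. *)
Lemma I2_mom_le j t : 0 <= t <= T -> I2 (fun x => `|momT j t x|) <= A * G.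
Proof.
move=> tT; apply: amgm_optimise => // l l0.
have nen : nice (en (u1^~ t) (v1^~ t) j j).
  have n1 := field_nice t (nls_u1 H j); have n2 := field_nice t (nls_v1 H j).
  by apply: niceD; apply: niceM.
apply: (@le_trans _ _ (I2 (fun x => 2^-1 * (l * rhoT t x + l^-1 * en (u1^~ t) (v1^~ t) j j x)))).
  apply: le_I2; first exact/nice_norm.
    by apply: niceZ; apply: niceD; apply: niceZ.
  move=> x; rewrite /momT /mom /rhoT /rho /en.
  set a := u t x; set b := v t x; set a1 := u1 j t x; set b1 := v1 j t x.
  have l20 := lt0r_neq0 l0.
  have e1 s : s ^+ 2 = 1 -> 0 <= l * (a ^+ 2 + b ^+ 2) + l^-1 * (a1 * a1 + b1 * b1)
      - 2 * (s * (a * b1 - b * a1)).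
    move=> s2.
    have -> : l * (a ^+ 2 + b ^+ 2) + l^-1 * (a1 * a1 + b1 * b1) -
        2 * (s * (a * b1 - b * a1)) =
        l^-1 * ((l * a - s * b1) ^+ 2 + (l * b + s * a1) ^+ 2).
      transitivity (l * (a ^+ 2 + b ^+ 2) + l^-1 * s ^+ 2 * (a1 * a1 + b1 * b1) -
        2 * (s * (a * b1 - b * a1))); first by rewrite s2 mulr1.
      by field.
    by rewrite mulr_ge0 ?invr_ge0 ?(ltW l0)// addr_ge0// sqr_ge0.
  have h1 := e1 1 (expr1n _ _).
  have h2 : 0 <= l * (a ^+ 2 + b ^+ 2) + l^-1 * (a1 * a1 + b1 * b1)
      - 2 * (-1 * (a * b1 - b * a1)) by apply: e1; rewrite sqrrN expr1n.
  by rewrite ler_norml; apply/andP; split; lra.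
rewrite I2Z; last by apply: niceD; apply: niceZ.
rewrite ler_pM2l ?invr_gt0// I2D; [|exact: niceZ..].
rewrite !I2Z//; apply: lerD; first by rewrite ler_pM2l// massA.
by rewrite mulrC ler_pM2r ?invr_gt0//; exact: kinG.
Qed.

Variables (M : R).
Hypothesis M0 : 0 < M.
Hypothesis MT : M ^+ 3 = T.

(** By [wgrad_le2] and [I2_mom_le] the Morawetz action is at most a multiple
    of [A^3 G], while the bump at scale [M] is at most [4 / M^2] and so costs
    at most [4 T A^4 / M^2] in the final bound. After multiplication by [M],
    the choice [M^3 = T] gives both contributions the factor [M]. *)
Lemma bump_bound d : 0 < d -> d < M ->
  IT T (fun t => tri (rescaled_kap2 kappa d) (rhoT t) (rhoT t)) <=
  M * (16 * A ^+ 3 * G + 4 * A ^+ 4).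
Proof.
move=> d0 dM; have fr := field_rho H.
have hM := morawetz_integrated T0 H d0 dM.
pose K x := M^-1 * (bump d x - bump M x).
have hK : bounded_kernel K.
  have hw := wlap2_bounded d0 dM.
  have := bounded_kernelN (bounded_kernelD (hw false) (hw true)).
  by congr bounded_kernel; apply/funext => x; rewrite wlap2_sum// /K; ring.
have hR := rescaled_kap2_bounded (@kappa_continuous R) kappa_le_jw d.
have Dj j t : 0 <= t <= T -> `|tri (wgrad M d j) (momT j t) (rhoT t)| <= 2 * (A ^+ 3 * G).
  move=> tT; apply: le_trans (tri_le (wgrad_bounded d0 dM j) (wgrad_le2 d0 dM j) _ _) _ => //.
  rewrite ler_pM2l// [leRHS](_ : _ = (A * G) * A ^+ 2); last by ring.
  apply: ler_pM.
  - exact: I2_ge0.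
  - exact: I2_ge0.
  - exact: I2_mom_le.
  - rewrite (_ : (fun x => `|rhoT t x|) = rhoT t); first exact: massA.
    by apply/funext => x; rewrite ger0_norm.
have up : 2^-1 * IT T (fun t => tri K (rhoT t) (rhoT t)) <= 8 * (A ^+ 3 * G).
  apply: le_trans hM _; rewrite big_bool/=.
  have t0 : 0 <= (0 : R) <= T by rewrite lexx ltW.
  have tT : 0 <= T <= T by rewrite lexx ltW.
  have := Dj false _ t0; have := Dj false _ tT.
  have := Dj true _ t0; have := Dj true _ tT.
  rewrite !ler_norml => /andP[h1 h2] /andP[h3 h4] /andP[h5 h6] /andP[h7 h8].
  by lra.
have low t : 0 <= t <= T -> tri (rescaled_kap2 kappa d) (rhoT t) (rhoT t) <=
    M * tri K (rhoT t) (rhoT t) + 4 / M ^+ 2 * A ^+ 4.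
  move=> tT.
  have nr := nrho t.
  have hc := @bounded_kernel_cst R 1.
  have : 0 <= sum_tri [:: (M, (K, rhoT t, rhoT t));
      (-1, (rescaled_kap2 kappa d, rhoT t, rhoT t)); (4 / M ^+ 2, (fun=> 1, rhoT t, rhoT t))].
    apply: sum_tri_ge0; first by rewrite /=; do 3! (split; first by split).
    move=> x y; apply: addr_ge0; rewrite /sum_tri_fun /tri_fun /=.
    - set z := sub2 _ _; have h1 := rescaled_kappa_le z d0; have h2 := bump_le M0 z.
      rewrite addr0 [leRHS](_ : _ = ((bump d z - rescaled_kap2 kappa d z) +
        (4 / M ^+ 2 - bump M z)) * (rhoT t x * rhoT t y)); last first.
        by rewrite /K; field; exact: lt0r_neq0.
      by rewrite mulr_ge0 ?mulr_ge0// addr_ge0// subr_ge0.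
    - set z := sub2 _ _; have h1 := rescaled_kappa_le z d0; have h2 := bump_le M0 z.
      rewrite addr0 [leRHS](_ : _ = ((bump d z - rescaled_kap2 kappa d z) +
        (4 / M ^+ 2 - bump M z)) * (rhoT t y * rhoT t x)); last first.
        by rewrite /K; field; exact: lt0r_neq0.
      by rewrite mulr_ge0 ?mulr_ge0// addr_ge0// subr_ge0.
  rewrite /= addr0 tri_cst// mul1r mulN1r => h.
  have hm : I2 (rhoT t) * I2 (rhoT t) <= A ^+ 4.
    rewrite (_ : A ^+ 4 = A ^+ 2 * A ^+ 2); last by ring.
    by apply: ler_pM; rewrite ?I2_ge0// massA.
  have c0 : 0 <= 4 / M ^+ 2 by rewrite divr_ge0// sqr_ge0.
  have h2 := ler_wpM2l c0 hm.
  lra.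
have dK : dominated (wT T) (fun t => wT T t * tri K (rhoT t) (rhoT t)).
  exact: tri_IT_dominated.
have cst1 : dominated (wT T) (fun t => wT T t * 1).
  by have := dominated_weight (weight_wT T); congr dominated; apply/funext => t; rewrite mulr1.
have IT1 : IT T (fun=> 1) = T.
  have -> : IT T (fun=> 1) = T - 0; last by rewrite subr0.
  apply: (@IT_FTC R T T0 (fun s => s) (fun=> 1)).
  - by move=> s; exact: cvg_id.
  - by move=> s; exact: cvg_cst.
  - by move=> t _; exact: der_id.
apply: (@le_trans _ _ (IT T (fun t => M * tri K (rhoT t) (rhoT t) + (4 / M ^+ 2 * A ^+ 4) * 1))).
  apply: le_IT.
  - exact: tri_IT_dominated.
  - by apply: dominated_wTD; apply: dominated_wTZ.
  - by move=> t tT; rewrite mulr1; exact: low.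
rewrite ITD; [|exact: dominated_wTZ..].
rewrite !ITZ// IT1 mulrDr; apply: lerD.
  rewrite ler_pM2l//; lra.
rewrite -MT le_eqVlt; apply/orP; left; apply/eqP.
by field; exact: lt0r_neq0.
Qed.

(** As [d] tends to zero in [bump_bound] the kernels concentrate on the
    diagonal. Their interaction integrals are bounded uniformly in time and in
    [d], so the limit passes under the time integral. *)
Theorem nls_L4_bound :
  kmass kappa * IT T (fun t => I2 (fun x => rhoT t x ^+ 2)) <=
  M * (16 * A ^+ 3 * G + 4 * A ^+ 4).
Proof.
have fr := field_rho H.
pose d_ (n : nat) := M / n.+2%:R.
have d0 n : 0 < d_ n by rewrite divr_gt0// ltr0n.
have dM n : d_ n < M by rewrite ltr_pdivrMr ?ltr0n// ltr_pMr// ltr1n.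
have cd : d_ n @[n --> \oo] --> (0 : R).
  rewrite -(mulr0 M); apply: cvgM; first exact: cvg_cst.
  by rewrite (cvg_shiftS (fun n => (n.+1%:R : R)^-1)); exact: cvg_harmonic.
have [B hB] := tri_rescale_bound (@kappa_continuous R) kappa_ge0 kappa_le_jw kappa_even.
have [F0 hF0] := fr.2.
pose F := `|F0|.
have hF t x : `|rhoT t x| <= F * w2 x.
  rewrite (le_trans (hF0 t x))// ler_wpM2r ?ler_norm//; exact/ltW/w2_gt0.
have hF1 t x : `|rhoT t x| <= F.
  by apply: le_trans (hF t x) _; apply: ler_piMr; [exact: normr_ge0|exact: w2_le1].
have hR n := rescaled_kap2_bounded (@kappa_continuous R) kappa_le_jw (d_ n).
have lim : IT T (fun t => tri (rescaled_kap2 kappa (d_ n)) (rhoT t) (rhoT t)) @[n --> \oo] -->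
    IT T (fun t => kmass kappa * I2 (fun x => rhoT t x * rhoT t x)).
  apply: (Rintegral_dct (weight_wT T) (C := F * F * B)).
  - by move=> n; case: (tri_IT_dominated T (hR n) fr fr).
  - move=> n t; rewrite normrM ger0_norm; last exact: (weight_wT T).1.
    rewrite [leRHS]mulrC; apply: ler_wpM2l; first exact: (weight_wT T).1.
    by apply: hB => //; exact: normr_ge0.
  - move=> t; apply: cvgM; first exact: cvg_cst.
    by apply: (tri_rescale_cvg (@kappa_continuous R) kappa_ge0 kappa_le_jw kappa_even) => //.
have -> : kmass kappa * IT T (fun t => I2 (fun x => rhoT t x ^+ 2)) =
    IT T (fun t => kmass kappa * I2 (fun x => rhoT t x * rhoT t x)).
  by rewrite ITZ//; apply: I2_field_dominated; exact: fieldM.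
rewrite -(cvg_lim _ lim)//; apply: limr_le; first by apply/cvg_ex; eexists; exact: lim.
by apply: nearW => n; exact: bump_bound.
Qed.

End space_time_bound.

(** * Equality of mixed partial derivatives *)

Section clairaut.
Context {R : realType}.

Lemma clairaut_aux (F F1 F12 : R -> R -> R) (a b h : R) : 0 < h ->
  (forall s t, a <= s <= a + h -> b <= t <= b + h -> der (F^~ t) s (F1 s t)) ->
  (forall s t, a <= s <= a + h -> b <= t <= b + h -> der (F1 s) t (F12 s t)) ->
  exists s t, [/\ a <= s <= a + h, b <= t <= b + h &
    F (a + h) (b + h) - F (a + h) b - (F a (b + h) - F a b) = F12 s t * (h * h)].
Proof.
move=> h0 d1 d12.
have ah : a < a + h by rewrite ltrDl.
have bh : b < b + h by rewrite ltrDl.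
have b0 : b <= b <= b + h by rewrite lexx ltW.
have b1 : b <= b + h <= b + h by rewrite lexx ltW.
have [s sI e1] := der_mvt ah (f := fun s => F s (b + h) - F s b)
  (f' := fun s => F1 s (b + h) - F1 s b)
  (fun s sI => derB (d1 s _ sI b1) (d1 s _ sI b0)).
have sI' : a <= s <= a + h by case/andP: sI => ? ?; rewrite !ltW.
have [t tI e2] := der_mvt bh (f := F1 s) (f' := F12 s) (fun t tI => d12 s t sI' tI).
exists s, t; split => //; first by case/andP: tI => ? ?; rewrite !ltW.
rewrite mulrA; have -> : F (a + h) (b + h) - F (a + h) b - (F a (b + h) - F a b) =
  (F1 s (b + h) - F1 s b) * (a + h - a) by rewrite -e1.
by rewrite e2 !(addrC _ h) !addrK.
Qed.

(** By the mean value theorem, the second difference over a square of side [h]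
    is [h^2] times either mixed derivative at some point of the square. *)
Lemma clairaut (F F1 F2 F12 F21 : R -> R -> R) (a b e : R) : 0 < e ->
  (forall s t, `|s - a| < e -> `|t - b| < e -> der (F^~ t) s (F1 s t)) ->
  (forall s t, `|s - a| < e -> `|t - b| < e -> der (F s) t (F2 s t)) ->
  (forall s t, `|s - a| < e -> `|t - b| < e -> der (F1 s) t (F12 s t)) ->
  (forall s t, `|s - a| < e -> `|t - b| < e -> der (F2^~ t) s (F21 s t)) ->
  {for (a, b), continuous (fun p : R * R => F12 p.1 p.2)} ->
  {for (a, b), continuous (fun p : R * R => F21 p.1 p.2)} ->
  F12 a b = F21 a b.
Proof.
move=> e0 d1 d2 d12 d21 c12 c21; apply/eqP; rewrite -subr_eq0 -normr_le0.
apply/ler_addgt0Pr => g g0; rewrite add0r.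
have g20 : 0 < g / 2 by rewrite divr_gt0.
have near_ball (P : R * R -> Prop) : nbhs (a, b) P ->
    exists2 r, 0 < r & forall s t, `|s - a| < r -> `|t - b| < r -> P (s, t).
  move=> /nbhs_ballP[r /= r0 hr]; exists r => // s t hs ht; apply: hr.
  by split; rewrite /= /ball/= distrC.
have /cvgrPdist_lt/(_ _ g20)/near_ball[r1 r10 h1] := c12.
have /cvgrPdist_lt/(_ _ g20)/near_ball[r2 r20 h2] := c21.
(* Half of the minimum keeps the closed square inside the open balls. *)
pose h := Num.min e (Num.min r1 r2) / 2.
have h0 : 0 < h by rewrite divr_gt0// !lt_min e0 r10 r20.
have [he hr1 hr2] : [/\ h < e, h < r1 & h < r2].
  have m0 : 0 < Num.min e (Num.min r1 r2) by rewrite !lt_min e0 r10 r20.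
  have hm : h < Num.min e (Num.min r1 r2) by rewrite /h ltr_pdivrMr// ltr_pMr// ltr1n.
  by move: hm; rewrite !lt_min => /andP[? /andP[? ?]].
have close c s r : h < r -> c <= s <= c + h -> `|s - c| < r.
  move=> hr /andP[cs sc]; rewrite ger0_norm ?subr_ge0// (le_lt_trans _ hr)//.
  by rewrite lerBlDl.
have [s [t [sI tI E1]]] := clairaut_aux h0
  (fun s t sI tI => d1 s t (close _ _ _ he sI) (close _ _ _ he tI))
  (fun s t sI tI => d12 s t (close _ _ _ he sI) (close _ _ _ he tI)).
have [t' [s' [tI' sI' E2]]] := @clairaut_aux (fun t s => F s t) (fun t s => F2 s t)
  (fun t s => F21 s t) b a h h0
  (fun t s tI sI => d2 s t (close _ _ _ he sI) (close _ _ _ he tI))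
  (fun t s tI sI => d21 s t (close _ _ _ he sI) (close _ _ _ he tI)).
have eq : F12 s t = F21 s' t'.
  apply: (@mulIf _ (h * h)); first by rewrite mulf_neq0// lt0r_neq0.
  by rewrite -E1 -E2; ring.
have := h1 s t (close _ _ _ hr1 sI) (close _ _ _ hr1 tI).
have := h2 s' t' (close _ _ _ hr2 sI') (close _ _ _ hr2 tI').
rewrite /= -eq => k2 k1.
rewrite (le_trans (ler_distD (F12 s t) _ _))//.
rewrite (splitr g) lerD// ltW//.
by rewrite distrC.
Qed.

End clairaut.

(** * Fields attached to a smooth solution *)

Section clamped_slab.
Context {R : realType}.
Variable T : R.
Hypothesis T0 : 0 < T.

Definition clamp (t : R) : R := Num.min T (Num.max 0 t).

Lemma clamp_itv t : 0 <= clamp t <= T.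
Proof. by rewrite /clamp le_min ge_min lexx (ltW T0)/= le_max lexx. Qed.

Lemma clamp_id t : 0 <= t <= T -> clamp t = t.
Proof. by case/andP => t0 tT; rewrite /clamp (max_idPr t0) (min_idPr tT). Qed.

Lemma clamp_continuous : continuous clamp.
Proof.
move=> t; apply: (@continuous_min R R (fun=> T) (fun t => Num.max 0 t)).
  exact: cvg_cst.
apply: (@continuous_max R R (fun=> 0) (fun t => t)); [exact: cvg_cst|exact: cvg_id].
Qed.

Definition idx (j : bool) : 'I_2 := if j then 1 else 0.

Lemma pder_partialx j (f : R * R -> R) :
  (forall x, derivable f x (basis_vec (idx j))) -> pder j f (partialx (idx j) f).
Proof.
move=> df x; have hx := df x.
have e : (fun h : R => h^-1 *: ((f \o shift x) (h *: basis_vec (idx j)) - f x)) =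
    (fun h : R => h^-1 *: (((fun s => f (upd j x s)) \o shift (crd j x)) (h *: 1) -
       f (upd j x (crd j x)))).
  apply/funext => h; congr (_ *: (f _ - _)); last by rewrite upd_crd.
  have hv : basis_vec (idx j) = upd j (0, 0) 1 :> R * R by case: (j).
  rewrite hv; case: (j); rewrite /upd /crd /shift /=.
    change ((h * 0 + x.1, h * 1 + x.2) = (x.1, h * 1 + x.2)).
    by rewrite mulr0 add0r.
  change ((h * 1 + x.1, h * 0 + x.2) = (h * 1 + x.1, x.2)).
  by rewrite mulr0 add0r.
split.
  by rewrite /derivable -e.
by rewrite /partialx /derive -e.
Qed.

Variable f : R -> R * R -> R.
Hypothesis sf : smooth_slab T f.

(** The partial derivative of [f] along the word [s], frozen in time outside
    the interval, which makes it continuous on the whole space-time. *)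
Definition fl (s : seq (option 'I_2)) t x := foldr (partial T) f s (clamp t) x.

Lemma fl_continuous s : continuous (fun p : R * (R * R) => fl s p.1 p.2).
Proof.
have [/subspace_continuousP cs _] := sf s.
pose phi (p : R * (R * R)) := (clamp p.1, p.2).
have cphi : continuous phi.
  apply: continuous_pair => p; last exact: cvg_snd.
  by apply: continuous_comp; [exact: cvg_fst|exact: clamp_continuous].
have inA p : (`[0, T]%classic `*` [set: R * R]) (phi p).
  by split => //=; rewrite in_itv/= clamp_itv.
move=> p.
have h1 : phi x @[x --> p] --> within (`[0, T] `*` [set: R * R]) (nbhs (phi p)).
  move=> P hP; have := cphi p _ hP.
  by rewrite /= !nbhs_simpl /=; apply: filterS => q /(_ (inA q)).
exact: (cvg_comp _ _ h1 (cs _ (inA p))).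
Qed.

Lemma fl_pder s j t : pder j (fl s t) (fl (Some (idx j) :: s) t).
Proof.
have [_ ds] := sf s.
have tI : clamp t \in `[0, T] by rewrite in_itv/= clamp_itv.
exact: (pder_partialx (fun x => ds (Some (idx j)) (clamp t) x tI)).
Qed.

(** At an interior time the one-sided restriction in the difference quotient
    is void. *)
Lemma fl_tder s : tder T (fl s) (fl (None :: s)).
Proof.
move=> t x /andP[t0 tT]; have [_ ds] := sf s.
have tI : t \in `[0, T] by rewrite in_itv/= !ltW.
set g := foldr (partial T) f s in ds.
have hd : cvg (diff_quot_within `[0, T] (g^~ x) t) := ds None t x tI.
have shiftF : (h *: (1 : R) + t) @[h --> (0 : R)^'] --> within `[0, T] (t^').
  move=> P hP; have {hP} : nbhs t (fun s => s != t -> `[0, T]%classic s -> P s) by [].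
  move=> /nbhs_ballP[r /= r0 hr].
  pose m := Num.min r (Num.min t (T - t)).
  have m0 : 0 < m by rewrite !lt_min r0 t0 subr_gt0.
  suff : nbhs (0 : R) (fun h => h != 0 -> P (h *: (1 : R) + t)) by [].
  apply/nbhs_ballP; exists m => //= h; rewrite /ball/= sub0r normrN !lt_min.
  move=> /andP[hr1 /andP[ht hT]] h0; rewrite /GRing.scale/= mulr1.
  apply: hr.
  - by rewrite /ball/= opprD addrCA subrr addr0 normrN.
  - by rewrite -subr_eq0 addrK.
  - move: ht hT; rewrite !ltr_norml /= in_itv/= => /andP[? ?] /andP[? ?].
    by apply/andP; split; lra.
have dg : der (g^~ x) t (lim (diff_quot_within `[0, T] (g^~ x) t)).
  have key : h^-1 *: (g (h *: (1 : R) + t) x - g t x) @[h --> (0 : R)^'] -->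
      lim (diff_quot_within `[0, T] (g^~ x) t).
    have := cvg_comp _ _ shiftF hd.
    apply: cvg_trans; apply: near_eq_cvg; near=> h => /=.
    by rewrite /GRing.scale/= mulr1 addrK mulrC.
  by split; [apply/cvg_ex; eexists; exact: key|exact: cvg_lim key].
have tT' : 0 <= t <= T by rewrite (ltW t0) (ltW tT).
have -> : fl (None :: s) t x = lim (diff_quot_within `[0, T] (g^~ x) t).
  by rewrite /fl/= (clamp_id tT').
apply: near_eq_is_derive dg; near=> r; rewrite /fl clamp_id//.
by apply/andP; split; apply: ltW; near: r; [exact: lt_nbhsr|exact: lt_nbhsl].
Unshelve. all: by end_near. Qed.

End clamped_slab.

Section almost_everywhere.
Context {R : realType}.
Local Notation mu := (@lebesgue_measure R).
Variable T : R.
Hypothesis T0 : 0 < T.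

(** A bound violated at one time is violated on an interval, which has
    positive measure. *)
Lemma continuous_ae_le (g : R -> R) (C : R) : continuous g ->
  (\forall t \ae mu, 0 <= (t : R) <= T -> g t <= C) ->
  forall t : R, 0 <= t <= T -> g t <= C.
Proof.
move=> cg [N [mN N0 hN]] t0 /andP[t00 t0T]; rewrite leNgt; apply/negP => gC.
have /nbhs_ballP[e /= e0 he] : nbhs t0 [set t | C < g t].
  have := cg t0 [set y | C < y]; apply.
  by apply: open_nbhs_nbhs; split => //; exact: open_gt.
pose a := Num.max 0 (t0 - e); pose b := Num.min T (t0 + e).
have ab : a < b.
  rewrite /a /b gt_max !lt_min.
  have h1 : 0 < t0 + e by rewrite ltr_wpDl.
  have h2 : t0 - e < T by rewrite ltrBlDr (le_lt_trans t0T)// ltrDl.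
  have h3 : t0 - e < t0 + e by rewrite ltrBlDr -addrA ltrDl addr_gt0.
  by rewrite T0 h1 h2 h3.
have sub : `]a, b[%classic `<=` N.
  move=> t /=; rewrite in_itv/= /a /b gt_max lt_min => /andP[/andP[t1 t2] /andP[t3 t4]].
  apply: hN => /= h.
  have : C < g t by apply: he; rewrite /ball/= ltr_norml; apply/andP; split; lra.
  by rewrite ltNge h// !ltW.
have : (mu `]a, b[%classic <= mu N)%E.
  by apply: le_measure; rewrite ?inE//; exact: measurable_itv.
rewrite N0 lebesgue_measure_itv/= lte_fin ab -EFinB lee_fin.
by rewrite subr_le0 leNgt ab.
Qed.

Lemma LqtNorm_oo_ae (N : R -> \bar R) : (forall t, 0 <= N t)%E ->
  \forall t \ae mu, 0 <= t <= T -> (N t <= LqtNorm T +oo N)%E.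
Proof.
move=> N0; rewrite /LqtNorm unlock.
have -> : (0 < mu [set: R])%E.
  have h : (mu `[0%R, T]%classic <= mu [set: R])%E.
    by apply: le_measure; rewrite ?inE//; exact: measurable_itv.
  by apply: lt_le_trans h; rewrite lebesgue_measure_itv/= lte_fin T0 -EFinB lte_fin subr0.
have := ess_sup_inf.ess_sup_ge mu (abse \o (N \_ `[0, T])).
apply: filterS => t h tT; apply: le_trans h.
rewrite /= patchE mem_set; last by rewrite /= in_itv.
by rewrite gee0_abs.
Qed.

End almost_everywhere.

Section extraction.
Context {R : realType}.
Local Notation mu := (@lebesgue_measure R).
Variable T : R.
Hypothesis T0 : 0 < T.

Section one_component.
Local Opaque fl.
Variable f : R -> R * R -> R.
Hypothesis sf : smooth_slab T f.
Local Notation fl := (fl T f).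
Local Notation "'dx j" := (Some (idx j)) (at level 0, j at level 0).

Lemma fl_slice_continuous s t : continuous (fl s t).
Proof.
have h : continuous (fun x : R * R => (t, x)).
  by apply: continuous_pair => x; [exact: cvg_cst|exact: cvg_id].
by have := continuous_compose h (@fl_continuous R T T0 f sf s); exact.
Qed.

Lemma fl_comm_x s t x :
  fl ('dx true :: 'dx false :: s) t x = fl ('dx false :: 'dx true :: s) t x.
Proof.
case: x => a b.
have eta k : (fun p : R * R => fl k t (p.1, p.2)) = fl k t.
  by apply/funext => -[].
apply: (@clairaut _ (fun a b => fl s t (a, b)) (fun a b => fl ('dx false :: s) t (a, b))
  (fun a b => fl ('dx true :: s) t (a, b)) (fun a b => fl ('dx true :: 'dx false :: s) t (a, b))
  (fun a b => fl ('dx false :: 'dx true :: s) t (a, b)) a b 1).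
- exact: ltr01.
- by move=> c e _ _; exact: (fl_pder T0 sf s false t (c, e)).
- by move=> c e _ _; exact: (fl_pder T0 sf s true t (c, e)).
- by move=> c e _ _; exact: (fl_pder T0 sf ('dx false :: s) true t (c, e)).
- by move=> c e _ _; exact: (fl_pder T0 sf ('dx true :: s) false t (c, e)).
- by rewrite eta; exact: fl_slice_continuous.
- by rewrite eta; exact: fl_slice_continuous.
Qed.

Lemma upd_upd j x (a b : R) : upd j (upd j x a) b = upd j x b :> R * R.
Proof. by case: j. Qed.

Lemma crd_upd j x (a : R) : crd j (upd j x a) = a.
Proof. by case: j. Qed.

(** Equality of mixed derivatives in the plane of [t] and of the coordinate
    [j]. *)
Lemma fl_comm_t s j t x : 0 < t < T ->
  fl (None :: 'dx j :: s) t x = fl ('dx j :: None :: s) t x.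
Proof.
move=> /andP[t0 tT].
pose e := Num.min t (T - t).
have e0 : 0 < e by rewrite lt_min t0 subr_gt0.
have inT b : `|b - t| < e -> 0 < b < T.
  rewrite lt_min !ltr_norml => /andP[/andP[? ?] /andP[? ?]].
  by apply/andP; split; lra.
have cont k : continuous (fun p : R * R => fl k p.2 (upd j x p.1)).
  have h : continuous (fun p : R * R => (p.2, upd j x p.1)).
    apply: continuous_pair; first by move=> p; exact: cvg_snd.
    have h1 : continuous (fun p : R * R => p.1) by move=> p; exact: cvg_fst.
    exact: (continuous_compose h1 (@upd_continuous R j x)).
  by have := continuous_compose h (@fl_continuous R T T0 f sf k); exact.
have pd k a b : der (fun a => fl k b (upd j x a)) a (fl ('dx j :: k) b (upd j x a)).
  have := fl_pder T0 sf k j b (upd j x a); rewrite crd_upd.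
  by congr (der _ _ _); apply/funext => s'; rewrite upd_upd.
rewrite -[x](upd_crd j).
apply: (@clairaut _ (fun a b => fl s b (upd j x a)) (fun a b => fl ('dx j :: s) b (upd j x a))
  (fun a b => fl (None :: s) b (upd j x a)) (fun a b => fl (None :: 'dx j :: s) b (upd j x a))
  (fun a b => fl ('dx j :: None :: s) b (upd j x a)) (crd j x) t e).
- exact: e0.
- by move=> a b _ _; exact: pd.
- by move=> a b _ hb; have := @fl_tder R T f sf s b (upd j x a) (inT b hb); apply.
- by move=> a b _ hb; have := @fl_tder R T f sf (Some (idx j) :: s) b (upd j x a) (inT b hb); apply.
- by move=> a b _ _; exact: pd.
- exact: cont.
- exact: cont.
Qed.

End one_component.
End extraction.

Section schwartz_bounds.
Context {R : realType}.
Local Notation mu := (@lebesgue_measure R).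
Local Notation "'dx j" := (Some (idx j)) (at level 0, j at level 0).
Variables (T : R) (u : R -> R * R -> R[i]).
Hypothesis T0 : 0 < T.
Hypothesis su : Linfty_schwartz T u.

Definition part (c : bool) (z : R[i]) : R := if c then complex.Im z else complex.Re z.

Lemma normc_part c (z : R[i]) : `|part c z| <= Normc.normc z.
Proof.
case: z => a b; rewrite -sqrtr_sqr; case: c => /=; apply: ler_wsqrtr.
  by rewrite lerDr sqr_ge0.
by rewrite lerDl sqr_ge0.
Qed.

Lemma part_iter_partialx c a j (f : R * R -> R[i]) :
  (fun x => part c (iter a (cpartialx j) f x)) =
  iter a (partialx j) (fun x => part c (f x)).
Proof.
elim: a => [//|a IH]; rewrite [RHS]iterS -IH.
by apply/funext => x; case: c {IH}.
Qed.

Lemma foldr_partial_space (f : R -> R * R -> R) (s : seq 'I_2) t :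
  foldr (partial T) f (map Some s) t = foldr partialx (f t) s.
Proof.
by elim: s => //= j s IH; apply/funext => x /=; rewrite /partial IH.
Qed.

(** The seminorms of the Schwartz class see the derivatives with those along
    the first coordinate outermost; other words are brought to this form by
    equality of mixed derivatives. *)
Definition sorted_word a b : seq (option 'I_2) := nseq a ('dx false) ++ nseq b ('dx true).

Lemma fl_sorted_word c a b t x : 0 <= t <= T ->
  fl T (fun t x => part c (u t x)) (sorted_word a b) t x =
  part c (iter a (cpartialx 0) (iter b (cpartialx 1) (u t)) x).
Proof.
move=> tT; rewrite /fl clamp_id//.
have -> : sorted_word a b = map Some (nseq a (idx false) ++ nseq b (idx true)).
  by rewrite map_cat !map_nseq.
rewrite foldr_partial_space.
rewrite foldr_cat.
have e (j : 'I_2) n g : foldr partialx g (nseq n j) = iter n (partialx j) g.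
  by elim: n => //= n ->.
rewrite !e.
by rewrite -part_iter_partialx -part_iter_partialx.
Qed.

(** The seminorms are controlled for almost every time only. Continuity in
    time of each value of the derivative extends the bound to all times. *)
Lemma seminorm_bound c k a b : smooth_slab T (fun t x => part c (u t x)) ->
  exists C, forall t x, enorm x ^+ k *
    `|fl T (fun t x => part c (u t x)) (sorted_word a b) t x| <= C.
Proof.
move=> sm; pose N t := schwartz_seminorm k a b (u t).
have fin := su.2 k a b.
have ub t x : ((enorm x ^+ k * Normc.normc
     (iter a (cpartialx 0) (iter b (cpartialx 1) (u t)) x))%:E <= N t)%E.
  by apply: ereal_sup_ubound; exists x.
have N0 t : (0 <= N t)%E.
  apply: le_trans (ub t (0, 0)); rewrite lee_fin mulr_ge0 ?exprn_ge0 ?sqrtr_ge0//.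
  by rewrite /Normc.normc; case: (iter _ _ _ _) => ? ?; exact: sqrtr_ge0.
have fin0 : (0 <= LqtNorm T +oo N)%E by exact: Lnorm_ge0.
have [C hC] : exists C : R, LqtNorm T +oo N = C%:E.
  by exists (fine (LqtNorm T +oo N)); rewrite fineK// ge0_fin_numE.
exists C => t x.
wlog tT : t / 0 <= t <= T => [hw|].
  have := hw _ (clamp_itv T0 t); rewrite /fl clamp_id//; exact: clamp_itv.
move: t tT; apply: (continuous_ae_le T0 (g := fun t => enorm x ^+ k *
    `|fl T (fun t x => part c (u t x)) (sorted_word a b) t x|)).
  move=> t; apply: cvgM; first exact: cvg_cst.
  apply: cvg_norm.
  have h : continuous (fun t : R => (t, x)).
    by apply: continuous_pair => s; [exact: cvg_id|exact: cvg_cst].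
  by have := continuous_compose h (fl_continuous T0 sm (s := sorted_word a b)); apply.
have := LqtNorm_oo_ae T0 N0.
apply: (@filterS _ _ (ae_filter_ringOfSetsType mu)) => t h tT.
rewrite -lee_fin -hC; apply: le_trans (h tT); apply: le_trans (ub t x).
rewrite lee_fin; apply: ler_wpM2l; first by rewrite exprn_ge0// sqrtr_ge0.
by rewrite fl_sorted_word//; exact: normc_part.
Qed.

(** The seminorms of orders 0 and 4 in [enorm] thus control the weight [w2]. *)
Lemma w2_enorm (x : R * R) : 1 <= 2 * (1 + enorm x ^+ 4) * w2 x.
Proof.
have e : enorm x ^+ 4 = (x.1 ^+ 2 + x.2 ^+ 2) ^+ 2.
  by rewrite (exprM _ 2 2) sqr_sqrtr// addr_ge0 ?sqr_ge0.
rewrite e /w2 /jw -invfM ler_pdivlMr ?mulr_gt0 ?ltr_wpDr ?sqr_ge0// mul1r.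
have := sqr_ge0 (x.1 ^+ 2 - x.2 ^+ 2); have := sqr_ge0 (x.1 ^+ 2 + x.2 ^+ 2 - 1).
have := sqr_ge0 x.1; have := sqr_ge0 x.2; nra.
Qed.

Lemma field_sorted_word c a b : smooth_slab T (fun t x => part c (u t x)) ->
  field (fl T (fun t x => part c (u t x)) (sorted_word a b)).
Proof.
move=> sm; split; first exact: (fl_continuous T0 sm).
have [C hC] := seminorm_bound 0 a b sm.
have [D hD] := seminorm_bound 4 a b sm.
exists (2 * (C + D)) => t x.
have h0 := hC t x; have h4 := hD t x; rewrite expr0 mul1r in h0.
have w0 := w2_gt0 x; have hw := w2_enorm x.
set z := `|_| in h0 h4 *; have z0 : 0 <= z by exact: normr_ge0.
apply: le_trans (_ : z * (2 * (1 + enorm x ^+ 4) * w2 x) <= _).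
  by rewrite -[leLHS]mulr1 ler_wpM2l.
rewrite mulrA ler_wpM2r ?(ltW w0)//.
by rewrite mulrCA ler_wpM2l// mulrDr mulr1 lerD// mulrC.
Qed.

End schwartz_bounds.

Section solution_fields.
Context {R : realType}.
Local Notation mu := (@lebesgue_measure R).
Local Notation "'dx j" := (Some (idx j)) (at level 0, j at level 0).
Variables (T : R) (u : R -> R * R -> R[i]).
Hypothesis T0 : 0 < T.
Hypothesis su : Linfty_schwartz T u.
Hypothesis nls : smooth_NLS_solution T u.

Definition sol c := fl T (fun t x => part c (u t x)).

Lemma sol_smooth c : smooth_slab T (fun t x => part c (u t x)).
Proof. by have [h1 h2 _] := nls; case: c. Qed.

Lemma fl_swap c s t :
  sol c [:: 'dx true, 'dx false & s] t = sol c [:: 'dx false, 'dx true & s] t.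
Proof. by apply/funext => x; exact: (fl_comm_x T0 (sol_smooth c)). Qed.

Lemma sol_cons c j s t : sol c ('dx j :: s) t = partialx (idx j) (sol c s t).
Proof. by []. Qed.

Lemma sol_field c a b : field (sol c (sorted_word a b)).
Proof. exact: (field_sorted_word T0 su a b (sol_smooth c)). Qed.

Lemma sol_field2 c k j : field (sol c [:: 'dx k; 'dx j]).
Proof.
case: k j => -[].
- exact: (sol_field c 0 2).
- have -> : sol c [:: 'dx true; 'dx false] = sol c [:: 'dx false; 'dx true].
    by apply/funext => t; exact: fl_swap.
  exact: (sol_field c 1 1).
- exact: (sol_field c 1 1).
- exact: (sol_field c 2 0).
Qed.

Lemma sol_field3 c j k : field (sol c [:: 'dx j; 'dx k; 'dx k]).
Proof.
case: j k => -[].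
- exact: (sol_field c 0 3).
- have -> : sol c [:: 'dx true; 'dx false; 'dx false] =
    sol c [:: 'dx false; 'dx false; 'dx true].
    by apply/funext => t; rewrite fl_swap sol_cons fl_swap.
  exact: (sol_field c 2 1).
- exact: (sol_field c 1 2).
- exact: (sol_field c 3 0).
Qed.

Definition sol_lapl c t x : R :=
  lapl (fun j k => sol c [:: 'dx j; 'dx k] t) x.

Lemma nls_real t x : 0 <= t <= T ->
  sol false [:: None] t x =
    - sol_lapl true t x + rho (sol false [::] t) (sol true [::] t) x * sol true [::] t x /\
  sol true [:: None] t x =
    sol_lapl false t x - rho (sol false [::] t) (sol true [::] t) x * sol false [::] t x.
Proof.
move=> tT; have [_ _ eq] := nls.
have tI : t \in `[0, T] by rewrite in_itv.
have := eq t x tI.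
rewrite /laplacian big_ord_recl big_ord1.
have -> : lift ord0 ord0 = 1 :> 'I_2 by apply/val_inj.
have -> : `|u t x| ^+ 2 =
    Complex (rho (sol false [::] t) (sol true [::] t) x) 0 :> R[i].
  by rewrite -add_Re2_Im2 /rho /sol /fl /= clamp_id.
set r := rho _ _ x.
have -> : u t x = Complex (sol false [::] t x) (sol true [::] t x) :> R[i].
  by rewrite /sol /fl /= clamp_id//; case: (u t x).
have lapE j : cpartialx j (cpartialx j (u t)) x =
    Complex (partialx j (partialx j (fun y => part false (u t y))) x)
      (partialx j (partialx j (fun y => part true (u t y))) x) by [].
have solE c j : sol c [:: 'dx j; 'dx j] t x =
    partialx (idx j) (partialx (idx j) (fun y => part c (u t y))) x.
  by rewrite /sol /fl clamp_id.
have solT c : sol c [:: None] t x = partial T None (fun s y => part c (u s y)) t x.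
  by rewrite /sol /fl /= clamp_id.
rewrite /cpartialt /sol_lapl /lapl !lapE !solE !solT.
have h (a b c d c' d' p q : R) :
    'i%C * Complex a b + (Complex c d + Complex c' d') = Complex r 0 * Complex p q ->
    a = - (d + d') + r * q /\ b = c + c' - r * p.
  by case=> /= hr hi; split; lra.
exact: h.
Qed.

(** The time derivative of a space derivative is obtained by exchanging the
    two and differentiating the equation. *)
Lemma nls_solution_data : nls_data T (sol false [::]) (sol true [::])
  (fun j => sol false [:: 'dx j]) (fun j => sol true [:: 'dx j])
  (fun k j => sol false [:: 'dx k; 'dx j]) (fun k j => sol true [:: 'dx k; 'dx j])
  (fun j k => sol false [:: 'dx j; 'dx k; 'dx k])
  (fun j k => sol true [:: 'dx j; 'dx k; 'dx k]).
Proof.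
have f1 c j : field (sol c [:: 'dx j]).
  by case: j; [exact: (sol_field c 0 1)|exact: (sol_field c 1 0)].
have pd c s j t : pder j (sol c s t) (sol c ('dx j :: s) t) :=
  fl_pder T0 (sol_smooth c) s j t.
have td c s : tder T (sol c s) (sol c (None :: s)).
  by move=> t x tT; exact: (fl_tder (sol_smooth c) s x tT).
have tI t : 0 < t < T -> 0 <= t <= T by case/andP => ? ?; rewrite !ltW.
have pl c j t : pder j (sol_lapl c t) (lapl1 (fun j k => sol c [:: 'dx j; 'dx k; 'dx k] t) j).
  exact: (pderD (pd c _ j t) (pd c _ j t)).
have pr j t : pder j (rho (sol false [::] t) (sol true [::] t))
    (rho1 (sol false [::] t) (sol true [::] t) (fun j => sol false [:: 'dx j] t)
      (fun j => sol true [:: 'dx j] t) j).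
  have h c := pderM (pd c [::] j t) (pd c [::] j t).
  apply: pder_eq (pderD (h false) (h true)) _ => x; rewrite /rho1; ring.
have tj c j (F F' : R -> R * R -> R) :
    (forall t x, 0 < t < T -> sol c [:: None] t x = F t x) ->
    (forall t, pder j (F t) (F' t)) -> tder T (sol c [:: 'dx j]) F'.
  move=> e dF t x tT.
  have := td c [:: 'dx j] t x tT.
  rewrite /sol (fl_comm_t T0 (sol_smooth c) [::] j x tT) => h.
  apply: der_eq h _.
  rewrite -/(sol c [:: 'dx j; None] t x).
  have [_ <-] := pd c [:: None] j t x.
  have [_ <-] := dF t x.
  have -> : (fun s => sol c [:: None] t (upd j x s)) = (fun s => F t (upd j x s)).
    by apply/funext => s; exact: e.
  by [].
split.
- exact: (sol_field false 0 0).
- exact: (sol_field true 0 0).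
- by move=> j; exact: f1.
- by move=> j; exact: f1.
- by move=> j k; exact: sol_field2.
- by move=> j k; exact: sol_field2.
- by move=> j k; exact: sol_field3.
- by move=> j k; exact: sol_field3.
- by move=> j t; exact: pd.
- by move=> j t; exact: pd.
- by move=> k j t; exact: pd.
- by move=> k j t; exact: pd.
- by move=> j k t; exact: pd.
- by move=> j k t; exact: pd.
- by move=> t x; rewrite fl_swap.
- by move=> t x; rewrite fl_swap.
- move=> t x tT; apply: der_eq (td false [::] t x tT) _.
  exact: (nls_real x (tI t tT)).1.
- move=> t x tT; apply: der_eq (td true [::] t x tT) _.
  exact: (nls_real x (tI t tT)).2.
- move=> j; apply: tj => [t x tT|t]; first exact: (nls_real x (tI t tT)).1.
  apply: pderD; first exact: (pderN (pl true j t)).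
  exact: (pderM (pr j t) (pd true [::] j t)).
- move=> j; apply: tj => [t x tT|t]; first exact: (nls_real x (tI t tT)).2.
  apply: pderB; first exact: (pl false j t).
  exact: (pderM (pr j t) (pd false [::] j t)).
Qed.

End solution_fields.

(** * Plancherel's inequality *)

Section damping.
Context {R : realType}.
Local Notation mR := (measurableTypeR R).
Local Notation mu := (@lebesgue_measure R).

Variable e : R.
Hypothesis e0 : 0 < e.

Definition damp (t : R) : R := expR (- (e * `|t|)).

Lemma damp_gt0 t : 0 < damp t. Proof. exact: expR_gt0. Qed.

Lemma damp_le1 t : damp t <= 1.
Proof. by rewrite expR_le1 oppr_le0 mulr_ge0// ltW. Qed.

Lemma damp_continuous : continuous damp.
Proof.
have h : continuous (fun t : R => - (e * `|t|)).
  move=> t; apply: cvgN; apply: cvgM; first exact: cvg_cst.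
  exact: norm_continuous.
exact: (continuous_compose h (@continuous_expR R)).
Qed.

(** From [exp y >= 1 + y^2 / 4] for [y >= 0]. *)
Lemma damp_le_jw : exists2 C, 0 <= C & forall t, damp t <= C * jw t.
Proof.
exists (1 + 4 / e ^+ 2); first by rewrite addr_ge0// divr_ge0// sqr_ge0.
move=> t; rewrite /damp expRN /jw -[leLHS]mul1r -!/(_ / _).
rewrite ler_pdivrMr ?expR_gt0// mulrAC ler_pdivlMr ?oneDsq_gt0// mul1r.
have h : 1 + e ^+ 2 / 4 * t ^+ 2 <= expR (e * `|t|).
  rewrite [X in expR X](splitr (e * `|t|)) expRD.
  set y := e * `|t| / 2; have y0 : 0 <= y by rewrite divr_ge0// mulr_ge0// ltW.
  have hy : 1 + y <= expR y by exact: expR_ge1Dx.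
  have -> : e ^+ 2 / 4 * t ^+ 2 = y ^+ 2.
    by rewrite /y -(real_normK (num_real t)); field.
  apply: le_trans (_ : (1 + y) * (1 + y) <= _); first by nra.
  by apply: ler_pM => //; rewrite addr_ge0.
apply: le_trans (_ : (1 + 4 / e ^+ 2) * (1 + e ^+ 2 / 4 * t ^+ 2) <= _); last first.
  by rewrite ler_wpM2l// addr_ge0// divr_ge0// sqr_ge0.
have -> : (1 + 4 / e ^+ 2) * (1 + e ^+ 2 / 4 * t ^+ 2) =
    1 + t ^+ 2 + (4 / e ^+ 2 + e ^+ 2 / 4 * t ^+ 2).
  by field; rewrite gt_eqF.
rewrite lerDl; apply: addr_ge0; [|apply: mulr_ge0; last exact: sqr_ge0];
  by apply: divr_ge0 => //; exact: sqr_ge0.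
Qed.

(** The two parts of the complex exponential under one name. *)
Definition wave (b : bool) (s : R) : R := if b then sin s else cos s.

Lemma wave_le1 b s : `|wave b s| <= 1.
Proof.
by case: b; rewrite ler_norml ?sin_geN1 ?sin_le1 ?cos_geN1 ?cos_le1.
Qed.

Lemma wave_continuous b : continuous (wave b).
Proof. by case: b; [exact: continuous_sin|exact: continuous_cos]. Qed.

Lemma damp_wave_dominated s t : continuous (fun r => damp r * wave s (r * t)) /\
  exists C, forall r, `|damp r * wave s (r * t)| <= C * jw r.
Proof.
split.
  move=> r; apply: cvgM; first exact: damp_continuous.
  have h : continuous (fun r : R => r * t).
    by move=> x; apply: cvgM; [exact: cvg_id|exact: cvg_cst].
  exact: (continuous_compose h (@wave_continuous s)).
have [C C0 hC] := damp_le_jw; exists C => r.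
rewrite normrM ger0_norm ?(ltW (damp_gt0 _))//.
by apply: le_trans (hC r); rewrite ler_piMr ?wave_le1// ltW// damp_gt0.
Qed.

(** The Fourier transform of [exp (- e |t|)] is a Poisson kernel: the
    integrand has an explicit primitive on each half-line. *)
Lemma Rintegral_damp_wave b s :
  Rintegral mu setT (fun t => damp t * wave b (t * s)) =
  if b then 0 else 2 * (e^-1 * jw (s / e)).
Proof.
have D0 : e ^+ 2 + s ^+ 2 != 0 by rewrite gt_eqF// ltr_pwDl ?exprn_gt0 ?sqr_ge0.
have [C C0 hC] := damp_le_jw.
pose K (sg p q : R) t :=
  expR (sg * e * t) * ((p * sin (t * s) + q * cos (t * s)) / (e ^+ 2 + s ^+ 2)).
have dK sg p q t : der (K sg p q) t
   (expR (sg * e * t) * (((sg * e * p - q * s) * sin (t * s) +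
      (sg * e * q + p * s) * cos (t * s)) / (e ^+ 2 + s ^+ 2))).
  have dl (a : R) : der (fun t => a * t) t a.
    by apply: der_eq (derM (der_cst _ _) (der_id _)) _; rewrite mul0r add0r mulr1.
  have dls : der (fun t => t * s) t s.
    by apply: der_eq (derM (der_id _) (der_cst _ _)) _; rewrite mulr0 addr0 mul1r.
  have de := der_comp (dl (sg * e)) (is_derive_expR (sg * e * t)).
  have ds := der_comp dls (is_derive_sin (t * s)).
  have dc := der_comp dls (is_derive_cos (t * s)).
  have dn := derM (derD (derM (der_cst p t) ds) (derM (der_cst q t) dc))
    (der_cst (e ^+ 2 + s ^+ 2)^-1 t).
  by apply: der_eq (derM de dn) _; field.
have bK sg p q : exists C, forall t, expR (sg * e * t) <= damp t -> `|K sg p q t| <= C * jw t.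
  exists (C * ((`|p| + `|q|) / `|e ^+ 2 + s ^+ 2|)) => t ht.
  rewrite /K normrM normrM normfV ger0_norm ?expR_ge0//.
  rewrite [leRHS]mulrAC; apply: ler_pM.
  - exact: expR_ge0.
  - by rewrite divr_ge0.
  - exact: le_trans ht (hC t).
  rewrite ler_wpM2r ?invr_ge0// (le_trans (ler_normD _ _))// lerD// normrM ler_piMr//.
    exact: (wave_le1 true).
  exact: (wave_le1 false).
have [cf bf] := damp_wave_dominated b s.
have rep (sg p q : R) t : damp t = expR (sg * e * t) ->
    sg * e * p - q * s = (if b then e ^+ 2 + s ^+ 2 else 0) ->
    sg * e * q + p * s = (if b then 0 else e ^+ 2 + s ^+ 2) ->
    damp t * wave b (t * s) = (expR (sg * e * t) * (((sg * e * p - q * s) * sin (t * s) +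
      (sg * e * q + p * s) * cos (t * s)) / (e ^+ 2 + s ^+ 2))).
  by move=> -> -> ->; case: (b) => /=; field.
pose pm sg : R := if b then sg * e else s.
pose qm sg : R := if b then - s else sg * e.
have dN t : t <= 0 -> damp t = expR (1 * e * t).
  by move=> t0; rewrite /damp ler0_norm// mulrN opprK mul1r.
have dP t : 0 <= t -> damp t = expR (-1 * e * t).
  by move=> t0; rewrite /damp ger0_norm// mulN1r mulNr.
rewrite (Rintegral_FTC (dK 1 (pm 1) (qm 1)) (dK (-1) (pm (-1)) (qm (-1)))) => //.
- rewrite /K !mulr0 mul0r !expR0 sin0 cos0 /pm /qm.
  case: (b); first by field.
  by rewrite /jw; field; rewrite D0 gt_eqF.
- by move=> t t0; apply: rep; [exact: dN|rewrite /pm /qm; case: (b); ring..].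
- by move=> t t0; apply: rep; [exact: dP|rewrite /pm /qm; case: (b); ring..].
- have [D hD] := bK 1 (pm 1) (qm 1); exists D => n.
  by rewrite -(jwN n%:R); apply: hD; rewrite dN// oppr_le0.
- have [D hD] := bK (-1) (pm (-1)) (qm (-1)); exists D => n.
  by apply: hD; rewrite dP.
Qed.

End damping.

Section plancherel.
Context {R : realType}.
Local Notation mR := (measurableTypeR R).
Local Notation mu := (@lebesgue_measure R).
Implicit Types (a b c f g : R * R -> R) (x y z xi : R * R) (s : bool).

Lemma tensor_dominated f g : nice f -> nice g -> dominated w4 (fun p => f p.1 * g p.2).
Proof.
move=> nf ng; have := tri_fun_dominated (bounded_kernel_cst 1) nf ng.
by congr dominated; apply/funext => p; rewrite /tri_fun mul1r.
Qed.

Lemma I2_mul f g : nice f -> nice g -> I2 f * I2 g = I4 (fun p => f p.1 * g p.2).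
Proof.
move=> nf ng; have dom := tensor_dominated nf ng.
rewrite /I4 (Rintegral_fubini1 weight_w2 weight_w2 dom) mulrC {2}/I2 -RintegralZl//.
  apply: eq_Rintegral => x _ /=; rewrite /I2 mulrC -RintegralZl//.
  exact: (dominated_integrable weight_w2 (nice_dominated ng)).
exact: (dominated_integrable weight_w2 (nice_dominated nf)).
Qed.

Lemma I2_prod (p q : R -> R) : continuous p -> continuous q ->
  (exists C, forall t, `|p t| <= C * jw t) -> (exists C, forall t, `|q t| <= C * jw t) ->
  nice (fun x => p x.1 * q x.2) /\
  I2 (fun x => p x.1 * q x.2) = Rintegral mu setT p * Rintegral mu setT q.
Proof.
move=> cp cq bp bq.
have [C C0 hC] := dominated_const_ge0 weight_jw bp.
have [D D0 hD] := dominated_const_ge0 weight_jw bq.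
have n : nice (fun x => p x.1 * q x.2).
  split.
    move=> x; apply: cvgM.
      exact: (continuous_compose (crd_continuous (j := false)) cp).
    exact: (continuous_compose (crd_continuous (j := true)) cq).
  by exists (C * D) => x; rewrite normrM /w2 mulrACA; apply: ler_pM.
have ip : dominated jw (p : mR -> R).
  by split => //; exact: continuous_measurable_fun.
have iq : dominated jw (q : mR -> R).
  by split => //; exact: continuous_measurable_fun.
split => //; rewrite /I2 (Rintegral_fubini1 weight_jw weight_jw (nice_dominated n)).
rewrite mulrC -RintegralZl//; last exact: (dominated_integrable weight_jw ip).
apply: eq_Rintegral => t _ /=; rewrite mulrC -RintegralZl//.
exact: (dominated_integrable weight_jw iq).
Qed.

Lemma jw_bounded : exists C, forall t : R, `|jw t| <= C * jw t.
Proof. by exists 1 => t; rewrite mul1r ger0_norm// ltW// jw_gt0. Qed.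

Lemma nice_w2 : nice (@w2 R).
Proof. exact: (I2_prod (@jw_continuous R) (@jw_continuous R) jw_bounded jw_bounded).1. Qed.

Lemma dotpC x y : dotp x y = dotp y x.
Proof. by rewrite /dotp (mulrC x.1) (mulrC x.2). Qed.

Lemma wave_dotp_continuous s xi : continuous (fun x => wave s (dotp x xi)).
Proof.
have h : continuous (fun x : R * R => dotp x xi).
  by move=> x; apply: cvgD; (apply: cvgM; last exact: cvg_cst);
    [exact: cvg_fst|exact: cvg_snd].
exact: (continuous_compose h (@wave_continuous R s)).
Qed.

Lemma wave_bounded_kernel s xi : bounded_kernel (fun x => wave s (dotp x xi)).
Proof. by split; [exact: wave_dotp_continuous|exists 1 => x; exact: wave_le1]. Qed.

Definition osc s a xi : R := I2 (fun x => wave s (dotp x xi) * a x).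

Lemma osc_nice s a xi : nice a -> nice (fun x => wave s (dotp x xi) * a x).
Proof. exact: niceMl (wave_bounded_kernel s xi). Qed.

Lemma measurable_dotp :
  measurable_fun [set: (mR * mR) * (mR * mR)] (fun p => dotp p.1 p.2).
Proof.
apply: measurable_funD; apply: measurable_funM.
- exact: (measurableT_comp measurable_fst measurable_fst).
- exact: (measurableT_comp measurable_fst measurable_snd).
- exact: (measurableT_comp measurable_snd measurable_fst).
- exact: (measurableT_comp measurable_snd measurable_snd).
Qed.

Lemma measurable_wave_dotp d (S : measurableType d) s (f g : S -> mR * mR) :
  measurable_fun [set: S] f -> measurable_fun [set: S] g ->
  measurable_fun [set: S] (fun p => wave s (dotp (f p) (g p))).
Proof.
move=> mf mg; apply: measurableT_comp.
  exact: (continuous_measurable_fun (@wave_continuous R s)).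
exact: (measurableT_comp measurable_dotp (measurable_fun_pair mf mg)).
Qed.

Lemma osc_measurable s a : nice a -> measurable_fun [set: mR * mR] (osc s a).
Proof.
move=> na; have [C C0 hC] := nice_const_ge0 na.
have dom : dominated w4 (fun p => w2 p.1 * (wave s (dotp p.2 p.1) * a p.2)).
  split.
    apply: measurable_funM.
      exact: (measurableT_comp (nice_dominated (nice_w2)).1 measurable_fst).
    apply: measurable_funM.
      by apply: measurable_wave_dotp.
    exact: (measurableT_comp (nice_dominated na).1 measurable_snd).
  exists C => p; rewrite /w4 /prodw normrM mulrCA (ger0_norm (ltW (w2_gt0 p.1))).
  apply: ler_wpM2l; first exact: ltW (w2_gt0 _).
  by rewrite normrM -[leRHS]mul1r; apply: ler_pM => //; exact: wave_le1.
have [m _] := dominated_fubini1 weight_w2 weight_w2 dom.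
have -> : osc s a = (fun xi => (w2 xi)^-1 *
    Rintegral plane_measure setT (fun x => w2 xi * (wave s (dotp x xi) * a x))).
  apply/funext => xi; rewrite RintegralZl//; last first.
    exact: (dominated_integrable weight_w2 (nice_dominated (osc_nice s xi na))).
  by rewrite mulrA mulVf ?mul1r// gt_eqF// w2_gt0.
apply: measurable_funM m.
apply: (continuous2_measurable (f := fun x => (w2 x)^-1)) => x.
by apply: cvgV; [rewrite gt_eqF// w2_gt0|exact: nice_w2.1].
Qed.

Lemma dotp_sub2 x y xi : dotp (sub2 x y) xi = dotp x xi - dotp y xi.
Proof. by rewrite /dotp /sub2/=; ring. Qed.

Lemma osc_cos_mul a c xi : nice a -> nice c ->
  osc false a xi * osc false c xi + osc true a xi * osc true c xi =
  tri (fun z => cos (dotp z xi)) a c.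
Proof.
move=> na nc; have n s b (nb : nice b) := osc_nice s xi nb.
rewrite /osc !I2_mul; [|exact: n..].
rewrite -I4D; [|exact: (tensor_dominated (n _ _ _) (n _ _ _))..].
by congr I4; apply/funext => p; rewrite /tri_fun dotp_sub2 cosB /=; ring.
Qed.

Lemma osc_sin_mul a c xi : nice a -> nice c ->
  osc true a xi * osc false c xi - osc false a xi * osc true c xi =
  tri (fun z => sin (dotp z xi)) a c.
Proof.
move=> na nc; have n s b (nb : nice b) := osc_nice s xi nb.
rewrite /osc !I2_mul; [|exact: n..].
rewrite -mulN1r -I4Z; last exact: (tensor_dominated (n _ _ _) (n _ _ _)).
rewrite -I4D; [|exact: (tensor_dominated (n _ _ _) (n _ _ _))|]; last first.
  exact: (dominatedZ weight_w4 _ (tensor_dominated (n _ _ _) (n _ _ _))).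
by congr I4; apply/funext => p; rewrite /tri_fun dotp_sub2 sinB /=; ring.
Qed.

(** The squared modulus of the integral of [exp (- i x.xi) (a + i b)]. *)
Definition spec a b xi : R :=
  (osc false a xi + osc true b xi) ^+ 2 + (osc false b xi - osc true a xi) ^+ 2.

Lemma spec_ge0 a b xi : 0 <= spec a b xi.
Proof. by rewrite addr_ge0// sqr_ge0. Qed.

Lemma spec_measurable a b : nice a -> nice b ->
  measurable_fun [set: mR * mR] (spec a b).
Proof.
move=> na nb; have m s c (nc : nice c) := osc_measurable s nc.
apply: measurable_funD; apply: measurable_funX.
  by apply: measurable_funD; exact: m.
by apply: measurable_funB; exact: m.
Qed.

Lemma spec_tri a b xi : nice a -> nice b ->
  spec a b xi = tri (fun z => wave false (dotp z xi)) a a +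
    tri (fun z => wave false (dotp z xi)) b b -
    2 * tri (fun z => wave true (dotp z xi)) a b.
Proof.
move=> na nb; rewrite /wave -!osc_cos_mul// -osc_sin_mul// /spec; ring.
Qed.

(** Integration by parts: differentiation exchanges the cosine and sine
    transforms up to the factor [xi_j]. *)
Lemma osc_pder j f f' xi : nice f -> nice f' -> pder j f f' ->
  osc false f' xi = crd j xi * osc true f xi /\
  osc true f' xi = - (crd j xi * osc false f xi).
Proof.
move=> nf nf' df.
have ddot x : der (fun t => dotp (upd j x t) xi) (crd j x) (crd j xi).
  have h1 (p q t : R) : der (fun t => p * t + q) t p.
    apply: der_eq (derD (derM (der_cst p t) (der_id t)) (der_cst q t)) _.
    by rewrite mul0r add0r mulr1 addr0.
  case: (j); rewrite /upd /crd /dotp /=.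
    have := h1 xi.2 (x.1 * xi.1) x.2; congr (der _ _ _).
    by apply/funext => t; ring.
  have := h1 xi.1 (x.2 * xi.2) x.1; congr (der _ _ _).
  by apply/funext => t; ring.
have by_parts s (k' : R * R -> R) (sg : R) :
    (forall x, k' x = sg * (crd j xi * wave (~~ s) (dotp x xi))) ->
    pder j (fun x => wave s (dotp x xi)) k' ->
    osc s f' xi = - (sg * (crd j xi * osc (~~ s) f xi)).
  move=> ek dk; apply/eqP; rewrite -addr_eq0 /osc.
  have nk := osc_nice (~~ s) xi nf.
  rewrite -!I2Z//; last exact: niceZ.
  have nk2 : nice (fun x => sg * (crd j xi * (wave (~~ s) (dotp x xi) * f x))).
    by do 2 apply: niceZ.
  rewrite -I2D//; last exact: osc_nice.
  apply/eqP; apply: (@I2_pder0 _ j (fun x => wave s (dotp x xi) * f x)).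
  - exact: osc_nice.
  - by apply: niceD => //; exact: osc_nice.
  - apply: pder_eq (pderM dk df) _ => x; rewrite ek; ring.
split.
  rewrite (by_parts false (fun x => - sin (dotp x xi) * crd j xi) (-1)) /=; first ring.
    by move=> x; ring.
  by move=> x; have := der_comp (ddot x) (is_derive_cos (dotp (upd j x (crd j x)) xi));
    rewrite upd_crd.
rewrite (by_parts true (fun x => cos (dotp x xi) * crd j xi) 1) /=; first by ring.
  by move=> x; ring.
by move=> x; have := der_comp (ddot x) (is_derive_sin (dotp (upd j x (crd j x)) xi));
  rewrite upd_crd.
Qed.

Lemma spec_pder j a a' b b' xi : nice a -> nice a' -> nice b -> nice b' ->
  pder j a a' -> pder j b b' -> spec a' b' xi = crd j xi ^+ 2 * spec a b xi.
Proof.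
move=> na na' nb nb' da db; rewrite /spec.
have [-> ->] := osc_pder xi na na' da; have [-> ->] := osc_pder xi nb nb' db; ring.
Qed.

Section damped.
Variable e : R.
Hypothesis e0 : 0 < e.

Definition damp2 xi : R := damp e xi.1 * damp e xi.2.

Lemma damp2_ge0 xi : 0 <= damp2 xi.
Proof. by rewrite mulr_ge0// ltW// damp_gt0. Qed.

Lemma damp2_le1 xi : damp2 xi <= 1.
Proof. by rewrite mulr_ile1 ?damp_le1 ?(ltW (damp_gt0 _ _)). Qed.

Lemma damp2_nice : nice damp2.
Proof.
have [C C0 hC] := damp_le_jw e0.
have bd : exists C, forall t, `|damp e t| <= C * jw t.
  by exists C => t; rewrite ger0_norm// ltW// damp_gt0.
exact: (I2_prod (@damp_continuous R e) (@damp_continuous R e) bd bd).1.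
Qed.

Lemma I2_damp_wave s z : I2 (fun xi => damp2 xi * wave s (dotp z xi)) =
  if s then 0 else 4 * rescaled_kap2 jw e z.
Proof.
have prod s1 s2 := I2_prod (damp_wave_dominated e0 s1 z.1).1 (damp_wave_dominated e0 s2 z.2).1
  (damp_wave_dominated e0 s1 z.1).2 (damp_wave_dominated e0 s2 z.2).2.
have n s1 s2 := (prod s1 s2).1.
case: s => /=.
  transitivity (I2 (fun xi => damp e xi.1 * wave true (xi.1 * z.1) *
       (damp e xi.2 * wave false (xi.2 * z.2)) +
     damp e xi.1 * wave false (xi.1 * z.1) * (damp e xi.2 * wave true (xi.2 * z.2)))).
    congr I2; apply/funext => xi.
    by rewrite /dotp /damp2 (mulrC z.1) (mulrC z.2) sinD /=; ring.
  rewrite I2D ?(prod _ _).2; [|exact: n..].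
  by rewrite !(Rintegral_damp_wave e0) /= mul0r mulr0 addr0.
transitivity (I2 (fun xi => damp e xi.1 * wave false (xi.1 * z.1) *
     (damp e xi.2 * wave false (xi.2 * z.2)) + -1 *
   (damp e xi.1 * wave true (xi.1 * z.1) * (damp e xi.2 * wave true (xi.2 * z.2))))).
  congr I2; apply/funext => xi.
  by rewrite /dotp /damp2 (mulrC z.1) (mulrC z.2) cosD /=; ring.
rewrite I2D; [|exact: n|by apply: niceZ; exact: n].
rewrite I2Z ?(prod _ _).2; last exact: n.
by rewrite !(Rintegral_damp_wave e0) /= /rescaled_kap2; ring.
Qed.

(** By Fubini's theorem, a damped frequency integral of oscillating
    interactions is the interaction through the transform of the damping,
    which is a Poisson kernel for the cosine and zero for the sine. *)
Lemma damped_tri s a b : nice a -> nice b ->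
  dominated (w2 : mR * mR -> R) (fun xi => damp2 xi * tri (fun z => wave s (dotp z xi)) a b) /\
  I2 (fun xi => damp2 xi * tri (fun z => wave s (dotp z xi)) a b) =
  if s then 0 else 4 * tri (rescaled_kap2 jw e) a b.
Proof.
move=> na nb; have nd := damp2_nice; have [D D0 hD] := nice_const_ge0 nd.
(* The frequency comes first in [F], the two space variables second. *)
pose F (p : (R * R) * ((R * R) * (R * R))) : R :=
  damp2 p.1 * tri_fun (fun z => wave s (dotp z p.1)) a b p.2.
have tF xi := tri_fun_dominated (wave_bounded_kernel s xi) na nb.
have [mab [C hC]] : dominated w4 (fun p => a p.1 * b p.2) by exact: tensor_dominated.
have [C' C'0 hC'] := dominated_const_ge0 weight_w4 (ex_intro _ C hC).
have dF : dominated (prodw w2 w4) F.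
  split.
    apply: measurable_funM.
      exact: (measurableT_comp (nice_dominated nd).1 measurable_fst).
    apply: measurable_funM.
      apply: measurable_wave_dotp => //.
      exact: (measurableT_comp (@measurable_sub2 R) measurable_snd).
    exact: (measurableT_comp mab measurable_snd).
  exists (D * C') => p; rewrite /F /prodw normrM mulrACA; apply: ler_pM => //.
  rewrite /tri_fun normrM -[leRHS]mul1r; apply: ler_pM => //; exact: wave_le1.
have inner : (fun xi => damp2 xi * tri (fun z => wave s (dotp z xi)) a b) =
    (fun xi => Rintegral (sf_product plane_measure plane_measure) setT (fun p => F (xi, p))).
  by apply/funext => xi; rewrite -I4Z.
split; first by rewrite inner; exact: (dominated_fubini1 weight_w2 weight_w4 dF).
rewrite inner {inner} /I2 -(Rintegral_fubini1 weight_w2 weight_w4 dF).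
rewrite (Rintegral_fubini2 weight_w2 weight_w4 dF).
transitivity (I4 (fun p => (if s then 0 else 4 * rescaled_kap2 jw e (sub2 p.1 p.2)) *
    (a p.1 * b p.2))).
  apply: eq_Rintegral => p _; rewrite -I2_damp_wave mulrC -I2Z; last first.
    apply: nice_eq (niceMl (wave_bounded_kernel s (sub2 p.1 p.2)) nd) _ => xi.
    by rewrite dotpC mulrC.
  by congr I2; apply/funext => xi; rewrite /F /tri_fun; ring.
case: s {F dF tF}.
  by rewrite /I4 Rintegral_eq0// => p; rewrite mul0r.
rewrite /tri -I4Z; first by congr I4; apply/funext => p; rewrite /tri_fun -mulrA.
apply: tri_fun_dominated => //.
exact: (rescaled_kap2_bounded (@jw_continuous R) jw_bounded).
Qed.

Lemma I2_damped_spec a b : nice a -> nice b ->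
  I2 (fun xi => damp2 xi * spec a b xi) =
  4 * (tri (rescaled_kap2 jw e) a a + tri (rescaled_kap2 jw e) b b).
Proof.
move=> na nb.
have [daa eaa] := damped_tri false na na; have [dbb ebb] := damped_tri false nb nb.
have [dab eab] := damped_tri true na nb.
have iw f := @dominated_integrable _ _ _ _ _ weight_w2 f.
have dZ := dominatedZ weight_w2 (-2) dab; have dD := dominatedD daa dbb.
transitivity (Rintegral plane_measure setT (fun xi =>
    damp2 xi * tri (fun z => wave false (dotp z xi)) a a +
    damp2 xi * tri (fun z => wave false (dotp z xi)) b b +
    -2 * (damp2 xi * tri (fun z => wave true (dotp z xi)) a b) : R)).
  by apply: eq_Rintegral => xi _; rewrite spec_tri//; ring.
rewrite RintegralD//; [|exact: iw..].
rewrite RintegralD//; [|exact: iw..].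
rewrite RintegralZl//; last exact: iw.
by rewrite -!/(I2 _) eaa ebb eab; ring.
Qed.

Lemma damped_spec_dominated a b : nice a -> nice b ->
  dominated (w2 : mR * mR -> R) (fun xi => damp2 xi * spec a b xi).
Proof.
move=> na nb.
have [daa _] := damped_tri false na na; have [dbb _] := damped_tri false nb nb.
have [dab _] := damped_tri true na nb.
have := dominatedD (dominatedD daa dbb) (dominatedZ weight_w2 (-2) dab).
by congr dominated; apply/funext => xi; rewrite spec_tri//; ring.
Qed.

End damped.

Lemma kmass_jw_gt0 : 0 < kmass (@jw R).
Proof.
apply: lt_le_trans (@kmass_kappa_gt0 R) _; apply: le_I2.
- exact: (kap2_nice (@kappa_continuous R) (@kappa_le_jw R)).
- exact: (kap2_nice (@jw_continuous R) jw_bounded).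
- have h (t : R) : kappa t <= jw t.
    by rewrite /kappa expr2 ler_piMr ?jw_le1// ltW// jw_gt0.
  by move=> z; apply: ler_pM => //; exact: kappa_ge0.
Qed.

(** Damping the frequency integral decreases it and turns it into Poisson
    means of [a] and [b], which converge to the integral of the squares as the
    damping disappears. The factor [4 * kmass jw] is the mass of the Poisson
    kernel. *)
Lemma plancherel_le a b (S : R) : nice a -> nice b ->
  (\int[@plane_measure R]_xi (spec a b xi)%:E <= S%:E)%E ->
  4 * kmass jw * I2 (fun x => a x * a x + b x * b x) <= S.
Proof.
move=> na nb hS.
have e_gt0 n : (0 : R) < n.+1%:R^-1 by rewrite invr_gt0 ltr0n.
have ce : n.+1%:R^-1 @[n --> \oo] --> (0 : R) by exact: cvg_harmonic.
have hc c (nc : nice c) := @tri_rescale_cvg R jw (@jw_continuous R)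
  (fun t => ltW (jw_gt0 t)) jw_bounded (@jwN R) c c _ e_gt0 ce nc nc.
have lim := cvgM (@cvg_cst _ (4 : R) nat \oo _) (cvgD (hc a na) (hc b nb)).
have {lim} c1 : (fun n => 4 * (tri (rescaled_kap2 jw n.+1%:R^-1) a a +
    tri (rescaled_kap2 jw n.+1%:R^-1) b b)) @ \oo -->
    4 * (kmass jw * I2 (fun x => a x * a x) + kmass jw * I2 (fun x => b x * b x)).
  exact: (lim _ _).
rewrite I2D; [|exact: niceM..].
rewrite -mulrA mulrDr -(cvg_lim _ c1)//.
apply: limr_le; first exact: cvgP c1.
apply: nearW => n; rewrite -I2_damped_spec//.
have dom := damped_spec_dominated (e_gt0 n) na nb.
rewrite -lee_fin /I2 (dominated_EFin_Rintegral weight_w2 dom).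
apply: le_trans hS; apply: ge0_le_integral => //.
- by move=> xi _; rewrite lee_fin mulr_ge0 ?damp2_ge0 ?spec_ge0.
- by apply/measurable_EFinP; case: dom.
- by apply/measurable_EFinP; exact: spec_measurable.
- by move=> xi _; rewrite lee_fin ler_piMl ?spec_ge0 ?damp2_le1.
Qed.

Lemma measurable_enorm_sq :
  measurable_fun [set: mR * mR] (fun xi : mR * mR => enorm xi ^+ 2).
Proof.
have -> : (fun xi : mR * mR => enorm xi ^+ 2) = (fun xi => xi.1 ^+ 2 + xi.2 ^+ 2).
  by apply/funext => xi; rewrite /enorm sqr_sqrtr// addr_ge0 ?sqr_ge0.
by apply: measurable_funD; apply: measurable_funX.
Qed.

Lemma dirichlet_le j a a' b b' (S : R) :
  nice a -> nice a' -> nice b -> nice b' -> pder j a a' -> pder j b b' ->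
  (\int[@plane_measure R]_xi ((enorm xi ^+ 2) * spec a b xi)%:E <= S%:E)%E ->
  4 * kmass jw * I2 (fun x => a' x * a' x + b' x * b' x) <= S.
Proof.
move=> na na' nb nb' da db hS; apply: plancherel_le => //; apply: le_trans hS.
apply: ge0_le_integral => //.
- by move=> xi _; rewrite lee_fin spec_ge0.
- by apply/measurable_EFinP; exact: spec_measurable.
- apply/measurable_EFinP; apply: measurable_funM; last exact: spec_measurable.
  exact: measurable_enorm_sq.
- move=> xi _; rewrite lee_fin (spec_pder _ na na' nb nb' da db).
  rewrite ler_wpM2r ?spec_ge0// /enorm sqr_sqrtr ?addr_ge0 ?sqr_ge0//.
  by case: (j); rewrite /crd ?lerDl ?lerDr sqr_ge0.
Qed.

End plancherel.

(** * Norms of the solution *)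

Local Open Scope complex_scope.

Section norms.
Context {R : realType}.
Local Notation mR := (measurableTypeR R).
Local Notation mu := (@lebesgue_measure R).

Lemma poweR_expe (x : \bar R) n : (0 <= x)%E -> (x `^ n.+1%:R = x ^+ n.+1)%E.
Proof.
case: x => [r|_|//]; first by rewrite lee_fin => r0; rewrite poweR_EFin powR_mulrn// EFin_expe.
rewrite poweRyr ?pnatr_eq0//; elim: n => [//|n IH].
by rewrite expeS -IH.
Qed.

Lemma Lnorm_expe d (S : measurableType d) (m : {measure set S -> \bar R}) n
    (F : S -> \bar R) :
  ('N[m]_(n.+1%:R%:E)[F] ^+ n.+1 = \int[m]_x (`|F x| ^+ n.+1))%E.
Proof.
rewrite unlock -poweR_expe ?poweR_ge0// -poweRrM mulVf ?pnatr_eq0// poweRe1.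
  by apply: eq_integral => x _; rewrite poweR_expe.
by apply: integral_ge0 => x _; exact: poweR_ge0.
Qed.

Lemma normc_ge0 (z : R[i]) : 0 <= Normc.normc z.
Proof. by case: z => a b; exact: sqrtr_ge0. Qed.

(** Raising to the power [p] removes the root in the norm, also when it is
    infinite. *)
Lemma LpNorm_expe n (f : R * R -> R[i]) :
  (LpNorm n.+1%:R%:E f ^+ n.+1 =
   \int[@plane_measure R]_x ((Normc.normc (f x)) ^+ n.+1)%:E)%E.
Proof.
rewrite /LpNorm Lnorm_expe; apply: eq_integral => x _ /=.
by rewrite ger0_norm ?normc_ge0// EFin_expe.
Qed.

Lemma LqtNorm_expe T n (g : R -> \bar R) : (forall t, 0 <= g t)%E ->
  (LqtNorm T n.+1%:R%:E g ^+ n.+1 = \int[mu]_t ((wT T t)%:E * g t ^+ n.+1))%E.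
Proof.
move=> g0; rewrite /LqtNorm Lnorm_expe; apply: eq_integral => t _.
rewrite /wT indicE patchE; case: ifPn => _.
  by rewrite mul1e gee0_abs.
by rewrite mul0e abse0 expeS mul0e.
Qed.

Lemma normc_sq (a b : R) : Normc.normc (Complex a b) ^+ 2 = a ^+ 2 + b ^+ 2.
Proof. by rewrite /= sqr_sqrtr// addr_ge0 ?sqr_ge0. Qed.

Lemma fourier_spec (f : R * R -> R[i]) xi :
  nice (fun x => complex.Re (f x)) -> nice (fun x => complex.Im (f x)) ->
  Normc.normc ((enorm xi)%:C * fourier f xi) ^+ 2 =
  (2 * pi) ^- 2 * (enorm xi ^+ 2 *
    spec (fun x => complex.Re (f x)) (fun x => complex.Im (f x)) xi).
Proof.
move=> na nb; have n s b (nb : nice b) := osc_nice s xi nb.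
have eR x : complex.Re (expi (- dotp x xi) * f x) =
    wave false (dotp x xi) * complex.Re (f x) + wave true (dotp x xi) * complex.Im (f x).
  by case: (f x) => p q; rewrite /expi /= cosN sinN; ring.
have eI x : complex.Im (expi (- dotp x xi) * f x) =
    wave false (dotp x xi) * complex.Im (f x) + -1 * (wave true (dotp x xi) * complex.Re (f x)).
  by case: (f x) => p q; rewrite /expi /= cosN sinN; ring.
have e1 : Rintegral plane_measure setT (fun x => complex.Re (expi (- dotp x xi) * f x)) =
    osc false (fun x => complex.Re (f x)) xi + osc true (fun x => complex.Im (f x)) xi.
  by rewrite /osc -I2D; [|exact: n..]; apply: eq_Rintegral => x _; rewrite eR.
have e2 : Rintegral plane_measure setT (fun x => complex.Im (expi (- dotp x xi) * f x)) =
    osc false (fun x => complex.Im (f x)) xi - osc true (fun x => complex.Re (f x)) xi.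
  rewrite -[X in _ - X]mul1r -mulNr /osc -I2Z; last exact: n.
  rewrite -I2D; [|exact: n|by apply: niceZ; exact: n].
  by apply: eq_Rintegral => x _; rewrite eI.
rewrite /fourier [X in Complex X _]e1 [X in Complex _ X]e2 /spec.
set p := _ + _; set q := _ - _.
have -> : (enorm xi)%:C * ((2 * pi)^-1%:C * Complex p q) =
    Complex (enorm xi * (2 * pi)^-1 * p) (enorm xi * (2 * pi)^-1 * q).
  by apply/eqP; rewrite eq_complex /=; apply/andP; split; apply/eqP; ring.
rewrite normc_sq -exprVn; ring.
Qed.

Lemma H1dotNorm_expe (f : R * R -> R[i]) :
  nice (fun x => complex.Re (f x)) -> nice (fun x => complex.Im (f x)) ->
  (H1dotNorm f ^+ 2 = ((2 * pi) ^- 2)%:E * \int[@plane_measure R]_xi (enorm xi ^+ 2 *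
    spec (fun x => complex.Re (f x)) (fun x => complex.Im (f x)) xi)%:E)%E.
Proof.
move=> na nb; rewrite /H1dotNorm (LpNorm_expe 1) -ge0_integralZl//.
- by apply: eq_integral => xi _; rewrite fourier_spec// EFinM.
- apply/measurable_EFinP; apply: measurable_funM; last exact: spec_measurable.
  exact: measurable_enorm_sq.
- by move=> xi _; rewrite lee_fin mulr_ge0 ?spec_ge0 ?sqr_ge0.
- by rewrite lee_fin invr_ge0 sqr_ge0.
Qed.

End norms.

Section assembly.
Context {R : realType}.
Local Notation mR := (measurableTypeR R).
Local Notation mu := (@lebesgue_measure R).

Lemma lee_expe (x y : \bar R) n : (0 <= x -> x <= y -> x ^+ n <= y ^+ n)%E.
Proof.
move=> x0 xy; elim: n => [//|n IH].
rewrite !expeS; apply: lee_pmul => //; exact: expe_ge0.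
Qed.

Lemma I2_field_continuous (a : R -> R * R -> R) : field a -> continuous (fun t => I2 (a t)).
Proof.
move=> fa; have [C hC] := fa.2 => t; apply/(@cvg_nbhsP _ R^o) => s cs.
apply: (Rintegral_dct weight_w2 (C := C)).
- by move=> n; exact: (nice_dominated (field_nice (s n) fa)).1.
- by move=> n x; exact: hC.
- move=> x; have ct := @field_time_continuous R a x fa t.
  exact: (cvg_comp s (a^~ x) cs ct).
Qed.

Variables (T : R) (u : R -> R * R -> R[i]).
Hypothesis T0 : 0 < T.
Hypothesis su : Linfty_schwartz T u.
Hypothesis nls : smooth_NLS_solution T u.

Let a := sol T u false [::].
Let b := sol T u true [::].
Let a1 j := sol T u false [:: Some (idx j)].
Let b1 j := sol T u true [:: Some (idx j)].
Let data := nls_solution_data T0 su nls.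

Lemma sol_part t : 0 <= t <= T ->
  a t = (fun x => complex.Re (u t x)) /\ b t = (fun x => complex.Im (u t x)).
Proof. by move=> tT; rewrite /a /b /sol /fl /= clamp_id. Qed.

Lemma nice_sol t : nice (a t) /\ nice (b t).
Proof. by split; apply: field_nice; [exact: (nls_u data)|exact: (nls_v data)]. Qed.

Lemma normc_rhoT t x : 0 <= t <= T -> Normc.normc (u t x) ^+ 2 = rhoT a b t x.
Proof.
move=> tT; rewrite /rhoT /rho; have [-> ->] := sol_part tT.
by case: (u t x) => p q; rewrite normc_sq.
Qed.

Lemma LpNorm2_rhoT t : 0 <= t <= T -> (LpNorm 2%:E (u t) ^+ 2 = (I2 (rhoT a b t))%:E)%E.
Proof.
move=> tT; rewrite (LpNorm_expe 1).
rewrite /I2 (dominated_EFin_Rintegral weight_w2); last first.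
  by apply: nice_dominated; apply: field_nice; exact: (field_rho data).
by apply: eq_integral => x _; rewrite normc_rhoT.
Qed.

Lemma LqtNorm4_rhoT :
  (LqtNorm T 4%:E (fun t => LpNorm 4%:E (u t)) ^+ 4 =
   (IT T (fun t => I2 (fun x => rhoT a b t x ^+ 2)))%:E)%E.
Proof.
have fr2 : field (fun t x => rhoT a b t x ^+ 2).
  by apply: fieldM; exact: (field_rho data).
rewrite (LqtNorm_expe T 3); last by move=> t; exact: Lnorm_ge0.
rewrite /IT (dominated_EFin_Rintegral (weight_wT T) (I2_field_dominated T fr2)).
apply: eq_integral => t _; rewrite EFinM (LpNorm_expe 3).
rewrite /wT indicE; case: (boolP (t \in _)); last by rewrite !mul0e.
rewrite inE /= in_itv /= => tT; rewrite !mul1e.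
rewrite /I2 (dominated_EFin_Rintegral weight_w2); last first.
  by apply: nice_dominated; exact: (field_nice t fr2).
by apply: eq_integral => x _; rewrite -normc_rhoT// -exprM.
Qed.

(** A bound on [I2 (f t)] by [N t] passes to the essential supremum [K] of [N]
    at almost every time, hence at every time by continuity. *)
Lemma ae_field_le (f : R -> R * R -> R) (N : R -> \bar R) (n : nat) (c K : R) :
  field f -> (forall t, 0 <= N t)%E -> LqtNorm T +oo N = K%:E ->
  (forall t : R, 0 <= t <= T -> forall k : R, (N t <= k%:E)%E -> 0 <= k ->
    I2 (f t) <= c * k ^+ n) ->
  forall t : R, 0 <= t <= T -> I2 (f t) <= c * K ^+ n.
Proof.
move=> ff N0 eK h; apply: (continuous_ae_le T0 (I2_field_continuous ff)).
have K0 : 0 <= K by rewrite -lee_fin -eK; exact: Lnorm_ge0.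
have := LqtNorm_oo_ae T0 N0.
apply: (@filterS _ _ (ae_filter_ringOfSetsType mu)) => t ht tT.
by apply: h => //; rewrite -eK; exact: ht.
Qed.

Lemma mass_le (A : R) : LqtNorm T +oo (fun t => LpNorm 2%:E (u t)) = A%:E ->
  forall t : R, 0 <= t <= T -> I2 (rhoT a b t) <= A ^+ 2.
Proof.
move=> eA t tT; rewrite -[leRHS]mul1r.
move: t tT; apply: ae_field_le (field_rho data) _ eA _; first by move=> t; exact: Lnorm_ge0.
move=> t tT k hk k0; rewrite mul1r -lee_fin -LpNorm2_rhoT// EFin_expe.
by apply: lee_expe hk; exact: Lnorm_ge0.
Qed.

Lemma field_en j : field (fun t => en (a1^~ t) (b1^~ t) j j).
Proof.
have h1 := nls_u1 data j; have h2 := nls_v1 data j.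
exact: (fieldD (fieldM h1 h1) (fieldM h2 h2)).
Qed.

Lemma kin_le (G : R) : LqtNorm T +oo (fun t => H1dotNorm (u t)) = G%:E ->
  forall j (t : R), 0 <= t <= T -> kin a1 b1 j t <= ((2 * pi) ^+ 2 / (4 * kmass jw)) * G ^+ 2.
Proof.
move=> eG j; pose f t := en (a1^~ t) (b1^~ t) j j.
have ff : field f := field_en j.
apply: (ae_field_le ff) eG _; first by move=> t; exact: Lnorm_ge0.
move=> t tT k hk k0.
have [na nb] := nice_sol t.
have m0 : 0 < 4 * kmass (@jw R) by rewrite mulr_gt0 ?kmass_jw_gt0.
have p0 : 0 < (2 * pi) ^+ 2 :> R by rewrite exprn_gt0// mulr_gt0 ?pi_gt0.
rewrite mulrAC ler_pdivlMr// mulrC.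
apply: (dirichlet_le (j := j) (a := a t) (b := b t)) => //.
- exact: (field_nice t (nls_u1 data j)).
- exact: (field_nice t (nls_v1 data j)).
- exact: (nls_du data j t).
- exact: (nls_dv data j t).
have h : (H1dotNorm (u t) ^+ 2 <= (k ^+ 2)%:E)%E.
  by rewrite EFin_expe; apply: lee_expe hk; exact: Lnorm_ge0.
have [ea eb] := sol_part tT.
rewrite H1dotNorm_expe -?ea -?eb// in h.
by rewrite lee_pdivrMl// -EFinM in h.
Qed.

(** A finite bound on the Dirichlet energy that remains available when the
    essential supremum of the homogeneous Sobolev norm is infinite. *)
Lemma kin_bounded : exists2 K, 0 <= K & forall j (t : R), 0 <= t <= T -> kin a1 b1 j t <= K.
Proof.
have ff := field_en.
have h j : exists K, forall t : R, kin a1 b1 j t <= K.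
  have [C hC] := (ff j).2; exists (C * I2 w2) => t.
  rewrite -I2Z; last exact: nice_w2.
  apply: le_I2; [exact: (field_nice t (ff j))|by apply: niceZ; exact: nice_w2|].
  by move=> x; apply: le_trans (ler_norm _) (hC t x).
have [K0 h0] := h false; have [K1 h1] := h true.
exists (Num.max 0 (Num.max K0 K1)); first by rewrite le_max lexx.
move=> -[] t _.
  by apply: le_trans (h1 t) _; rewrite !le_max lexx !orbT.
by apply: le_trans (h0 t) _; rewrite !le_max lexx orbT.
Qed.

Lemma L4_bound (A G G2 : R) : 0 <= A -> 0 <= G -> G ^+ 2 = G2 ->
  (forall t : R, 0 <= t <= T -> I2 (rhoT a b t) <= A ^+ 2) ->
  (forall j (t : R), 0 <= t <= T -> kin a1 b1 j t <= G2) ->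
  kmass kappa * IT T (fun t => I2 (fun x => rhoT a b t x ^+ 2)) <=
  T `^ 3^-1 * (16 * A ^+ 3 * G + 4 * A ^+ 4).
Proof.
move=> A0 G0 <- hA hG; apply: (nls_L4_bound T0 data) => //.
- by rewrite powR_gt0.
- by rewrite -powR_mulrn ?powR_ge0// -powRrM mulVf ?pnatr_eq0// powRr1// ltW.
Qed.

End assembly.

Theorem mainTheorem3 (R : realType) :
  exists C : R, 0 < C /\
    forall (T : R) (u : R -> R * R -> R[i]),
      0 < T ->
      Linfty_schwartz T u ->
      smooth_NLS_solution T u ->
      (LqtNorm T 4%:E (fun t => LpNorm 4%:E (u t)) ^+ 4 <=
       C%:E *
         ((T `^ 3^-1)%:E * LqtNorm T +oo (fun t => LpNorm 2%:E (u t)) ^+ 3 *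
            LqtNorm T +oo (fun t => H1dotNorm (u t)) +
          (T `^ 3^-1)%:E *
            LqtNorm T +oo (fun t => LpNorm 2%:E (u t)) ^+ 4))%E.
Proof.
have k0 : 0 < kmass (@kappa R) by exact: kmass_kappa_gt0.
pose q2 : R := (2 * pi) ^+ 2 / (4 * kmass jw).
have q20 : 0 <= q2.
  by rewrite divr_ge0 ?sqr_ge0// mulr_ge0// ltW// kmass_jw_gt0.
pose q := Num.sqrt q2; have q0 : 0 <= q by exact: sqrtr_ge0.
pose C := (16 * q + 4) / kmass kappa.
have C0 : 0 < C by rewrite divr_gt0// ltr_wpDl// mulr_ge0.
exists C; split=> // T u T0 su nls.
have M0 : 0 < T `^ 3^-1 by rewrite powR_gt0.
rewrite (LqtNorm4_rhoT T0 su nls).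
set I := IT _ _.
have bound := L4_bound T0 su nls.
have m := mass_le T0 su nls; have kk := kin_le T0 su nls.
have [K K0 hK] := kin_bounded T0 su nls.
set Ae := LqtNorm T +oo (fun t => LpNorm 2%:E (u t)) in m *.
set Be := LqtNorm T +oo (fun t => H1dotNorm (u t)) in kk *.
have Ae0 : (0 <= Ae)%E by exact: Lnorm_ge0.
have Be0 : (0 <= Be)%E by exact: Lnorm_ge0.
have M0e : (0 <= (T `^ 3^-1)%:E)%E by rewrite lee_fin ltW.
have C0e : (0 <= C%:E)%E by rewrite lee_fin ltW.
have Xge0 : (0 <= (T `^ 3^-1)%:E * Ae ^+ 3 * Be)%E.
  by apply: mule_ge0 => //; apply: mule_ge0 => //; exact: expe_ge0.
have Yge0 : (0 <= (T `^ 3^-1)%:E * Ae ^+ 4)%E.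
  by apply: mule_ge0 => //; exact: expe_ge0.
(* With an infinite mass bound the second term on the right is infinite. *)
have [Aoo|Afin] := eqVneq Ae +oo%E.
  have -> : ((T `^ 3^-1)%:E * Ae ^+ 4 = +oo)%E.
    by rewrite Aoo !expeS expe0 mule1 !gt0_muley ?ltry ?lte_fin.
  rewrite addey; last by move: Xge0; case: (_ * Be)%E.
  by rewrite gt0_muley ?lte_fin// leey.
have [A eA] : exists A, Ae = A%:E.
  by exists (fine Ae); rewrite fineK// ge0_fin_numE// ltey.
have A0 : 0 <= A by rewrite -lee_fin -eA.
have {}m := m A eA.
(* Both bounds finite: the constant of Plancherel's inequality enters through [q]. *)
have [Boo|Bfin] := eqVneq Be +oo%E; last first.
  have [B eB] : exists B, Be = B%:E.
    by exists (fine Be); rewrite fineK// ge0_fin_numE// ltey.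
  have B0 : 0 <= B by rewrite -lee_fin -eB.
  have qB : (q * B) ^+ 2 = q2 * B ^+ 2 by rewrite exprMn sqr_sqrtr.
  have h := bound A (q * B) _ A0 (mulr_ge0 q0 B0) qB m (kk B eB).
  have -> : (C%:E * ((T `^ 3^-1)%:E * Ae ^+ 3 * Be + (T `^ 3^-1)%:E * Ae ^+ 4) =
      (C * (T `^ 3^-1 * A ^+ 3 * B + T `^ 3^-1 * A ^+ 4))%:E)%E.
    by rewrite eA eB -!EFin_expe.
  rewrite lee_fin.
  rewrite /C mulrAC ler_pdivlMr// mulrC; apply: (le_trans h).
  have h1 : 0 <= T `^ 3^-1 * A ^+ 3 * B.
    by rewrite mulr_ge0// mulr_ge0 ?exprn_ge0// ltW.
  have h2 : 0 <= T `^ 3^-1 * A ^+ 4 by rewrite mulr_ge0 ?exprn_ge0// ltW.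
  have h3 := mulr_ge0 q0 h2; nra.
(* The product of a zero mass and an infinite Sobolev norm is 0, so the left-hand
   side has to vanish; any finite bound on the Dirichlet energy shows it. *)
have [A00|An0] := eqVneq A 0.
  have := bound A (Num.sqrt K) _ A0 (sqrtr_ge0 _) (sqr_sqrtr K0) m hK.
  rewrite A00 !expr0n /= mulr0 mul0r mulr0 addr0 mulr0 => h.
  apply: le_trans (_ : 0 <= _)%E; last by apply: mule_ge0 => //; exact: adde_ge0.
  by rewrite lee_fin -(pmulr_rle0 _ k0).
have Ap : 0 < A by rewrite lt_neqAle eq_sym An0.
have -> : ((T `^ 3^-1)%:E * Ae ^+ 3 * Be = +oo)%E.
  by rewrite Boo eA -EFin_expe -EFinM gt0_muley// lte_fin mulr_gt0// exprn_gt0.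
rewrite addye; last by move: Yge0; case: (_ * _ ^+ 4)%E.
by rewrite gt0_muley ?lte_fin// leey.
Qed.
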